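(* Let $E\subseteq\mathbf R^d$ be a non-degenerate parallelepiped, $s>0$, $t>0$, and $\phi\in\mathcal S_t^s(\mathbf R^d)\setminus\{0\}$ (resp. $\phi\in\Sigma_t^s(\mathbf R^d)\setminus\{0\}$). Let $f$ be an $E$-periodic Gelfand–Shilov distribution on $\mathbf R^d$ for which $V_\phi f$ is defined. Then: (1) $f\in(\mathcal E_s^E)'(\mathbf R^d)$ (resp. $f\in(\mathcal E_{0,s}^E)'(\mathbf R^d)$) if and only if $|V_\phi f(x,\xi)|\lesssim e^{r|\xi|^{1/s}}$ for every $r>0$ (resp. for some $r>0$); (2) $f\in\mathcal E_s^E(\mathbf R^d)$ (resp. $f\in\mathcal E_{0,s}^E(\mathbf R^d)$) if and only if $|V_\phi f(x,\xi)|\lesssim e^{-r|\xi|^{1/s}}$ for some $r>0$ (resp. for every $r>0$).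
   Context: Gelfand–Shilov spaces: for $s,t>0$, $\mathcal S_t^s(\mathbf R^d)$ is the set of $f\in C^\infty(\mathbf R^d)$ with $\sup_{\alpha,\beta,x}\frac{|x^\beta\partial^\alpha f(x)|}{h^{|\alpha+\beta|}\alpha!^s\beta!^t}<\infty$ for some $h>0$; $\Sigma_t^s(\mathbf R^d)$ requires this for every $h>0$; their duals are Gelfand–Shilov distribution spaces. A Gelfand–Shilov distribution here means an element of some such dual space (e.g. of $(\mathcal S_{t_0}^{s_0})'(\mathbf R^d)$ with $\mathcal S_t^s\subseteq\mathcal S_{t_0}^{s_0}$), so that $V_\phi f(x,\xi)=\mathscr F(f\,\overline{\phi(\cdot-x)})(\xi)$ is defined, where $\widehat g(\xi)=(2\pi)^{-d/2}\int g(x)e^{-i\langle x,\xi\rangle}dx$. $A\lesssim B$ means $A\le cB$ for a constant $c>0$ independent of $(x,\xi)$. $E=\{\sum x_ke_k:0\le x_k\le1\}$ for a basis $e_1,\dots,e_d$, $\Lambda_E=\sum\mathbf Ze_k$; $f$ is $E$-periodic if $f(\cdot+j)=f$ for all $j\in\Lambda_E$. Gevrey classes: for $s\ge0$, $\mathcal E_s(\mathbf R^d)$ (resp. $\mathcal E_{0,s}(\mathbf R^d)$) consists of $f\in C^\infty$ such that for every compact $K$, $\sup_\alpha\|\partial^\alpha f\|_{L^\infty(K)}/(h^{|\alpha|}\alpha!^s)<\infty$ for some (resp. every) $h>0$; $\mathcal E_s^E$, $\mathcal E_{0,s}^E$ denote their $E$-periodic elements and $(\mathcal E_s^E)'$,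 $(\mathcal E_{0,s}^E)'$ their duals. The dual $(\mathcal E_s^E)'$ (resp. $(\mathcal E_{0,s}^E)'$) is identified with formal series $\sum_{\alpha\in\Lambda'_E}c(\alpha)e^{i\langle\cdot,\alpha\rangle}$ ($\Lambda'_E$ the dual lattice, $\langle e_j,e'_k\rangle=2\pi\delta_{jk}$) with $|c(\alpha)|\lesssim e^{\varepsilon|\alpha|^{1/s}}$ for every (resp. some) $\varepsilon>0$, which act on $\phi$ as $\langle f,\phi\rangle=(2\pi)^{d/2}\sum_\alpha c(\alpha)\widehat\phi(-\alpha)$. *)

(* Defs.v *)
From HB Require Import structures.
From mathcomp Require Import all_boot all_order all_algebra.
From mathcomp Require Import all_classical all_reals all_analysis.
From mathcomp Require Import complex.

Set Implicit Arguments.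
Unset Strict Implicit.
Unset Printing Implicit Defensive.

Import Order.TTheory GRing.Theory Num.Theory.
Import numFieldNormedType.Exports.

Local Open Scope ring_scope.
Local Open Scope classical_set_scope.

Section GS.
Context {R : realType} {d : nat}.

Local Notation vec := 'rV[R]_d.
Local Notation C := R[i].

Definition inner (x y : vec) : R := \sum_(j < d) x 0 j * y 0 j.
Definition enorm (x : vec) : R := Num.sqrt (\sum_(j < d) x 0 j ^+ 2).

Definition cabs (z : C) : R := Num.sqrt (complex.Re z ^+ 2 + complex.Im z ^+ 2).
Definition cexpi (th : R) : C := (cos th +i* sin th)%C.
Definition Rc (x : R) : C := (x +i* 0)%C.

Definition mabs (a : 'I_d -> nat) : nat := (\sum_(j < d) a j)%N.
Definition mfact (a : 'I_d -> nat) : nat := (\prod_(j < d) (a j)`!)%N.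
Definition xpow (x : vec) (b : 'I_d -> nat) : R := \prod_(j < d) x 0 j ^+ b j.

Definition ej (j : 'I_d) : vec := delta_mx 0 j.
Definition partial (j : 'I_d) (g : vec -> R) : vec -> R :=
  fun x => 'D_(ej j) g x.
Definition partials (l : seq 'I_d) (g : vec -> R) : vec -> R :=
  foldr partial g l.
Definition mpartial (a : 'I_d -> nat) (g : vec -> R) : vec -> R :=
  foldr (fun j h => iter (a j) (partial j) h) g (enum 'I_d).

Definition smoothR (g : vec -> R) : Prop :=
  forall (l : seq 'I_d) (x : vec), differentiable (partials l g) x.

Definition reF (F : vec -> C) : vec -> R := fun x => complex.Re (F x).
Definition imF (F : vec -> C) : vec -> R := fun x => complex.Im (F x).

Definition smoothC (F : vec -> C) : Prop := smoothR (reF F) /\ smoothR (imF F).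
Definition mpartialC (a : 'I_d -> nat) (F : vec -> C) : vec -> C :=
  fun x => (mpartial a (reF F) x +i* mpartial a (imF F) x)%C.

Definition GSbound (s t h M : R) (F : vec -> C) : Prop :=
  forall (a b : 'I_d -> nat) (x : vec),
    `|xpow x b| * cabs (mpartialC a F x) <=
      M * h ^+ (mabs a + mabs b) * ((mfact a)%:R `^ s) * ((mfact b)%:R `^ t).

Definition inGS (sig : bool) (s t : R) (F : vec -> C) : Prop :=
  smoothC F /\
  if sig then forall h, 0 < h -> exists M, GSbound s t h M F
  else exists h, 0 < h /\ exists M, GSbound s t h M F.

(* continuous linear functionals on S_t^s (inductive limit) resp.
   Sigma_t^s (projective limit); the functional is a map on all functions,
   only its values on the test space matter *)
Definition GSlinear (sig : bool) (s t : R) (u : (vec -> C) -> C) : Prop :=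
  forall (a b : C) (psi chi : vec -> C),
    inGS sig s t psi -> inGS sig s t chi ->
    u (fun y => a * psi y + b * chi y) = a * u psi + b * u chi.

Definition GScont (sig : bool) (s t : R) (u : (vec -> C) -> C) : Prop :=
  if sig then
    exists h, 0 < h /\ exists K : R, forall (psi : vec -> C) (M : R),
      inGS true s t psi -> GSbound s t h M psi -> cabs (u psi) <= K * M
  else
    forall h, 0 < h -> exists K : R, forall (psi : vec -> C) (M : R),
      smoothC psi -> GSbound s t h M psi -> cabs (u psi) <= K * M.

Definition GSdist (sig : bool) (s t : R) (u : (vec -> C) -> C) : Prop :=
  0 < s /\ 0 < t /\ GSlinear sig s t u /\ GScont sig s t u.

Definition STFT (u : (vec -> C) -> C) (phi : vec -> C) (x xi : vec) : C :=
  Rc ((2 * pi) `^ (- (d%:R / 2))) *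
  u (fun y => conjc (phi (y - x)) * cexpi (- inner y xi)).

(* B is the matrix whose rows are the basis vectors e_1, ..., e_d of E *)
Definition intvec (k : 'rV[int]_d) : vec := map_mx (fun z : int => z%:~R) k.
Definition latt (B : 'M[R]_d) (k : 'rV[int]_d) : vec := intvec k *m B.
(* dual lattice Lambda'_E, with <e_j, e'_k> = 2 pi delta_jk :
   the e'_k are the rows of 2 pi (B^{-1})^T *)
Definition dlatt (B : 'M[R]_d) (k : 'rV[int]_d) : vec :=
  intvec k *m ((2 * pi) *: (invmx B)^T).

(* E-periodic distribution: f(. + j) = f for j in Lambda_E, i.e.
   <f, psi(. - j)> = <f, psi> for all test functions psi *)
Definition periodic_dist (B : 'M[R]_d) (T : (vec -> C) -> Prop)
    (u : (vec -> C) -> C) : Prop :=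
  forall (k : 'rV[int]_d) (psi : vec -> C), T psi ->
    u (fun y => psi (y - latt B k)) = u psi.

Definition periodic_fun (B : 'M[R]_d) (F : vec -> C) : Prop :=
  forall (k : 'rV[int]_d) (y : vec), F (y + latt B k) = F y.

Fixpoint intd (n : nat) (g : (nat -> R) -> R) : R :=
  match n with
  | 0 => g (fun _ => 0)
  | n'.+1 => Rintegral (@lebesgue_measure R) setT
      (fun y : R => intd n' (fun v => g (fun i => if i == n' then y else v i)))
  end.

Definition intRd (g : vec -> R) : R := intd d (fun v => g (\row_j v (nat_of_ord j))).
Definition intC (F : vec -> C) : C := (intRd (reF F) +i* intRd (imF F))%C.

Definition fourier (psi : vec -> C) (eta : vec) : C :=
  Rc ((2 * pi) `^ (- (d%:R / 2))) * intC (fun y => psi y * cexpi (- inner y eta)).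

Definition boxpt (N : nat) (k : {ffun 'I_d -> 'I_(N.*2.+1)}) : 'rV[int]_d :=
  \row_j ((k j : nat)%:Z - N%:Z).
Definition boxsum (N : nat) (a : 'rV[int]_d -> C) : C :=
  \sum_(k : {ffun 'I_d -> 'I_(N.*2.+1)}) a (boxpt k).
Definition ccvg (v : nat -> C) (L : C) : Prop :=
  forall e : R, 0 < e -> exists N0 : nat, forall N, (N0 <= N)%N -> cabs (v N - L) < e.

(* f in (E_s^E)' (every = true) resp. (E_{0,s}^E)' (every = false):
   f = sum_{alpha in Lambda'_E} c(alpha) e^{i<., alpha>}, with
   |c(alpha)| <~ e^{eps |alpha|^{1/s}} for every (resp. some) eps > 0,
   acting as <f, psi> = (2 pi)^{d/2} sum_alpha c(alpha) psihat(-alpha);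
   c is indexed by k in Z^d via alpha = dlatt B k. *)
Definition coef_growth (B : 'M[R]_d) (s eps : R) (c : 'rV[int]_d -> C) : Prop :=
  exists K : R, forall k, cabs (c k) <= K * expR (eps * enorm (dlatt B k) `^ (1 / s)).

Definition in_dual_Gevrey (every : bool) (B : 'M[R]_d) (s : R)
    (T : (vec -> C) -> Prop) (u : (vec -> C) -> C) : Prop :=
  exists c : 'rV[int]_d -> C,
    (if every then forall eps, 0 < eps -> coef_growth B s eps c
     else exists eps, 0 < eps /\ coef_growth B s eps c) /\
    forall psi, T psi ->
      ccvg (fun N => Rc ((2 * pi) `^ (d%:R / 2)) *
                      boxsum N (fun k => c k * fourier psi (- dlatt B k)))
           (u psi).

Definition gevrey_on (s h : R) (K : set vec) (F : vec -> C) : Prop :=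
  exists M : R, forall (a : 'I_d -> nat) (x : vec), K x ->
    cabs (mpartialC a F x) <= M * h ^+ mabs a * ((mfact a)%:R `^ s).

Definition Gevrey (some : bool) (s : R) (F : vec -> C) : Prop :=
  smoothC F /\
  forall K : set vec, compact K ->
    if some then exists h, 0 < h /\ gevrey_on s h K F
    else forall h, 0 < h -> gevrey_on s h K F.

Definition in_Gevrey (some : bool) (B : 'M[R]_d) (s : R)
    (T : (vec -> C) -> Prop) (u : (vec -> C) -> C) : Prop :=
  exists F : vec -> C, Gevrey some s F /\ periodic_fun B F /\
    forall psi, T psi -> u psi = intC (fun y => F y * psi y).

Definition stft_bound (u : (vec -> C) -> C) (phi : vec -> C) (s r : R) : Prop :=
  exists K : R, forall x xi : vec,
    cabs (STFT u phi x xi) <= K * expR (r * enorm xi `^ (1 / s)).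

End GS.

(* Main.v *)
Require Import Defs.
From HB Require Import structures.
From mathcomp Require Import all_boot all_order all_algebra.
From mathcomp Require Import all_classical all_reals all_analysis.
From mathcomp Require Import measurable_realfun complex ring lra zify.
Set Implicit Arguments.
Unset Strict Implicit.
Unset Printing Implicit Defensive.
Import Order.TTheory GRing.Theory Num.Theory.
Import numFieldNormedType.Exports.

(** For an odd integer [N], let [a_N(k)(psi)] be the [k]-th discrete Fourier coefficient of the
    periodic function [z |-> u (psi (. - z))] sampled on the refined lattice [Lambda_E / N].
    The [a_N(k)(psi)] sum to [u psi], and they are dominated by a summable sequence, because
    second difference quotients of [psi] stay bounded in the test space.  Multiplying [psi] by
    Riemann sums of [G = g e^{i alpha_k}] shows that, up to [O(1/N)],
      [a_N(k)(psi) * int g e^{i alpha_k} = a_N(k)(g) * int psi e^{i alpha_k}].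
    In the limit [N -> oo] (along an ultrafilter), [u psi = sum_k c_k int psi e^{i alpha_k}] with
      [|c_k| <= sup_x |u (g_k (. - x))| / |int g_k e^{i alpha_k}|]
    for any prescribed test functions [g_k] with nonzero denominators.  The choice
    [g_k = conj phi * e^{-i <., alpha_k - eta>}] makes the numerator a value of the short-time
    Fourier transform at the frequency [alpha_k - eta] and the denominator the Fourier transform
    of [conj phi] at a point [eta] where it does not vanish; so bounds on [V_phi u] pass to the
    coefficients [c_k].  Conversely, bounds on the [c_k], or on the derivatives of a periodic
    function, pass to [V_phi u] by the exponential decay of the Fourier transform of [phi]. *)

(** * Integrals of decaying Lipschitz functions *)

(** The space that carries [u] may be quasi-analytic (first index at most 1). Then it contains no
    cut-off functions, and [u] cannot be restricted to one period. Sampling on refined lattices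
    evaluates [u] at finitely many test functions at a time. Continuity of [u] is known only through
    Gelfand-Shilov seminorms, so every approximation of test functions is an estimate in these
    seminorms. It may multiply the scale [h] by a fixed factor, and the factor must not depend on
    the lattice or on the truncation. Since [intRd] is an iterated integral, its properties on
    Lipschitz functions come from the one-dimensional ones by a joint induction. The cell volume is
    measured on one reference function, [Tent]: because convolution is symmetric, Riemann sums and
    integrals are proportional up to O(1/N), with the same factor for all functions. The indices of
    the space that carries [u] govern the expansion into a series. The indices [s], [t] enter
    through the decay of the Fourier transform of [phi] and through the Gevrey bounds. *)

Section OneDim.
Local Open Scope ring_scope.
Local Open Scope classical_set_scope.
Context {R : realType}.
Local Notation mu := (@lebesgue_measure R).

Definition I1 (f : R -> R) : R := Rintegral mu setT f.

Definition rho1 (y : R) : R := (1 + y ^+ 2)^-1.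

Lemma rho1_gt0 y : 0 < rho1 y.
Proof. by rewrite invr_gt0 ltr_pwDl// sqr_ge0. Qed.

Lemma rho1_ge0 y : 0 <= rho1 y.
Proof. exact: ltW (rho1_gt0 y). Qed.

Lemma rho1_le1 y : rho1 y <= 1.
Proof. by rewrite invf_le1 ?ltr_pwDl ?sqr_ge0// lerDl sqr_ge0. Qed.

Lemma continuous_rho1 : continuous rho1.
Proof. exact: continuous_oneDsqrV. Qed.

Lemma integrable_rho1 : mu.-integrable setT (EFin \o rho1).
Proof.
apply/integrableP; split.
  apply/measurable_EFinP; apply: continuous_measurable_fun.
  exact: continuous_rho1.
under eq_integral do rewrite /= ger0_norm ?rho1_ge0//.
rewrite ge0_symfun_integralT//=.
- rewrite (_ : [set x | _] = `[0, +oo[%classic); last first.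
    by apply/seteqP; split => x/=; rewrite in_itv/= andbT.
  by rewrite integral0y_oneDsqr -EFinM ltry.
- exact: rho1_ge0.
- exact: continuous_rho1.
- by move=> x; rewrite /rho1 /= sqrrN.
Qed.

(** Continuity supplies measurability and the bound by [rho1] supplies integrability, so the rules
    for [I1] carry no further side conditions. *)
Definition tame (f : R -> R) := continuous f /\ exists M, forall y, `|f y| <= M * rho1 y.

Lemma tame_integrable f : tame f -> mu.-integrable setT (EFin \o f).
Proof.
move=> [cf [M Mf]].
apply: (@le_integrable _ _ _ mu setT _ _ (fun y => (M%:E * (rho1 y)%:E)%E)) => //.
- by apply/measurable_EFinP; exact: continuous_measurable_fun.
- by move=> x _ /=; rewrite lee_fin (le_trans (Mf x))// ler_norm.
- by apply: integrableZl => //; exact: integrable_rho1.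
Qed.

Lemma tameZ c f : tame f -> tame (fun y => c * f y).
Proof.
move=> [cf [M Mf]]; split; first by move=> x; apply: cvgM; [exact: cvg_cst|exact: cf].
by exists (`|c| * M) => y; rewrite normrM -mulrA ler_wpM2l.
Qed.

Lemma I1D f g : tame f -> tame g -> I1 (fun y => f y + g y) = I1 f + I1 g.
Proof. by move=> tf tg; rewrite /I1 RintegralD//; exact: tame_integrable. Qed.

Lemma I1Z c f : tame f -> I1 (fun y => c * f y) = c * I1 f.
Proof. by move=> tf; rewrite /I1 RintegralZl//; exact: tame_integrable. Qed.

Lemma tame_rho1 : tame rho1.
Proof.
split; first exact: continuous_rho1.
by exists 1 => y; rewrite mul1r ger0_norm// rho1_ge0.
Qed.

Lemma I1_le f M : tame f -> (forall y, `|f y| <= M * rho1 y) -> `|I1 f| <= M * I1 rho1.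
Proof.
move=> tf Mf; rewrite -I1Z; last exact: tame_rho1.
apply: le_trans (le_normr_Rintegral _ _) _ => //; first exact: tame_integrable.
apply: le_Rintegral => //.
- exact: integrable_norm (tame_integrable tf).
- by apply: tame_integrable; apply: tameZ; exact: tame_rho1.
Qed.

Lemma I1_rho1_ge0 : 0 <= I1 rho1.
Proof. by apply: Rintegral_ge0 => x _; exact: rho1_ge0. Qed.

(** Translation preserves the length of half-open intervals, and Lebesgue measure is determined by
    its values on them. *)
Lemma lebesgue_measure_shift (c : R) (A : set R) : measurable A ->
  pushforward mu (fun y => y + c : measurableTypeR R) A = mu A.
Proof.
move=> mA.
have mc : measurable_fun setT (fun y : measurableTypeR R => y + c : measurableTypeR R).
  by apply: measurable_funD.
pose phi : {mfun measurableTypeR R >-> measurableTypeR R} :=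
  HB.pack (fun y => y + c : measurableTypeR R) (isMeasurableFun.Build _ _ _ _ _ mc).
apply/esym.
apply: (@lebesgue_measure_unique R (pushforward mu phi)) => //= _ [[a b]] _ <-.
rewrite /pushforward.
have -> : (fun y => y + c) @^-1` `]a, b]%classic = `]a - c, b - c]%classic.
  by apply/seteqP; split => x /=; rewrite !in_itv/= ltrBlDr lerBrDr.
rewrite /= !lebesgue_measure_itv/= !lte_fin ltrD2r.
by case: ifP => // _; rewrite -!EFinB; congr EFin; ring.
Qed.

(** Peetre's inequality. After clearing denominators the two sides differ by
    [1 + (x + 2 y)^2 + 2 ((x + y) y)^2]. *)
Lemma rho1D x y : rho1 (x + y) <= 2 * (1 + y ^+ 2) * rho1 x.
Proof.
rewrite /rho1 ler_pdivlMr ?ltr_pwDl ?sqr_ge0// mulrC ler_pdivrMr ?ltr_pwDl ?sqr_ge0//.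
have := sqr_ge0 (x + 2 * y); have := sqr_ge0 ((x + y) * y); nra.
Qed.

Lemma tame_shift c f : tame f -> tame (fun y => f (y + c)).
Proof.
move=> [cf [M Mf]]; split.
  move=> x; apply: (@continuous_comp _ _ _ (fun y => y + c) f); last exact: cf.
  by apply: cvgD; [exact: cvg_id|exact: cvg_cst].
have M0 : 0 <= M by have := Mf 0; have := rho1_gt0 0; have := normr_ge0 (f 0); nra.
exists (M * (2 * (1 + c ^+ 2))) => y; apply: le_trans (Mf _) _.
by rewrite -mulrA ler_wpM2l// rho1D.
Qed.

Lemma tame_opp f : tame f -> tame (fun y => f (- y)).
Proof.
move=> [cf [M Mf]]; split.
  by move=> x; apply: (@continuous_comp _ _ _ -%R f); [exact: opp_continuous|exact: cf].
by exists M => y; apply: le_trans (Mf _) _; rewrite /rho1 sqrrN.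
Qed.

Lemma I1_shift c f : tame f -> I1 (fun y => f (y + c)) = I1 f.
Proof.
move=> tf; rewrite /I1 /Rintegral; congr fine.
have mc : measurable_fun setT (fun y : measurableTypeR R => y + c : measurableTypeR R).
  by apply: measurable_funD.
transitivity (\int[pushforward mu (fun y => (y + c)%R : measurableTypeR R)]_x (f x)%:E)%E; last first.
  by apply: eq_measure_integral => A mA _; exact: lebesgue_measure_shift.
rewrite integral_pushforward//=.
  by apply/measurable_EFinP; exact: continuous_measurable_fun tf.1.
rewrite preimage_setT.
exact: (tame_integrable (tame_shift c tf)).
Qed.

Lemma I1_opp f : tame f -> I1 (fun y => f (- y)) = I1 f.
Proof.
move=> tf; rewrite /I1 /Rintegral; congr fine.
transitivity (\int[pushforward mu (-%R : _ -> measurableTypeR R)]_x (f x)%:E)%E; last first.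
  by apply: eq_measure_integral => A mA _; exact: lebesgue_measureN.
rewrite integral_pushforward//=.
  by apply/measurable_EFinP; exact: continuous_measurable_fun tf.1.
rewrite preimage_setT.
exact: (tame_integrable (tame_opp tf)).
Qed.

End OneDim.

(** * Iterated integrals in several variables *)

Section IterInt.
Local Open Scope ring_scope.
Local Open Scope classical_set_scope.
Context {R : realType}.
Implicit Types (v : nat -> R) (G : (nat -> R) -> R) (M m e c y : R).

Definition wn n v : R := \prod_(i < n) rho1 (v i).

Definition upd v n y : nat -> R := fun i => if i == n then y else v i.

Lemma wn_ge0 n v : 0 <= wn n v.
Proof. by apply: prodr_ge0 => i _; exact: rho1_ge0. Qed.

Lemma wn_upd n v y : wn n.+1 (upd v n y) = wn n v * rho1 y.
Proof.
rewrite /wn big_ord_recr /= /upd eqxx; congr (_ * _).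
by apply: eq_bigr => i _; rewrite /= ltn_eqF.
Qed.

(* The second clause makes the inner integrals continuous in the remaining variables. *)
Definition clsn n M G :=
  (forall v, `|G v| <= M * wn n v) /\
  (forall v v' e, 0 <= e -> e <= 1 -> (forall i, `|v i - v' i| <= e) ->
     `|G v - G v'| <= M * e * wn n v).

Lemma clsnD n M M' G G' : clsn n M G -> clsn n M' G' ->
  clsn n (M + M') (fun v => G v + G' v).
Proof.
move=> [b l] [b' l']; split=> [v|v v' e e0 e1 h].
  by rewrite mulrDl (le_trans (ler_normD _ _))// lerD.
rewrite opprD addrACA !mulrDl (le_trans (ler_normD _ _))// lerD//; [exact: l|exact: l'].
Qed.

Lemma clsnZ n M c G : clsn n M G -> clsn n (`|c| * M) (fun v => c * G v).
Proof.
move=> [b l]; split=> [v|v v' e e0 e1 h].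
  by rewrite normrM -mulrA ler_wpM2l.
by rewrite -mulrBr normrM -!mulrA ler_wpM2l// mulrA; exact: l.
Qed.

Lemma clsn_sect n M G y : clsn n.+1 M G -> clsn n (M * rho1 y) (fun v => G (upd v n y)).
Proof.
move=> [b l]; split=> [v|v v' e e0 e1 h].
  by rewrite -mulrA [rho1 y * _]mulrC -wn_upd.
have := l (upd v n y) (upd v' n y) e e0 e1; rewrite wn_upd => H.
rewrite (_ : _ * wn n v = M * e * (wn n v * rho1 y)); last by ring.
apply: H => i; rewrite /upd; case: ifP => _ //.
by rewrite subrr normr0.
Qed.

Lemma clsn_ge0 n M G : clsn n M G -> 0 <= M.
Proof.
move=> [b _]; have := b (fun _ => 0).
have w0 : 0 < wn n (fun _ => 0 : R) by apply: prodr_gt0 => i _; exact: rho1_gt0.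
by move=> /(le_trans (normr_ge0 _)); rewrite pmulr_lge0.
Qed.

(** The four claims need each other: linearity at level [n + 1] requires the inner integrals to be
    tame, and their continuity in the outer variable follows from linearity and the bound, applied
    to the difference of two sections. For this the bound [m] is kept apart from the class constant
    [M]: the difference has a large class constant but small values. *)
Lemma intd_main n :
  (forall M m G, clsn n M G -> (forall v, `|G v| <= m * wn n v) ->
     `|intd n G| <= m * I1 (@rho1 R) ^+ n) /\
  (forall M M' G G', clsn n M G -> clsn n M' G' ->
     intd n (fun v => G v + G' v) = intd n G + intd n G') /\
  (forall M c G, clsn n M G -> intd n (fun v => c * G v) = c * intd n G) /\
  (forall M G, clsn n.+1 M G -> tame (fun y => intd n (fun v => G (upd v n y)))).
Proof.
elim: n => [|n [IHa [IHb [IHc IHt]]]].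
  have T M G : clsn 1 M G -> tame (fun y => intd 0 (fun v => G (upd v 0 y))).
    move=> c; have [b l] := c; have M0 := clsn_ge0 c; split; last first.
      exists M => y; apply: le_trans (b _) _.
      by rewrite wn_upd /wn big_ord0 mul1r.
    move=> y; apply/cvgrPdist_le => /= e e0.
    near=> y'.
    have dy : `|y - y'| <= 1 by near: y'; apply: cvgr_dist_le.
    have H : forall i, `|upd (fun _ => 0) 0 y i - upd (fun _ => 0) 0 y' i| <= `|y - y'|.
      by move=> i; rewrite /upd; case: ifP => // _; rewrite subrr normr0.
    apply: le_trans (l _ _ _ (normr_ge0 _) dy H) _.
    rewrite wn_upd /wn big_ord0 mul1r.
    apply: (@le_trans _ _ (M * `|y - y'|)).
      by rewrite -mulrA ler_wpM2l// ler_piMr// rho1_le1.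
    have : `|y - y'| <= e / (M + 1).
      by near: y'; apply: cvgr_dist_le; rewrite // divr_gt0// ltr_wpDl.
    rewrite ler_pdivlMr ?ltr_wpDl// => ?; apply: le_trans (_ : `|y - y'| * (M + 1) <= _) => //.
    by rewrite mulrC ler_wpM2l// lerDl.
  split; first by move=> M m G c h; rewrite /= expr0 mulr1; have := h (fun _ => 0); rewrite /wn big_ord0 mulr1.
  by [].
have HT M G : clsn n.+1 M G -> tame (fun y => intd n (fun v => G (upd v n y))) by exact: IHt.
have A : forall M m G, clsn n.+1 M G -> (forall v, `|G v| <= m * wn n.+1 v) ->
     `|intd n.+1 G| <= m * I1 (@rho1 R) ^+ n.+1.
  move=> M m G c h.
  have -> : m * I1 (@rho1 R) ^+ n.+1 = (m * I1 (@rho1 R) ^+ n) * I1 (@rho1 R) by rewrite exprSr mulrA.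
  apply: I1_le; first exact: HT c.
  move=> y; rewrite mulrAC.
  apply: (IHa _ _ _ (clsn_sect y c)) => v.
  by rewrite -mulrA [rho1 y * _]mulrC -wn_upd.
have B : forall M M' G G', clsn n.+1 M G -> clsn n.+1 M' G' ->
     intd n.+1 (fun v => G v + G' v) = intd n.+1 G + intd n.+1 G'.
  move=> M M' G G' c c'; rewrite /= -I1D; [|exact: HT c|exact: HT c'].
  congr (I1 _); apply/funext => y.
  exact: (IHb _ _ _ _ (clsn_sect y c) (clsn_sect y c')).
have C : forall M c G, clsn n.+1 M G -> intd n.+1 (fun v => c * G v) = c * intd n.+1 G.
  move=> M c G k; rewrite /= -I1Z; last exact: HT k.
  congr (I1 _); apply/funext => y.
  exact: (IHc _ _ _ (clsn_sect y k)).
split=> //; split=> //; split=> //.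
move=> M G c; have M0 := clsn_ge0 c; have [b l] := c; split; last first.
  exists (M * I1 (@rho1 R) ^+ n.+1) => y.
  rewrite mulrAC; apply: (A _ _ _ (clsn_sect y c)) => v.
  by rewrite -mulrA [rho1 y * _]mulrC -wn_upd.
set K := I1 (@rho1 R) ^+ n.+1.
have K0 : 0 <= K by rewrite exprn_ge0// I1_rho1_ge0.
move=> y; apply/cvgrPdist_le => /= e e0.
have eK : 0 < e / (M * K + 1) by rewrite divr_gt0// ltr_wpDl// mulr_ge0.
near=> y'.
have dy : `|y - y'| <= 1 by near: y'; apply: cvgr_dist_le.
have c2 := clsnZ (-1) (clsn_sect y' c).
have -> : I1 (fun z => intd n (fun v => G (upd (upd v n z) n.+1 y))) -
   I1 (fun z => intd n (fun v => G (upd (upd v n z) n.+1 y'))) =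
   intd n.+1 (fun v => G (upd v n.+1 y) + -1 * G (upd v n.+1 y')).
  by rewrite (B _ _ _ _ (clsn_sect y c) c2) (C _ _ _ (clsn_sect y' c)) mulN1r.
apply: (@le_trans _ _ (M * `|y - y'| * K)).
  apply: (A _ _ _ (clsnD (clsn_sect y c) c2)) => v.
  rewrite mulN1r.
  apply: le_trans (l _ _ `|y - y'| (normr_ge0 _) dy _) _.
    by move=> i; rewrite /upd; case: ifP => // _; rewrite subrr normr0.
  rewrite wn_upd mulrA ler_piMr ?rho1_le1//.
  by rewrite !mulr_ge0// wn_ge0.
have : `|y - y'| <= e / (M * K + 1).
  by near: y'; apply: cvgr_dist_le.
rewrite ler_pdivlMr ?ltr_wpDl ?mulr_ge0// => ?.
apply: le_trans (_ : `|y - y'| * (M * K + 1) <= _) => //.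
by rewrite mulrAC mulrC ler_wpM2l// lerDl.
Unshelve. all: by end_near.
Qed.

(** At level 0 the integrand is evaluated at the zero sequence, hence the condition that [c]
    vanishes beyond the integrated coordinates. *)
Lemma intd_shift n M (c : nat -> R) G : clsn n M G -> (forall i, (n <= i)%N -> c i = 0) ->
  intd n (fun v => G (fun i => v i + c i)) = intd n G.
Proof.
elim: n M G c => [|n IH] M G c k hc /=.
  by congr (G _); apply/funext => i; rewrite hc// addr0.
have [_ [_ [_ t]]] := intd_main n.
rewrite -[RHS](I1_shift (c n) (t _ _ k)); congr (I1 _); apply/funext => y.
(* The shift of coordinate [n] is spent on the outer integral and removed from the shift handed to
   the inner ones. *)
pose c' := upd c n 0.
rewrite -(IH _ _ c' (clsn_sect (y + c n) k)).
  congr (intd n _); apply/funext => v; congr (G _); apply/funext => i.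
  by rewrite /upd /c' /upd; case: eqP => [->|].
move=> i; rewrite /c' /upd; case: eqP => // ni; rewrite leq_eqVlt => /orP[/eqP|] ?; first by subst.
by apply: hc.
Qed.

Lemma intd_opp n M G : clsn n M G -> intd n (fun v => G (fun i => - v i)) = intd n G.
Proof.
elim: n M G => [|n IH] M G k /=.
  by congr (G _); apply/funext => i; rewrite oppr0.
have [_ [_ [_ t]]] := intd_main n.
rewrite -[RHS](I1_opp (t _ _ k)); congr (I1 _); apply/funext => y.
rewrite -(IH _ _ (clsn_sect (- y) k)).
congr (intd n _); apply/funext => v; congr (G _); apply/funext => i.
by rewrite /upd; case: eqP.
Qed.

(** [c] collects the factors of the outer coordinates, which are constants for the inner integrals;
    the induction therefore needs it arbitrary. *)
Lemma intd_prod n T c : tame T ->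
  intd n (fun v => c * \prod_(i < n) T (v i)) = c * I1 T ^+ n.
Proof.
move=> t; elim: n c => [|n IH] c /=; first by rewrite big_ord0 expr0.
rewrite (_ : (fun y => _) = fun y => c * I1 T ^+ n * T y).
  by rewrite -/(I1 _) I1Z// exprSr mulrA.
apply/funext => y; rewrite mulrAC -IH; congr (intd n _); apply/funext => v.
rewrite big_ord_recr /= eqxx -mulrA [T y * _]mulrC; congr (_ * (_ * _)).
by apply: eq_bigr => i _; rewrite /= ltn_eqF.
Qed.

End IterInt.

(** * Weights and Lipschitz classes on row vectors *)

Section Vec.
Local Open Scope ring_scope.
Local Open Scope classical_set_scope.
Context {R : realType} {d : nat}.
Local Notation vec := 'rV[R]_d.
Implicit Types (x y : vec) (g f w : vec -> R) (M m A e : R).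

Lemma vnorm_coord x j : `|x 0 j| <= `|x|.
Proof. by rewrite /Num.Def.normr/= mx_normrE; exact: (le_bigmax _ (fun ij => `|x ij.1 ij.2|) (0, j)). Qed.

Lemma vnorm_le x m : 0 <= m -> (forall j, `|x 0 j| <= m) -> `|x| <= m.
Proof.
move=> m0 h; rewrite /Num.Def.normr/= mx_normrE; apply: bigmax_le => // -[i j] _ /=.
by rewrite ord1.
Qed.

(* The norm of a row vector is the sup norm, so [w1] is dominated by the product weight [wn]. *)
Definition w1 x : R := rho1 `|x| ^+ d.
(** Squared so that one factor [w1] can absorb a translation through [w1_mul_le] while the other
    still makes integrals converge. *)
Definition w2 x : R := w1 x ^+ 2.

Lemma w1_gt0 x : 0 < w1 x. Proof. by rewrite exprn_gt0// rho1_gt0. Qed.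
Lemma w1_ge0 x : 0 <= w1 x. Proof. exact/ltW/w1_gt0. Qed.
Lemma w1_le1 x : w1 x <= 1. Proof. by rewrite exprn_ile1 ?rho1_ge0 ?rho1_le1. Qed.
Lemma w2_gt0 x : 0 < w2 x. Proof. by rewrite exprn_gt0// w1_gt0. Qed.
Lemma w2_ge0 x : 0 <= w2 x. Proof. exact/ltW/w2_gt0. Qed.
Lemma w2_le1 x : w2 x <= 1. Proof. by rewrite exprn_ile1 ?w1_ge0 ?w1_le1. Qed.
Lemma w2_le_w1 x : w2 x <= w1 x.
Proof. by rewrite /w2 expr2 ler_piMr ?w1_ge0 ?w1_le1. Qed.

Lemma rho1_le (a b : R) : `|a| <= `|b| -> rho1 b <= rho1 a.
Proof.
move=> h; rewrite /rho1 lef_pV2 ?posrE ?ltr_pwDl ?sqr_ge0// lerD2l.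
by rewrite -(real_normK (num_real a)) -(real_normK (num_real b)) lerXn2r ?nnegrE.
Qed.

Lemma rho1_mul_le (a b : R) : rho1 a * rho1 b <= 2 * rho1 (a + b).
Proof.
rewrite /rho1 -invfM ler_pdivlMr ?ltr_pwDl ?sqr_ge0//.
rewrite mulrC ler_pdivrMr ?mulr_gt0 ?ltr_pwDl ?sqr_ge0//.
by have := sqr_ge0 (a - b); have := sqr_ge0 (a * b); nra.
Qed.

Lemma w1_mul_le x y : w1 x * w1 y <= 2 ^+ d * w1 (x + y).
Proof.
rewrite /w1 -!exprMn lerXn2r ?nnegrE ?mulr_ge0 ?rho1_ge0//.
apply: le_trans (rho1_mul_le _ _) _; rewrite ler_wpM2l//; apply: rho1_le.
by rewrite normr_id (le_trans (ler_normD _ _))// ler_norm.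
Qed.

Lemma w1D x y : w1 (x + y) <= 2 ^+ d * (1 + `|y| ^+ 2) ^+ d * w1 x.
Proof.
have := w1_mul_le (x + y) (- y); rewrite addrK => h.
have wy : w1 (- y) * (1 + `|y| ^+ 2) ^+ d = 1.
  rewrite /w1 normrN /rho1 -exprMn mulVf ?expr1n// gt_eqF//.
have y0 : 0 <= (1 + `|y| ^+ 2) ^+ d by rewrite exprn_ge0// addr_ge0// sqr_ge0.
have := ler_wpM2r y0 h; rewrite -[X in X <= _]mulrA wy mulr1.
by rewrite [X in _ <= X]mulrAC.
Qed.

Lemma w2D x y : w2 (x + y) <= (2 ^+ d * (1 + `|y| ^+ 2) ^+ d) ^+ 2 * w2 x.
Proof.
have y0 : 0 <= 1 + `|y| ^+ 2 by rewrite addr_ge0// sqr_ge0.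
rewrite /w2 -exprMn lerXn2r ?nnegrE ?w1_ge0//; last exact: w1D.
by rewrite !mulr_ge0// ?w1_ge0// exprn_ge0.
Qed.

(** Increments of norm at most 1 keep the weights comparable, so the weight may be taken at the base
    point [x]. *)
Definition lip w M g :=
  (forall x, `|g x| <= M * w x) /\
  (forall x y, `|y| <= 1 -> `|g (x + y) - g x| <= M * `|y| * w x).

Lemma lip_le w w' M M' g : lip w M g -> (forall x, M * w x <= M' * w' x) -> lip w' M' g.
Proof.
move=> [b l] h; split=> [x|x y hy]; first exact: le_trans (b _) (h _).
by apply: le_trans (l _ _ hy) _; rewrite mulrAC [leRHS]mulrAC ler_wpM2r.
Qed.

Lemma lipD w M M' g f : lip w M g -> lip w M' f -> lip w (M + M') (fun x => g x + f x).
Proof.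
move=> [b l] [b' l']; split=> [x|x y hy].
  by rewrite mulrDl (le_trans (ler_normD _ _))// lerD.
by rewrite opprD addrACA !mulrDl (le_trans (ler_normD _ _))// lerD//; [exact: l|exact: l'].
Qed.

Lemma lipZ w M (c : R) g : lip w M g -> lip w (`|c| * M) (fun x => c * g x).
Proof.
move=> [b l]; split=> [x|x y hy]; first by rewrite normrM -mulrA ler_wpM2l.
by rewrite -mulrBr normrM -!mulrA ler_wpM2l// mulrA; exact: l.
Qed.

Lemma lip_sum w M (T : eqType) (s : seq T) (G : T -> vec -> R) :
  (forall i, lip w M (G i)) -> lip w ((size s)%:R * M) (fun x => \sum_(i <- s) G i x).
Proof.
move=> h; elim: s => [|a s IH].
  split=> [x|x y hy]; rewrite !big_nil ?subr0 ?normr0 !mul0r//.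
rewrite (_ : (fun x => _) = fun x => G a x + \sum_(i <- s) G i x).
  by rewrite /= -addn1 natrD mulrDl mul1r addrC; exact: lipD.
by apply/funext => x; rewrite big_cons.
Qed.

Lemma lipM w M M' g f : (forall x, 0 <= w x) -> 0 <= M' ->
  lip w M g -> lip (fun=> 1) M' f -> lip w (3 * (M * M')) (fun x => g x * f x).
Proof.
move=> w0 M'0 [b l] [b' l'].
have MM x : 0 <= M * w x by apply: le_trans (b x).
have bf x : `|f x| <= M' by rewrite (le_trans (b' _))// mulr1.
split=> [x|x y hy].
  rewrite normrM (le_trans (ler_pM _ _ (b x) (bf x)))//.
  by have := mulr_ge0 (MM x) M'0; lra.
have -> : g (x + y) * f (x + y) - g x * f x =
  (g (x + y) - g x) * f (x + y) + g x * (f (x + y) - f x) by ring.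
rewrite (le_trans (ler_normD _ _))// !normrM.
have h1 : `|g (x + y) - g x| * `|f (x + y)| <= M * `|y| * w x * M'.
  exact: ler_pM (l _ _ hy) (bf _).
have h2 : `|g x| * `|f (x + y) - f x| <= M * w x * (M' * `|y|).
  by apply: ler_pM (b _) _ => //; have := l' x y hy; rewrite mulr1.
apply: le_trans (lerD h1 h2) _.
have := mulr_ge0 (mulr_ge0 (MM x) M'0) (normr_ge0 y).
have -> : 3 * (M * M') * `|y| * w x = 3 * (M * w x * M' * `|y|) by ring.
by rewrite (_ : M * `|y| * w x * M' = M * w x * M' * `|y|); [lra|ring].
Qed.

Lemma lip_shift w A M (c : vec) g : (forall x, w (x + c) <= A * w x) -> 0 <= M ->
  lip w M g -> lip w (M * A) (fun x => g (x + c)).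
Proof.
move=> h M0 [b l]; split=> [x|x y hy].
  by rewrite (le_trans (b _))// -mulrA ler_wpM2l.
rewrite addrAC (le_trans (l _ _ hy))// -[leRHS]mulrA mulrAC [leRHS]mulrAC.
rewrite -!mulrA [`|y| * _]mulrC !mulrA ler_wpM2r// -mulrA ler_wpM2l//.
by rewrite mulrC.
Qed.

Lemma lip_opp w M g : (forall x, w (- x) = w x) -> lip w M g -> lip w M (fun x => g (- x)).
Proof.
move=> h [b l]; split=> [x|x y hy]; first by rewrite -h.
by have := l (- x) (- y); rewrite normrN h opprD; apply.
Qed.

Definition nv (v : nat -> R) : vec := \row_j v (nat_of_ord j).

Lemma w1_nv v : w1 (nv v) <= wn d v.
Proof.
rewrite /w1; move: `|nv v| (vnorm_coord (nv v)) => r hr.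
rewrite -[X in _ ^+ X]card_ord -prodr_const /wn.
apply: ler_prod => i _; rewrite rho1_ge0/=; apply: rho1_le.
by have := hr i; rewrite mxE => h; exact: le_trans h (ler_norm _).
Qed.

Lemma clsn_nv M g : 0 <= M -> lip w1 M g -> clsn d M (fun v => g (nv v)).
Proof.
move=> M0 [b l].
have hw := w1_nv.
split=> [v|v v' e e0 e1 h].
  by rewrite (le_trans (b _))// ler_wpM2l.
have hn : `|nv v' - nv v| <= e.
  by apply: vnorm_le => // j; rewrite !mxE distrC.
rewrite distrC -[X in g X - _](subrKC (nv v)).
apply: le_trans (l _ _ (le_trans hn e1)) _.
by apply: ler_pM => //; rewrite ?mulr_ge0 ?w1_ge0// ler_wpM2l.
Qed.

Definition CI : R := I1 (@rho1 R) ^+ d.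
Lemma CI_ge0 : 0 <= CI. Proof. by rewrite exprn_ge0// I1_rho1_ge0. Qed.

Local Notation I := (@intRd R d).

Lemma I_bound M m g : 0 <= M -> lip w1 M g -> (forall x, `|g x| <= m * w1 x) -> `|I g| <= m * CI.
Proof.
move=> M0 L h; have [A _] := @intd_main R d.
apply: A (clsn_nv M0 L) _ => v; apply: le_trans (h _) _.
have m0 : 0 <= m.
  by have := le_trans (normr_ge0 _) (h 0); rewrite pmulr_lge0// w1_gt0.
rewrite ler_wpM2l//.
exact: w1_nv.
Qed.

Lemma I_add M M' g f : 0 <= M -> 0 <= M' -> lip w1 M g -> lip w1 M' f ->
  I (fun x => g x + f x) = I g + I f.
Proof.
move=> M0 M'0 h h'; have [_ [B _]] := @intd_main R d.
exact: B (clsn_nv M0 h) (clsn_nv M'0 h').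
Qed.

Lemma I_scale M (c : R) g : 0 <= M -> lip w1 M g -> I (fun x => c * g x) = c * I g.
Proof.
move=> M0 h; have [_ [_ [B _]]] := @intd_main R d.
exact: B (clsn_nv M0 h).
Qed.

Lemma I_shift M (c : vec) g : 0 <= M -> lip w1 M g -> I (fun x => g (x + c)) = I g.
Proof.
move=> M0 h.
(* The row [c] as a sequence extended by 0, as [intd_shift] requires. *)
pose c' (i : nat) : R := if insub i is Some j then c 0 j else 0.
rewrite /intRd -(intd_shift (c := c') (clsn_nv M0 h)).
  congr (intd d _); apply/funext => v; congr (g _); apply/rowP => j.
  by rewrite !mxE /c' valK.
by move=> i di; rewrite /c' insubN// -leqNgt.
Qed.

Lemma I_opp M g : 0 <= M -> lip w1 M g -> I (fun x => g (- x)) = I g.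
Proof.
move=> M0 h; rewrite /intRd -(intd_opp (clsn_nv M0 h)).
by congr (intd d _); apply/funext => v; congr (g _); apply/rowP => j; rewrite !mxE.
Qed.

End Vec.

(** * Iterated partial derivatives *)

Section Calculus.
Local Open Scope ring_scope.
Local Open Scope classical_set_scope.
Context {R : realType} {d : nat}.
Local Notation vec := 'rV[R]_d.
Implicit Types (x y z c b : vec) (g f : vec -> R) (j i : 'I_d) (l : seq 'I_d).

Lemma partials_rcons l j g : partials (rcons l j) g = partials l (partial j g).
Proof. by rewrite /partials foldr_rcons. Qed.

Lemma partials_cat l l' g : partials (l ++ l') g = partials l (partials l' g).
Proof. by rewrite /partials foldr_cat. Qed.

Lemma smooth_diff g x : smoothR g -> differentiable g x.
Proof. by move=> /(_ [::] x). Qed.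

Lemma smooth_partial j g : smoothR g -> smoothR (partial j g).
Proof. by move=> h l x; rewrite -partials_rcons; exact: h. Qed.

Lemma smooth_partials l g : smoothR g -> smoothR (partials l g).
Proof. by move=> h l' x; rewrite -partials_cat; exact: h. Qed.

(** [smoothR] is the largest class of differentiable functions stable under [partial], so smoothness
    is proved by exhibiting such a class. *)
Lemma smooth_ind (C : (vec -> R) -> Prop) :
  (forall f, C f -> forall x, differentiable f x) ->
  (forall f j, C f -> C (partial j f)) -> forall f, C f -> smoothR f.
Proof.
move=> hd hp f hf l x; apply: hd.
by elim: l => [|j l IH] //=; apply: hp.
Qed.

Lemma partialD j f g : (forall x, differentiable f x) -> (forall x, differentiable g x) ->
  partial j (fun x => f x + g x) = fun x => partial j f x + partial j g x.
Proof.
by move=> df dg; apply/funext => x; rewrite /partial deriveD//; apply: diff_derivable.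
Qed.

Lemma partialZ j (k : R) f : (forall x, differentiable f x) ->
  partial j (fun x => k * f x) = fun x => k * partial j f x.
Proof.
by move=> df; apply/funext => x; rewrite /partial (deriveZ k)//; apply: diff_derivable.
Qed.

Lemma partialM j f g : (forall x, differentiable f x) -> (forall x, differentiable g x) ->
  partial j (fun x => f x * g x) = fun x => partial j f x * g x + f x * partial j g x.
Proof.
move=> df dg; apply/funext => x; rewrite /partial deriveM; [|exact: diff_derivable..].
by rewrite addrC; congr (_ + _); rewrite /GRing.scale/= mulrC.
Qed.

Lemma partial_shift j c f : partial j (fun x => f (x + c)) = fun x => partial j f (x + c).
Proof.
apply/funext => x; rewrite /partial /derive.
rewrite (_ : (fun h : R => _ *: (((fun y => f (y + c)) \o shift x) _ - _)) =
  (fun h : R => h^-1 *: ((f \o shift (x + c)) (h *: ej j) - f (x + c))))//.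
by apply/funext => h /=; rewrite addrA.
Qed.

Lemma partial_cst j (k : R) : partial j (fun=> k) = fun=> 0.
Proof. by apply/funext => x; rewrite /partial derive_cst. Qed.

Lemma diff_shift c f x : differentiable f (x + c) -> differentiable (fun y => f (y + c)) x.
Proof.
by move=> h; apply: (@differentiable_comp _ _ _ _ (fun y => y + c) f).
Qed.

Lemma smooth_cst (k : R) : smoothR (fun _ : vec => k).
Proof.
apply: (smooth_ind (C := fun f => exists k, f = fun=> k)); last by exists k.
- by move=> _ [a ->] x; exact: differentiable_cst.
- by move=> _ j [a ->]; exists 0; rewrite partial_cst.
Qed.

Lemma smoothD f g : smoothR f -> smoothR g -> smoothR (fun x => f x + g x).
Proof.
move=> sf sg.
apply: (smooth_ind (C := fun h => exists f g, [/\ smoothR f, smoothR g & h = fun x => f x + g x])).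
- by move=> _ [a [b [sa sb ->]]] x; apply: differentiableD; exact: smooth_diff.
- move=> _ j [a [b [sa sb ->]]]; exists (partial j a), (partial j b).
  split; [exact: smooth_partial..|]; rewrite partialD// => x; exact: smooth_diff.
- by exists f, g.
Qed.

Lemma smoothZ k f : smoothR f -> smoothR (fun x => k * f x).
Proof.
move=> sf.
apply: (smooth_ind (C := fun h => exists2 f, smoothR f & h = fun x => k * f x)).
- by move=> _ [a sa ->] x; apply: (@differentiableZ _ _ _ a k); exact: smooth_diff.
- move=> _ j [a sa ->]; exists (partial j a); first exact: smooth_partial.
  rewrite partialZ// => x; exact: smooth_diff.
- by exists f.
Qed.

Lemma smooth_shift c f : smoothR f -> smoothR (fun x => f (x + c)).
Proof.
move=> sf.
apply: (smooth_ind (C := fun h => exists2 f, smoothR f & h = fun x => f (x + c))).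
- by move=> _ [a sa ->] x; apply: diff_shift; exact: smooth_diff.
- move=> _ j [a sa ->]; exists (partial j a); first exact: smooth_partial.
  by rewrite partial_shift.
- by exists f.
Qed.

(** Products alone are not stable under [partial]; finite sums of products are, by the product
    rule. *)
Inductive prodsum : (vec -> R) -> Prop :=
| prodsumM f g : smoothR f -> smoothR g -> prodsum (fun x => f x * g x)
| prodsumD f g : prodsum f -> prodsum g -> prodsum (fun x => f x + g x).

Lemma smoothM f g : smoothR f -> smoothR g -> smoothR (fun x => f x * g x).
Proof.
move=> sf sg; apply: (smooth_ind (C := prodsum)); last exact: prodsumM.
- move=> h; elim=> [a b sa sb x|a b _ da _ db x].
    by apply: differentiableM; exact: smooth_diff.
  by apply: differentiableD.
- have D h : prodsum h -> forall x, differentiable h x.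
    elim=> [a b sa sb x|a b _ da _ db x].
      by apply: differentiableM; exact: smooth_diff.
    by apply: differentiableD.
  move=> h j; elim=> [a b sa sb|a b pa IHa pb IHb].
    rewrite partialM; [|move=> x; exact: smooth_diff..].
    by apply: prodsumD; apply: prodsumM => //; exact: smooth_partial.
  by rewrite partialD; [exact: prodsumD|exact: D..].
Qed.

Lemma partialsD l f g : smoothR f -> smoothR g ->
  partials l (fun x => f x + g x) = fun x => partials l f x + partials l g x.
Proof.
move=> sf sg; elim: l => [|j l IH] //=; rewrite IH partialD// => x;
  exact/smooth_diff/smooth_partials.
Qed.

Lemma partialsZ l k f : smoothR f -> partials l (fun x => k * f x) = fun x => k * partials l f x.
Proof.
move=> sf; elim: l => [|j l IH] //=; rewrite IH partialZ// => x; exact/smooth_diff/smooth_partials.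
Qed.

Lemma partials_shift l c f : partials l (fun x => f (x + c)) = fun x => partials l f (x + c).
Proof. by elim: l => [|j l IH] //=; rewrite IH partial_shift. Qed.

Lemma smooth_sum (T : Type) (s : seq T) (G : T -> vec -> R) :
  (forall t, smoothR (G t)) -> smoothR (fun x => \sum_(t <- s) G t x).
Proof.
move=> h; elim: s => [|t s IH].
  rewrite (_ : (fun x => _) = fun=> 0); first exact: smooth_cst.
  by apply/funext => x; rewrite big_nil.
rewrite (_ : (fun x => _) = fun x => G t x + \sum_(t <- s) G t x); first exact: smoothD.
by apply/funext => x; rewrite big_cons.
Qed.

Lemma partials_sum l (T : Type) (s : seq T) (G : T -> vec -> R) :
  (forall t, smoothR (G t)) ->
  partials l (fun x => \sum_(t <- s) G t x) = fun x => \sum_(t <- s) partials l (G t) x.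
Proof.
move=> h; elim: s => [|t s IH].
  rewrite (_ : (fun x => _) = fun x => 0 * 0); last by apply/funext => x; rewrite big_nil mulr0.
  rewrite partialsZ; last exact: smooth_cst.
  by apply/funext => x; rewrite big_nil mul0r.
rewrite (_ : (fun x => \sum_(t <- _) G _ _) = fun x => G t x + \sum_(t <- s) G t x); last first.
  by apply/funext => x; rewrite big_cons.
rewrite partialsD//; last exact: smooth_sum.
by apply/funext => x; rewrite IH big_cons.
Qed.

Lemma line_derive f x b (t : R) : differentiable f (x + t *: b) ->
  is_derive t 1 (fun t : R => f (x + t *: b)) ('D_b f (x + t *: b)).
Proof.
move=> df; have dv := @diff_derivable _ _ _ _ _ b df.
have E : (fun h : R => h^-1 *: (((fun t : R => f (x + t *: b)) \o shift t) (h *: 1) - f (x + t *: b)))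
   = (fun h => h^-1 *: ((f \o shift (x + t *: b)) (h *: b) - f (x + t *: b))).
  apply/funext => h /=; congr (_ *: (f _ - _)).
  by rewrite scaler1 scalerDl addrCA.
apply: DeriveDef; first by rewrite /derivable E.
by rewrite /derive E.
Qed.

Lemma derive_coord f x b : differentiable f x -> 'D_b f x = \sum_(j < d) b 0 j * partial j f x.
Proof.
move=> df; rewrite deriveE// [X in 'd f x X]row_sum_delta linear_sum.
by apply: eq_bigr => j _; rewrite linearZ /= /partial deriveE.
Qed.

Lemma mvt_line f x b : (forall y, differentiable f y) ->
  exists2 t : R, 0 <= t <= 1 & f (x + b) - f x = \sum_(j < d) b 0 j * partial j f (x + t *: b).
Proof.
move=> df.
have [||t tI] := @MVT_segment R (fun t => f (x + t *: b)) (fun t => 'D_b f (x + t *: b)) 0 1 ler01.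
- by move=> t _; exact: line_derive.
- apply: derivable_within_continuous => t _.
  by have [] := line_derive (df (x + t *: b)).
- rewrite scale1r scale0r addr0 subr0 mulr1 derive_coord// => ->.
  by exists t => //; move: tI; rewrite in_itv.
Qed.

Lemma ejE j i : @ej R d j 0 i = (i == j)%:R.
Proof. by rewrite /ej mxE eqxx. Qed.

Lemma mvt_coord f x j (h : R) : (forall y, differentiable f y) ->
  exists2 t : R, 0 <= t <= 1 & f (x + h *: ej j) - f x = h * partial j f (x + (t * h) *: ej j).
Proof.
move=> df; have [t tI ->] := mvt_line x (h *: ej j) df; exists t => //.
rewrite (bigD1 j)//= big1 ?addr0.
  by rewrite mxE ejE eqxx mulr1 scalerA.
by move=> i ij; rewrite mxE ejE (negbTE ij) mulr0 mul0r.
Qed.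

Lemma norm_ej j : `|@ej R d j| <= 1.
Proof.
apply: vnorm_le => // i; rewrite ejE; case: eqP => _; by rewrite ?normr1 ?normr0.
Qed.

(** The mean value theorem is applied in direction [i] to the increment [F] of [g] along [ej j], and
    then in direction [j]. The left side is symmetric in [i] and [j], which is what [schwarz]
    exploits. *)
Lemma second_mixed g x i j (h : R) : smoothR g -> 0 <= h ->
  exists2 p, `|p - x| <= 2 * h &
    g (x + h *: ej i + h *: ej j) - g (x + h *: ej i) - (g (x + h *: ej j) - g x) =
    h * (h * partial j (partial i g) p).
Proof.
move=> sg h0; pose F y := g (y + h *: ej j) + -1 * g y.
have sF : smoothR F by apply: smoothD; [exact: smooth_shift|exact: smoothZ].
have [t /andP[t0 t1] Et] := mvt_coord x i h (fun y => smooth_diff y sF).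
have [t' /andP[t'0 t'1] Et'] := mvt_coord (x + (t * h) *: ej i) j h
  (fun y => smooth_diff y (smooth_partial i sg)).
exists (x + (t * h) *: ej i + (t' * h) *: ej j).
  rewrite -[x + _ + _]addrA [x + _]addrC addrK.
  apply: le_trans (ler_normD _ _) _; rewrite (normrZ (t * h)) (normrZ (t' * h)).
  have H (a : R) k : 0 <= a -> a <= 1 -> `|a * h| * `|@ej R d k| <= h.
    move=> a0 a1; rewrite ger0_norm ?mulr_ge0//.
    by apply: le_trans (ler_piMr _ (norm_ej _)) _; rewrite ?mulr_ge0// ler_piMl.
  by rewrite mulr_natl mulr2n lerD// H.
rewrite -Et' -[LHS]/(_ - (_ - _)).
have -> : partial i g (x + (t * h) *: ej i + h *: ej j) - partial i g (x + (t * h) *: ej i) =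
   partial i F (x + (t * h) *: ej i).
  rewrite /F partialD ?partialZ ?partial_shift ?mulN1r// => y; apply: smooth_diff => //.
  - exact: smooth_shift.
  - exact: smoothZ.
by rewrite -Et /F !mulN1r.
Qed.

Lemma eq_at_limit (A B : vec -> R) x :
  {for x, continuous A} -> {for x, continuous B} ->
  (forall h : R, 0 < h -> exists p q, [/\ `|p - x| <= 2 * h, `|q - x| <= 2 * h & A q = B p]) ->
  A x = B x.
Proof.
move=> cA cB H; have [//|ne] := eqVneq (A x) (B x).
have e0 : 0 < `|A x - B x| / 3 by rewrite divr_gt0// normr_gt0 subr_eq0.
have /cvgrPdist_lt/(_ _ e0)/nbhs_ballP[r1 /= r10 H1] := cA.
have /cvgrPdist_lt/(_ _ e0)/nbhs_ballP[r2 /= r20 H2] := cB.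
pose h := Num.min r1 r2 / 4.
have m0 : 0 < Num.min r1 r2 by rewrite lt_min r10.
have h0 : 0 < h by rewrite divr_gt0.
have [p [q [hp hq AB]]] := H h h0.
have hh : 2 * h < Num.min r1 r2 by rewrite /h; lra.
have bA : `|A x - A q| < `|A x - B x| / 3.
  apply: H1; rewrite -ball_normE /=; rewrite distrC; apply: le_lt_trans hq (lt_le_trans hh _).
  by rewrite ge_min lexx.
have bB : `|B x - B p| < `|A x - B x| / 3.
  apply: H2; rewrite -ball_normE /=; rewrite distrC; apply: le_lt_trans hp (lt_le_trans hh _).
  by rewrite ge_min lexx orbT.
have := ler_distD (A q) (A x) (B x).
rewrite {2}AB [`|B p - B x|]distrC; lra.
Qed.

Lemma schwarz g i j : smoothR g -> partial i (partial j g) = partial j (partial i g).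
Proof.
move=> sg; apply/funext => x; apply: eq_at_limit.
- by apply: differentiable_continuous; apply: smooth_diff; do 2 apply: smooth_partial.
- by apply: differentiable_continuous; apply: smooth_diff; do 2 apply: smooth_partial.
move=> h h0.
have [p hp Ep] := second_mixed x i j sg (ltW h0).
have [q hq Eq] := second_mixed x j i sg (ltW h0).
exists p, q; split; [exact: hp|exact: hq|].
have h00 : h != 0 by rewrite gt_eqF.
move: Ep Eq; move: (partial i _ q) (partial j _ p) => u v Ep Eq.
apply: (mulfI h00); apply: (mulfI h00); rewrite -Ep -Eq [x + h *: ej i + _]addrAC.
by move: (g x) (g _) (g _) (g _) => *; ring.
Qed.

Lemma partials_move l1 l2 j g : smoothR g ->
  partials (l1 ++ j :: l2) g = partials (j :: l1 ++ l2) g.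
Proof.
move=> sg; elim: l1 => [|i l1 IH] //=.
by rewrite IH /= schwarz//; exact: smooth_partials.
Qed.

Lemma partials_perm l l' g : smoothR g -> perm_eq l l' -> partials l g = partials l' g.
Proof.
move=> sg; elim: l l' => [|j l IH] l' p.
  by move: p; rewrite perm_sym => /perm_nilP ->.
have : j \in l' by rewrite -(perm_mem p) mem_head.
move=> /splitPr jl'; case: jl' p => l1 l2 p.
rewrite partials_move//=; congr (partial j _); apply: IH.
by move: p; rewrite perm_sym -[j :: l2]cat1s perm_catCA /= perm_cons perm_sym.
Qed.

Definition lst (a : 'I_d -> nat) : seq 'I_d := flatten [seq nseq (a j) j | j <- enum 'I_d].
Definition cnt l (j : 'I_d) : nat := count_mem j l.

Lemma mpartial_lst a g : mpartial a g = partials (lst a) g.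
Proof.
rewrite /mpartial /lst; elim: (enum 'I_d) => [|j e IH] //=.
rewrite partials_cat -IH; elim: (a j) => [|n IHn] //=; congr (partial j _); exact: IHn.
Qed.

Lemma cnt_lst a : cnt (lst a) = a.
Proof.
apply/funext => j; rewrite /cnt /lst count_flatten -map_comp sumnE big_map big_enum /=.
rewrite (bigD1 j)//= big1 ?addn0; first by rewrite count_nseq /= eqxx mul1n.
by move=> i ij; rewrite count_nseq /= (negbTE ij).
Qed.

Lemma lst_cnt l : perm_eq (lst (cnt l)) l.
Proof. by apply/allP => j _ /=; rewrite -/(cnt _ j) cnt_lst. Qed.

Lemma partials_mpartial l g : smoothR g -> partials l g = mpartial (cnt l) g.
Proof. by move=> sg; rewrite mpartial_lst; apply: partials_perm => //; rewrite perm_sym lst_cnt. Qed.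

(** Each derivative falls on one of the two factors, giving [2 ^ size l] terms with the same bound;
    this replaces multinomial coefficients. The induction is on pairs [l1], [l2] of derivatives
    already distributed, and the invariance of [Bd] under permutations makes their order
    irrelevant. *)
Lemma leibniz_bound (Bd : seq 'I_d -> R) (M : R) f g x l :
  smoothR f -> smoothR g ->
  (forall l l', perm_eq l l' -> Bd l = Bd l') ->
  (forall l1 l2, `|partials l1 f x| * `|partials l2 g x| <= M * Bd (l1 ++ l2)) ->
  `|partials l (fun x => f x * g x) x| <= 2 ^+ size l * (M * Bd l).
Proof.
move=> sf sg hB h.
suff H : forall l l1 l2, `|partials l (fun x => partials l1 f x * partials l2 g x) x| <=
    2 ^+ size l * (M * Bd (l ++ l1 ++ l2)).
  by have := H l [::] [::]; rewrite /= cats0.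
elim/last_ind => [|l0 j IH] l1 l2.
  by rewrite /= normrM expr0 mul1r.
have sf1 := smooth_partials l1 sf; have sg1 := smooth_partials l2 sg.
rewrite partials_rcons partialM; [|move=> y; exact: smooth_diff..].
rewrite partialsD; [|by apply: smoothM => //; exact: smooth_partial..].
apply: le_trans (ler_normD _ _) _.
have := IH (j :: l1) l2; have := IH l1 (j :: l2).
rewrite /= (hB _ (rcons l0 j ++ l1 ++ l2)); last first.
  by rewrite cat_rcons perm_cat2l -[j :: l2]cat1s perm_catCA.
rewrite (hB (l0 ++ j :: _) (rcons l0 j ++ l1 ++ l2)) ?cat_rcons//.
move=> h1 h2; rewrite size_rcons exprS.
by apply: le_trans (lerD h2 h1) _; lra.
Qed.

Lemma leibniz_bound_scaled (Bd : seq 'I_d -> R) (k M : R) f g x l :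
  smoothR f -> smoothR g -> 0 <= k ->
  (forall l l', perm_eq l l' -> Bd l = Bd l') ->
  (forall l1 l2, k * (`|partials l1 f x| * `|partials l2 g x|) <= M * Bd (l1 ++ l2)) ->
  k * `|partials l (fun x => f x * g x) x| <= 2 ^+ size l * (M * Bd l).
Proof.
move=> sf sg; rewrite le_eqVlt => /orP[/eqP <-|k0] hB h.
  rewrite mul0r mulr_ge0 ?exprn_ge0//.
  by have := h l [::]; rewrite cats0 mul0r.
rewrite mulrC -ler_pdivlMr// (_ : _ / k = 2 ^+ size l * ((M / k) * Bd l)); last by rewrite -!mulrA; ring.
apply: leibniz_bound => // l1 l2.
by rewrite mulrAC ler_pdivlMr// mulrC.
Qed.

End Calculus.

(** * Gelfand-Shilov bounds *)

Section Bounds.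
Local Open Scope ring_scope.
Local Open Scope classical_set_scope.
Context {R : realType} {d : nat}.
Local Notation vec := 'rV[R]_d.
Implicit Types (x y z c b : vec) (g f w : vec -> R) (j i : 'I_d) (l p : seq 'I_d)
  (s t h M rho e E : R).

Lemma le_eq (a c : R) : a = c -> a <= c. Proof. by move=> ->. Qed.

Lemma sum_const_ord (a : R) : \sum_(j < d) a = d%:R * a.
Proof. by rewrite sumr_const card_ord mulr_natl. Qed.

Lemma powR_exp s (a : R) n : 0 <= a -> (a `^ s) ^+ n = (a ^+ n) `^ s.
Proof. by move=> a0; rewrite -powR_mulrn ?powR_ge0// -powRrM mulrC powRrM powR_mulrn. Qed.

Lemma ge1_2powR s : 0 <= s -> 1 <= 2 `^ s :> R.
Proof.
move=> s0; have h : (1 : R) <= 2 by rewrite ler1n.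
by have := ler_powR h s0; rewrite powRr0.
Qed.

(* Multi-indices are encoded as lists of directions: [l] stands for [cnt l], and [bd s h l]
   for the factor [h ^ |alpha| * alpha! ^ s] of the Gelfand-Shilov bounds. *)
Definition lf l : nat := mfact (cnt l).
Definition bd s h l : R := h ^+ size l * ((lf l)%:R `^ s).
Definition xp x p : R := \prod_(j <- p) x 0 j.

Lemma cnt_cat l1 l2 j : cnt (l1 ++ l2) j = (cnt l1 j + cnt l2 j)%N.
Proof. exact: count_cat. Qed.

Lemma sum_cnt l : (\sum_(j < d) cnt l j)%N = size l.
Proof.
elim: l => [|i l IH]; first by rewrite big1.
rewrite /= -IH (eq_bigr (fun j => (i == j) + cnt l j)%N)//.
rewrite big_split /= (bigD1 i)//= eqxx big1 ?addn0// => j ji.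
by rewrite eq_sym (negbTE ji).
Qed.

Lemma fact_add (a b : nat) : (a`! * b`! <= (a + b)`!)%N.
Proof.
rewrite -(bin_fact (leq_addr b a)) addKn leq_pmull// bin_gt0 leq_addr//.
Qed.

Lemma fact_add2 (a b : nat) : ((a + b)`! <= 2 ^ (a + b) * (a`! * b`!))%N.
Proof.
rewrite -(bin_fact (leq_addr b a)) addKn leq_mul2r; apply/orP; right.
have := Pascal 1 1 (a + b); rewrite /= => ->.
rewrite (bigD1 (inord a)) //= inordK ?ltnS ?leq_addr// !exp1n !muln1.
exact: leq_addr.
Qed.

Lemma lf_cat l1 l2 : (lf l1 * lf l2 <= lf (l1 ++ l2))%N.
Proof.
rewrite /lf /mfact -big_split /=; apply: leq_prod => j _.
by rewrite cnt_cat fact_add.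
Qed.

Lemma lf_cat2 l1 l2 : (lf (l1 ++ l2) <= 2 ^ (size l1 + size l2) * (lf l1 * lf l2))%N.
Proof.
rewrite -!sum_cnt -big_split /= expn_sum /lf /mfact -!big_split /=.
by apply: leq_prod => j _; rewrite cnt_cat fact_add2.
Qed.

Lemma cnt_perm l l' : perm_eq l l' -> cnt l = cnt l'.
Proof. by move=> pl; apply/funext => j; exact/permP. Qed.

Lemma bd_perm s h l l' : perm_eq l l' -> bd s h l = bd s h l'.
Proof. by move=> pl; rewrite /bd /lf (cnt_perm pl) (perm_size pl). Qed.

Lemma bd_ge0 s h l : 0 <= h -> 0 <= bd s h l.
Proof. by move=> h0; rewrite mulr_ge0 ?exprn_ge0// powR_ge0. Qed.

Lemma bd_nil s h : bd s h [::] = 1.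
Proof.
by rewrite /bd expr0 mul1r /lf /mfact big1 ?powR1// => j _; rewrite /cnt fact0.
Qed.

Lemma bd_cat s h l1 l2 : 0 <= s -> 0 <= h -> bd s h l1 * bd s h l2 <= bd s h (l1 ++ l2).
Proof.
move=> s0 h0; rewrite /bd mulrACA -exprD size_cat ler_wpM2l ?exprn_ge0//.
rewrite -powRM// ge0_ler_powR ?nnegrE ?mulr_ge0//.
by rewrite -natrM ler_nat lf_cat.
Qed.

Lemma bd_scale s h (k : R) l : bd s (k * h) l = k ^+ size l * bd s h l.
Proof. by rewrite /bd exprMn mulrA. Qed.

Lemma bd_mono s h h' l : 0 <= h -> h <= h' -> bd s h l <= bd s h' l.
Proof.
by move=> h0 hh; rewrite ler_wpM2r ?powR_ge0// lerXn2r ?nnegrE// (le_trans h0).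
Qed.

(** Rests on [(a + b)! <= 2^(a + b) a! b!]: splitting a derivative costs [2^s] per order, which is
    absorbed into [h]. *)
Lemma bd_cat2 s h l1 l2 : 0 <= s -> 0 <= h ->
  bd s h (l1 ++ l2) <= bd s (2 `^ s * h) l1 * bd s (2 `^ s * h) l2.
Proof.
move=> s0 h0; rewrite !bd_scale mulrACA -exprD {1}/bd size_cat /bd mulrACA -exprD.
rewrite mulrCA ler_wpM2l ?exprn_ge0//.
rewrite -powRM// powR_exp// -powRM ?exprn_ge0 ?mulr_ge0// ge0_ler_powR ?nnegrE ?mulr_ge0 ?exprn_ge0//.
by rewrite -natrX -!natrM ler_nat lf_cat2.
Qed.

Lemma bd1 s h j : bd s h [:: j] = h.
Proof.
rewrite /bd expr1 /lf /mfact big1 ?powR1 ?mulr1// => i _.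
by rewrite /cnt /= addn0; case: (_ == _).
Qed.

Lemma xp_cat x p1 p2 : xp x (p1 ++ p2) = xp x p1 * xp x p2.
Proof. by rewrite /xp big_cat. Qed.

Lemma xp_xpow x p : xp x p = xpow x (cnt p).
Proof.
rewrite /xp /xpow; elim: p => [|i p IH].
  by rewrite big_nil big1// => j _; rewrite /cnt expr0.
rewrite big_cons IH.
rewrite [RHS](eq_bigr (fun j => x 0 j ^+ (i == j) * x 0 j ^+ cnt p j)); last first.
  by move=> j _; rewrite -exprD.
rewrite big_split /=; congr (_ * _); rewrite (bigD1 i)//= eqxx expr1 big1 ?mulr1// => j ji.
by rewrite eq_sym (negbTE ji) expr0.
Qed.

Lemma mabs_cnt l : mabs (cnt l) = size l. Proof. exact: sum_cnt. Qed.

Lemma exp_fact_bound (X : R) (n : nat) : 0 <= X -> X ^+ n <= n`!%:R * expR X.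
Proof.
move=> X0; have n0 : 0 < (n`!%:R : R) by rewrite ltr0n fact_gt0.
rewrite mulrC -ler_pdivrMr//.
have := nondecreasing_cvgn_le _ (@is_cvg_series_exp_coeff R X) n.+1.
rewrite /series /= => /(_ _); rewrite big_mkord big_ord_recr /= => H.
apply: le_trans (H _); last first.
  apply/nondecreasing_seqP => m; rewrite /series /= !big_mkord big_ord_recr /= lerDl.
  exact: exp_coeff_ge0.
rewrite ler_wpDl//; apply: sumr_ge0 => k _; exact: exp_coeff_ge0.
Qed.

(** A majorant of [r^n / n!^t] for all [n]: the [t]-th power of [X^n / n! <= exp X] at
    [X = r^(1/t)]. *)
Definition expt t (r : R) : R := expR (t * r `^ (1 / t)).

Lemma pow_expt t h (r : R) n : 0 < t -> 0 < h -> 0 <= r ->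
  r ^+ n <= expt t (r / h) * (h ^+ n * (n`!%:R `^ t)).
Proof.
move=> t0 h0 r0; set X := (r / h) `^ (1 / t).
have X0 : 0 <= X by exact: powR_ge0.
have := exp_fact_bound n X0.
move=> /(ge0_ler_powR (ltW t0)); rewrite !nnegrE exprn_ge0// mulr_ge0 ?expR_ge0//.
move=> /(_ isT isT); rewrite powRM ?expR_ge0//.
rewrite -powR_mulrn// -powRrM mulrC powRrM -[X `^ t]powRrM div1r mulVf ?gt_eqF// powRr1 ?divr_ge0 ?(ltW h0)//.
rewrite powR_mulrn ?divr_ge0 ?(ltW h0)// expr_div_n ler_pdivrMr ?exprn_gt0//.
by rewrite -expRM /expt [t * _]mulrC => /le_trans; apply; apply: le_eq; rewrite -/X; ring.
Qed.

Lemma xp_expt t h rho c p : 0 < t -> 0 < h -> 0 <= rho -> `|c| <= rho ->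
  `|xp c p| <= expt t (rho / h) ^+ d * bd t h p.
Proof.
move=> t0 h0 r0 cr; rewrite xp_xpow /xpow normr_prod.
have -> : bd t h p = \prod_(j < d) (h ^+ cnt p j * ((cnt p j)`!%:R `^ t)).
  rewrite big_split /= -expr_sum sum_cnt /bd; congr (_ * _).
  rewrite /lf /mfact; elim/big_rec2: _ => [|j u v _ <-]; first by rewrite powR1.
  by rewrite natrM powRM.
rewrite -[X in _ ^+ X]card_ord -prodr_const -big_split /=.
apply: ler_prod => j _; rewrite normr_ge0/= normrX.
apply: le_trans (_ : rho ^+ cnt p j <= _); last exact: pow_expt.
by rewrite lerXn2r ?nnegrE// (le_trans (vnorm_coord _ _)).
Qed.

(** The scheme of [leibniz_bound] for monomials: each factor is expanded as [y_j + c_j], and [p1],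
    [p2] record the choices already made. *)
Lemma xpD_bound t h (k B : R) y c p : 0 <= k ->
  (forall p1 p2, `|xp y p1| * `|xp c p2| * k <= B * bd t h (p1 ++ p2)) ->
  `|xp (y + c) p| * k <= 2 ^+ size p * (B * bd t h p).
Proof.
move=> k0 H.
suff G : forall p p1 p2, `|xp (y + c) p * xp y p1 * xp c p2| * k <= 2 ^+ size p * (B * bd t h (p ++ p1 ++ p2)).
  by have := G p [::] [::]; rewrite /= cats0 /xp !big_nil !mulr1.
elim=> [|j q IH] p1 p2.
  by rewrite /= {1}/xp big_nil !mul1r normrM.
have -> : xp (y + c) (j :: q) * xp y p1 * xp c p2 =
   xp (y + c) q * xp y (j :: p1) * xp c p2 + xp (y + c) q * xp y p1 * xp c (j :: p2).
  by rewrite /xp !big_cons !mxE; ring.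
apply: le_trans (ler_wpM2r k0 (ler_normD _ _)) _; rewrite mulrDl.
have := IH (j :: p1) p2; have := IH p1 (j :: p2).
rewrite (@bd_perm t h (q ++ p1 ++ j :: p2) ((j :: q) ++ p1 ++ p2)); last first.
  by rewrite catA -[j :: p2]cat1s perm_catCA /= catA.
rewrite (@bd_perm t h (q ++ (j :: p1) ++ p2) ((j :: q) ++ p1 ++ p2)); last first.
  by rewrite -[(j :: p1) ++ p2]/([:: j] ++ (p1 ++ p2)) perm_catCA.
move=> h1 h2; rewrite /= exprS; apply: le_trans (lerD h2 h1) _; rewrite /=; lra.
Qed.

(* [RB] is the Gelfand-Shilov bound of a real function; the integrable weight in [RBW] costs
   only a larger [h], by [RB_RBW]. *)
Definition RB s t h M g := forall l p x,
  `|xp x p| * `|partials l g x| <= M * (bd s h l * bd t h p).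

Definition RBW s t h M g := forall l p x,
  `|xp x p| * `|partials l g x| <= M * (bd s h l * bd t h p) * w2 x.

Definition WB w s h M g := forall l x, `|partials l g x| <= M * bd s h l * w x.

Lemma cabs_re (z : R[i]) : `|complex.Re z| <= cabs z.
Proof.
rewrite /cabs -sqrtr_sqr; apply: ler_wsqrtr; by rewrite lerDl sqr_ge0.
Qed.

Lemma cabs_im (z : R[i]) : `|complex.Im z| <= cabs z.
Proof.
rewrite /cabs -sqrtr_sqr; apply: ler_wsqrtr; by rewrite lerDr sqr_ge0.
Qed.

Lemma cabs_le (z : R[i]) : cabs z <= `|complex.Re z| + `|complex.Im z|.
Proof.
rewrite /cabs -[leRHS]ger0_norm ?addr_ge0// -sqrtr_sqr; apply: ler_wsqrtr.
rewrite -(real_normK (num_real (complex.Re z))) -(real_normK (num_real (complex.Im z))).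
have := mulr_ge0 (normr_ge0 (complex.Re z)) (normr_ge0 (complex.Im z)); nra.
Qed.

Lemma GSbound_RB s t h M F : smoothC F -> GSbound s t h M F ->
  RB s t h M (reF F) /\ RB s t h M (imF F).
Proof.
move=> [sr si] H; split=> l p x; have := H (cnt l) (cnt p) x;
  rewrite -xp_xpow !mabs_cnt /mpartialC -!partials_mpartial// => H1.
- apply: le_trans (ler_wpM2l (normr_ge0 _) (cabs_re (_ +i* _)%C)) (le_trans H1 _).
  by rewrite /bd /lf exprD; apply/le_eq; ring.
- apply: le_trans (ler_wpM2l (normr_ge0 _) (cabs_im (_ +i* _)%C)) (le_trans H1 _).
  by rewrite /bd /lf exprD; apply/le_eq; ring.
Qed.

Lemma RB_GSbound s t h M M' F :
  RB s t h M (reF F) -> RB s t h M' (imF F) -> GSbound s t h (M + M') F.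
Proof.
move=> H1 H2 a b x; have := H1 (lst a) (lst b) x; have := H2 (lst a) (lst b) x.
rewrite xp_xpow /bd /lf !cnt_lst -!mabs_cnt !cnt_lst -!mpartial_lst => h2 h1.
apply: le_trans (ler_wpM2l (normr_ge0 _) (cabs_le _)) _.
rewrite mulrDr; apply: le_trans (lerD h1 h2) _.
by rewrite exprD; apply/le_eq; ring.
Qed.

Lemma RBW_RB s t h M g : 0 <= h -> 0 <= M -> RBW s t h M g -> RB s t h M g.
Proof.
move=> h0 M0 H l p x; apply: le_trans (H l p x) _.
by rewrite ler_piMr ?w2_le1// mulr_ge0// mulr_ge0 ?bd_ge0.
Qed.

Lemma one_plus_pow (y : R) n : 0 <= y -> (1 + y) ^+ n <= 2 ^+ n * (1 + y ^+ n).
Proof.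
move=> y0; have [y1|y1] := lerP y 1.
  apply: le_trans (_ : 2 ^+ n <= _).
    by rewrite lerXn2r ?nnegrE ?addr_ge0//; lra.
  by rewrite ler_peMr ?exprn_ge0// lerDl exprn_ge0.
apply: le_trans (_ : (2 * y) ^+ n <= _).
  by rewrite lerXn2r ?nnegrE ?addr_ge0 ?mulr_ge0//; lra.
by rewrite exprMn ler_wpM2l ?exprn_ge0// lerDr.
Qed.

(** The monomial is multiplied by the power [4 d] of the largest coordinate of [x]. This power is
    [|x|^(4 d)], which together with 1 dominates the inverse [(1 + |x|^2)^(2 d)] of [w2]; [bd_cat2]
    then moves its share of the bound into the constant. *)
Lemma RB_RBW s t h : 0 < h -> 0 < t -> exists2 C : R, 0 <= C & forall M g, 0 <= M ->
  RB s t h M g -> RBW s t (2 `^ t * h) (C * M) g.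
Proof.
move=> h0 t0; set h' := 2 `^ t * h.
have h'0 : 0 < h' by rewrite mulr_gt0// powR_gt0.
have hh' : h <= h'.
  by rewrite ler_peMl ?(ltW h0)// ge1_2powR// ltW.
(* The value of [bd t h'] on the list that repeats one direction [4 * d] times. *)
set Q := h' ^+ (4 * d) * ((4 * d)`!%:R `^ t).
have Q0 : 0 <= Q by rewrite mulr_ge0 ?powR_ge0// exprn_ge0// ltW.
exists (2 ^+ (2 * d) * (1 + Q)); first by rewrite mulr_ge0 ?exprn_ge0 ?addr_ge0.
move=> M g M0 H l p x.
have bdl : bd s h l <= bd s h' l by rewrite bd_mono// ltW.
have bdp : bd t h p <= bd t h' p by rewrite bd_mono// ltW.
have B0 := bd_ge0 s l (ltW h0). have B1 := bd_ge0 t p (ltW h0).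
have B2 := bd_ge0 s l (ltW h'0). have B3 := bd_ge0 t p (ltW h'0).
set T := `|xp x p| * `|partials l g x|.
set D := bd s h' l * bd t h' p.
have D0 : 0 <= D by rewrite mulr_ge0.
have h1 : T <= M * D.
  by apply: le_trans (H l p x) _; rewrite ler_wpM2l// ler_pM.
have h2 : `|x| ^+ (4 * d) * T <= M * (D * Q).
  have [x0|xn0] := eqVneq `|x| 0.
    rewrite x0; case: (posnP d) => [d0|dp].
      rewrite {1}d0 muln0 expr0 mul1r (le_trans h1)// ler_wpM2l//.
      by rewrite ler_peMr// /Q d0 muln0 expr0 mul1r fact0 powR1.
    by rewrite expr0n muln_eq0 /= gtn_eqF// mul0r mulr_ge0// mulr_ge0.
  have [[i0 j] Ej] := mx_norm_neq0 xn0; rewrite /= ord1 in Ej.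
  have := H l (nseq (4 * d) j ++ p) x; rewrite xp_cat normrM.
  have -> : `|xp x (nseq (4 * d) j)| = `|x| ^+ (4 * d).
    rewrite /xp normr_prod [`|x|]Ej; elim: (4 * d)%N => [|n IH]; first by rewrite big_nil expr0.
    by rewrite /= big_cons IH exprS.
  rewrite -mulrA => /le_trans; apply; rewrite ler_wpM2l//.
  rewrite /D -mulrA ler_pM ?bd_ge0 ?(ltW h0)//.
  apply: le_trans (bd_cat2 _ _ (ltW t0) (ltW h0)) _.
  rewrite -/h' mulrC ler_wpM2l//.
  rewrite /Q /bd size_nseq ler_wpM2l ?exprn_ge0 ?(ltW h'0)//.
  rewrite ge0_ler_powR ?nnegrE ?(ltW t0)// ler_nat /lf /mfact (bigD1 j)//= big1 ?muln1.
    by rewrite /cnt count_nseq /= eqxx mul1n.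
  by move=> i ij; rewrite /cnt count_nseq /= eq_sym (negbTE ij).
have w2E : w2 x * (1 + `|x| ^+ 2) ^+ (2 * d) = 1.
  by rewrite /w2 /w1 -exprM mulnC /rho1 -exprMn mulVf ?expr1n.
have [W0 P0] : 0 <= w2 x /\ 0 <= (1 + `|x| ^+ 2) ^+ (2 * d).
  by rewrite w2_ge0 exprn_ge0// addr_ge0 ?sqr_ge0.
have T0 : 0 <= T by rewrite mulr_ge0.
rewrite [leLHS](_ : _ = ((1 + `|x| ^+ 2) ^+ (2 * d) * T) * w2 x); last first.
  by rewrite mulrAC [_ * w2 x]mulrC w2E mul1r.
apply: ler_wpM2r => //.
have := one_plus_pow (2 * d) (sqr_ge0 `|x|); rewrite -exprM mulnA (_ : (2 * 2)%N = 4%N)// => h3.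
apply: le_trans (ler_wpM2r T0 h3) _.
rewrite -[leLHS]mulrA mulrDl mul1r.
apply: le_trans (_ : 2 ^+ (2 * d) * (M * D + M * (D * Q)) <= _).
  by rewrite ler_wpM2l ?exprn_ge0// lerD.
by apply/le_eq; rewrite /D; ring.
Qed.

Lemma RBW_mono s t h h' M M' g : 0 <= h -> h <= h' -> 0 <= M -> M <= M' ->
  RBW s t h M g -> RBW s t h' M' g.
Proof.
move=> h0 hh M0 MM H l p x; apply: le_trans (H l p x) _.
rewrite ler_wpM2r ?w2_ge0//; apply: ler_pM => //; first by apply: mulr_ge0; exact: bd_ge0.
by apply: ler_pM; rewrite ?bd_ge0// bd_mono.
Qed.

Lemma WB_mono w s h h' M M' g : (forall x, 0 <= w x) -> 0 <= h -> h <= h' -> 0 <= M -> M <= M' ->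
  WB w s h M g -> WB w s h' M' g.
Proof.
move=> w0 h0 hh M0 MM H l x; apply: le_trans (H l x) _.
by rewrite ler_wpM2r// ler_pM ?bd_ge0// bd_mono.
Qed.

Lemma RBW_WB s t h M g : RBW s t h M g -> WB w2 s h M g.
Proof.
by move=> H l x; have := H l [::] x; rewrite /xp big_nil normr1 mul1r bd_nil mulr1.
Qed.

Lemma RB_DB s t h M g : RB s t h M g -> WB (fun=> 1) s h M g.
Proof.
by move=> H l x; have := H l [::] x; rewrite /xp big_nil normr1 mul1r bd_nil !mulr1.
Qed.

Lemma RBW_ge0 s t h M g : RBW s t h M g -> 0 <= M.
Proof.
move=> /(_ [::] [::] 0); rewrite !bd_nil !mulr1 => /(le_trans (mulr_ge0 _ _)).
by rewrite !normr_ge0 => /(_ isT isT); rewrite pmulr_lge0// w2_gt0.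
Qed.

Lemma RB_ge0 s t h M g : RB s t h M g -> 0 <= M.
Proof.
move=> /(_ [::] [::] 0); rewrite !bd_nil !mulr1 => /(le_trans (mulr_ge0 _ _)).
by rewrite !normr_ge0 => /(_ isT isT).
Qed.

Lemma WB_ge0 w s h M g : 0 < w 0 -> WB w s h M g -> 0 <= M.
Proof.
move=> w0 /(_ [::] 0); rewrite bd_nil mulr1 => /(le_trans (normr_ge0 _)).
by rewrite pmulr_lge0.
Qed.

Lemma RBWM s t h M M' g f : 0 <= s -> 0 <= h -> smoothR g -> smoothR f ->
  RBW s t h M g -> WB (fun=> 1) s h M' f -> RBW s t (2 * h) (M * M') (fun x => g x * f x).
Proof.
move=> s0 h0 sg sf Hg Hf l p x.
have M0 := RBW_ge0 Hg.
have M'0 : 0 <= M' by apply: WB_ge0 Hf; exact: ltr01.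
apply: le_trans (leibniz_bound_scaled (Bd := bd s h) (M := M * M' * bd t h p * w2 x) l sg sf _ _ _) _ => //.
- by move=> *; exact: bd_perm.
- move=> l1 l2; have := Hg l1 p x; have := Hf l2 x; rewrite mulr1 => h2 h1.
  rewrite [leLHS]mulrA; apply: le_trans (ler_pM _ _ h1 h2) _ => //.
  apply: le_trans (_ : M * M' * bd t h p * w2 x * (bd s h l1 * bd s h l2) <= _).
    by apply/le_eq; ring.
  by rewrite ler_wpM2l ?bd_cat// mulr_ge0 ?w2_ge0// mulr_ge0 ?bd_ge0// mulr_ge0.
rewrite !bd_scale.
have P : 1 <= 2 ^+ size p :> R by rewrite exprn_ege1// ler1n.
rewrite [leLHS](_ : _ = M * M' * (2 ^+ size l * bd s h l * bd t h p) * w2 x * 1); last by ring.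
rewrite [leRHS](_ : _ = M * M' * (2 ^+ size l * bd s h l * bd t h p) * w2 x * 2 ^+ size p); last by ring.
rewrite ler_wpM2l// mulr_ge0 ?w2_ge0// mulr_ge0 ?mulr_ge0 ?bd_ge0 ?exprn_ge0//.
Qed.

Lemma WBM w s h M M' g f : 0 <= s -> 0 <= h -> (forall x, 0 < w x) -> smoothR g -> smoothR f ->
  WB w s h M g -> WB (fun=> 1) s h M' f -> WB w s (2 * h) (M * M') (fun x => g x * f x).
Proof.
move=> s0 h0 w0 sg sf Hg Hf l x.
have M0 := WB_ge0 (w0 _) Hg.
have M'0 : 0 <= M' by apply: WB_ge0 Hf; exact: ltr01.
apply: le_trans (leibniz_bound (Bd := bd s h) (M := M * M' * w x) l sg sf _ _) _ => //.
- by move=> *; exact: bd_perm.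
- move=> l1 l2; have := Hg l1 x; have := Hf l2 x; rewrite mulr1 => h2 h1.
  apply: le_trans (ler_pM _ _ h1 h2) _ => //.
  apply: le_trans (_ : M * M' * w x * (bd s h l1 * bd s h l2) <= _).
    by apply/le_eq; ring.
  by rewrite ler_wpM2l ?bd_cat// mulr_ge0 ?(ltW (w0 _))// mulr_ge0.
by rewrite bd_scale; apply/le_eq; ring.
Qed.

(** Monomials at [x] are expanded around [x + c], which doubles the scale of the monomial part
    alone, and the weight is moved by Peetre's inequality. [E] depends on the size [rho] of the
    shift but not on [g], so the estimate is uniform over bounded translations. *)
Lemma RBW_near s t h rho : 0 < t -> 0 < h -> 0 <= rho ->
  exists2 E : R, 0 <= E & forall M g c x l p, RBW s t h M g -> `|c| <= rho ->
   `|xp x p| * `|partials l g (x + c)| <= E * M * (bd s h l * bd t (2 * h) p) * w2 x.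
Proof.
move=> t0 h0 r0; set e := expt t (rho / h) ^+ d.
have e0 : 0 <= e by rewrite exprn_ge0// expR_ge0.
set W := (2 ^+ d * (1 + rho ^+ 2) ^+ d) ^+ 2 : R.
have W0 : 0 <= W by rewrite exprn_ge0// mulr_ge0 ?exprn_ge0// addr_ge0 ?sqr_ge0.
exists (e * W); first by rewrite mulr_ge0.
move=> M g c x l p H cr; have M0 := RBW_ge0 H.
have wx : w2 (x + c) <= W * w2 x.
  apply: le_trans (w2D x c) _; rewrite ler_wpM2r ?w2_ge0//.
  rewrite /W lerXn2r ?nnegrE ?mulr_ge0 ?exprn_ge0 ?addr_ge0 ?sqr_ge0//.
  rewrite ler_wpM2l ?exprn_ge0// lerXn2r ?nnegrE ?addr_ge0 ?sqr_ge0//.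
  by rewrite lerD2l lerXn2r ?nnegrE.
have -> : `|xp x p| = `|xp ((x + c) + - c) p| by rewrite addrK.
apply: le_trans (@xpD_bound t h `|partials l g (x + c)| (M * e * bd s h l * w2 (x + c)) (x + c) (- c) p _ _) _ => //.
  move=> p1 p2; have h1 := H l p1 (x + c).
  have h2 : `|xp (- c) p2| <= e * bd t h p2 by apply: xp_expt => //; rewrite normrN.
  rewrite mulrAC; apply: le_trans (ler_pM _ _ h1 h2) _ => //.
  apply: le_trans (_ : M * e * bd s h l * w2 (x + c) * (bd t h p1 * bd t h p2) <= _).
    by apply/le_eq; ring.
  apply: ler_wpM2l; last by apply: bd_cat; exact: ltW.
  by rewrite mulr_ge0 ?w2_ge0// mulr_ge0 ?bd_ge0 ?(ltW h0)// mulr_ge0.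
rewrite bd_scale.
rewrite [leLHS](_ : _ = (M * e * bd s h l * (2 ^+ size p * bd t h p)) * w2 (x + c)); last by ring.
rewrite [leRHS](_ : _ = (M * e * bd s h l * (2 ^+ size p * bd t h p)) * (W * w2 x)); last by ring.
apply: ler_wpM2l => //; rewrite mulr_ge0//.
  by rewrite mulr_ge0 ?bd_ge0 ?(ltW h0)// mulr_ge0.
by rewrite mulr_ge0 ?bd_ge0 ?(ltW h0)// exprn_ge0.
Qed.

Lemma RBW_shift s t h rho : 0 < t -> 0 < h -> 0 <= rho ->
  exists2 E : R, 0 <= E & forall M g c, RBW s t h M g -> `|c| <= rho ->
   RBW s t (2 * h) (E * M) (fun x => g (x + c)).
Proof.
move=> t0 h0 r0; have [E E0 H] := RBW_near s t0 h0 r0.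
exists E => // M g c Hg cr l p x; rewrite partials_shift.
have M0 := RBW_ge0 Hg.
apply: le_trans (H _ _ _ _ _ _ Hg cr) _.
rewrite ler_wpM2r ?w2_ge0// ler_wpM2l ?mulr_ge0// ler_wpM2r ?bd_ge0 ?mulr_ge0 ?(ltW h0)//.
by rewrite bd_mono ?(ltW h0)//; lra.
Qed.

Lemma WB_lip s h M g l : 0 <= s -> 0 <= h -> smoothR g -> WB w2 s h M g ->
  lip w2 ((1 + d%:R * (2 `^ s * h) * (4 ^+ d) ^+ 2) * M * bd s (2 `^ s * h) l) (partials l g).
Proof.
move=> s0 h0 sg H; set h' := 2 `^ s * h.
have h'0 : 0 <= h' by rewrite mulr_ge0 ?powR_ge0.
have hh' : h <= h'.
  by rewrite ler_peMl// ge1_2powR.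
have M0 : 0 <= M by apply: WB_ge0 H; exact: w2_gt0.
have K0 : 0 <= d%:R * h' * (4 ^+ d) ^+ 2 by rewrite !mulr_ge0 ?exprn_ge0.
have B0 := bd_ge0 s l h'0.
split=> [x|x y y1].
  apply: le_trans (H l x) _; rewrite ler_wpM2r ?w2_ge0//.
  apply: ler_pM => //; [exact: bd_ge0|by rewrite ler_peMl// lerDl|exact: bd_mono].
have [t /andP[t0 t1] ->] := mvt_line x y (fun y => smooth_diff y (smooth_partials l sg)).
apply: le_trans (ler_norm_sum _ _ _) _.
(* Since [|t *: y| <= 1], the factor [2^d (1 + |t y|^2)^d] of [w2D] is at most [4^d]. *)
have wb : w2 (x + t *: y) <= (4 ^+ d) ^+ 2 * w2 x.
  apply: le_trans (w2D x (t *: y)) _; rewrite ler_wpM2r ?w2_ge0//.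
  rewrite lerXn2r ?nnegrE ?mulr_ge0 ?exprn_ge0 ?addr_ge0 ?sqr_ge0//.
  rewrite -exprMn lerXn2r ?nnegrE ?mulr_ge0 ?addr_ge0 ?sqr_ge0//.
  have : `|t *: y| ^+ 2 <= 1.
    by rewrite exprn_ile1// normrZ ger0_norm// mulr_ile1.
  lra.
apply: le_trans (_ : \sum_(j < d) `|y| * (M * (h' * bd s h' l) * ((4 ^+ d) ^+ 2 * w2 x)) <= _).
  apply: ler_sum => j _; rewrite normrM ler_pM// ?vnorm_coord//.
  apply: le_trans (H (j :: l) _) _.
  have hb : M * bd s h (j :: l) <= M * (h' * bd s h' l).
    by rewrite ler_wpM2l//; have := bd_cat2 [:: j] l s0 h0; rewrite /= bd1.
  by apply: ler_pM hb wb; rewrite ?w2_ge0// mulr_ge0// bd_ge0.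
rewrite sum_const_ord; set D := d%:R.
rewrite [leLHS](_ : _ = (D * h' * (4 ^+ d) ^+ 2) * (M * bd s h' l * `|y| * w2 x)); last by ring.
rewrite [leRHS](_ : _ = (1 + D * h' * (4 ^+ d) ^+ 2) * (M * bd s h' l * `|y| * w2 x)); last by ring.
have P0 : 0 <= M * bd s h' l * `|y| * w2 x.
  by rewrite mulr_ge0 ?w2_ge0// mulr_ge0// mulr_ge0.
by apply: ler_wpM2r => //; rewrite lerDr.
Qed.

(** Minus the second difference quotient in direction [b]: with this sign its Fourier symbol is
    nonnegative. *)
Definition sdiff (b : vec) (e : R) g : vec -> R :=
  fun x => e ^- 2 * (2 * g x + (-1) * (g (x + e *: b) + g (x - e *: b))).

Lemma smooth_sdiff b e g : smoothR g -> smoothR (sdiff b e g).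
Proof.
move=> sg; apply/smoothZ/smoothD; first exact: smoothZ.
by apply/smoothZ/smoothD; exact: smooth_shift.
Qed.

Lemma partials_sdiff b e g l : smoothR g -> partials l (sdiff b e g) = sdiff b e (partials l g).
Proof.
move=> sg.
have s1 : smoothR (fun x => 2 * g x) by exact: smoothZ.
have s2 : smoothR (fun x => g (x + e *: b) + g (x - e *: b)).
  by apply: smoothD; exact: smooth_shift.
rewrite /sdiff partialsZ; last by apply: smoothD => //; exact: smoothZ.
rewrite partialsD//; last exact: smoothZ.
rewrite !partialsZ// partialsD ?partials_shift//; exact: smooth_shift.
Qed.

(** The increments from [x - e b] to [x] and from [x] to [x + e b] are written as first derivatives
    at [x + y2] and [x + y1], and the mean value theorem is applied once more to their difference.
    The two factors [e] gained cancel [e^-2], and the points reached are within [rho + 2 rho] of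
    [x]. *)
Lemma sdiff_bound b e g rho (k B : R) x : 0 < e -> e <= 1 -> `|b| <= rho -> 0 <= k ->
  smoothR g ->
  (forall c i j, `|c| <= 3 * rho -> k * `|partial j (partial i g) (x + c)| <= B) ->
  k * `|sdiff b e g x| <= d%:R ^+ 2 * 3 * rho ^+ 2 * B.
Proof.
move=> e0 e1 br k0 sg H.
have r0 : 0 <= rho by exact: le_trans br.
have dg y := smooth_diff y sg.
have [t1 /andP[t10 t11] E1] := mvt_line x (e *: b) dg.
have [t2 /andP[t20 t21] E2] := mvt_line (x - e *: b) (e *: b) dg.
rewrite subrK in E2.
set y1 := t1 *: (e *: b) in E1; set y2 := - (e *: b) + t2 *: (e *: b) in E2.
have neb : `|e *: b| <= e * rho by rewrite normrZ gtr0_norm// ler_wpM2l// ltW.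
have er : e * rho <= rho by rewrite ler_piMl.
have ny1 : `|y1| <= e * rho.
  by rewrite /y1 normrZ ger0_norm// (le_trans (ler_piMl _ _) neb).
have ny2 : `|y2| <= e * rho.
  rewrite (_ : y2 = (t2 - 1) *: (e *: b)); last by rewrite /y2 scalerBl scale1r addrC.
  rewrite normrZ ler0_norm ?subr_le0// (le_trans _ neb)// ler_piMl//; lra.
have dE : sdiff b e g x = e ^- 2 * \sum_(i < d) (e *: b) 0 i * (partial i g (x + y2) - partial i g (x + y1)).
  rewrite /sdiff; congr (_ * _).
  rewrite (eq_bigr (fun i => (e *: b) 0 i * partial i g (x + y2) - (e *: b) 0 i * partial i g (x + y1))).
    rewrite sumrB -E1 {1}/y2 addrA -E2; ring.
  by move=> i _; rewrite mulrBr.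
have term i : k * `|partial i g (x + y2) - partial i g (x + y1)| <= d%:R * (2 * e * rho) * B.
  have [t /andP[ta tb] E] := mvt_line (x + y1) (y2 - y1) (fun y => smooth_diff y (smooth_partial i sg)).
  have ny : `|y2 - y1| <= 2 * e * rho.
    by apply: le_trans (ler_normB _ _) _; apply: le_trans (lerD ny2 ny1) _; lra.
  rewrite -[x + y2](_ : x + y1 + (y2 - y1) = _); last by rewrite -addrA subrKC.
  rewrite E; apply: le_trans (ler_wpM2l k0 (ler_norm_sum _ _ _)) _.
  rewrite mulr_sumr -mulrA mulr_natl -[X in _ *+ X]card_ord -sumr_const.
  apply: ler_sum => j _; rewrite normrM mulrCA ler_pM ?mulr_ge0//.
    exact: le_trans (vnorm_coord _ _) ny.
  rewrite -addrA; apply: H.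
  apply: le_trans (ler_normD _ _) _.
  have : `|t *: (y2 - y1)| <= 2 * e * rho.
    by rewrite normrZ ger0_norm// (le_trans (ler_piMl _ _) ny).
  move=> h1; apply: le_trans (lerD ny1 h1) _; lra.
rewrite dE normrM [`|e ^- 2|]gtr0_norm ?invr_gt0 ?exprn_gt0// mulrCA.
rewrite mulrC ler_pdivrMr ?exprn_gt0//.
apply: le_trans (ler_wpM2l k0 (ler_norm_sum _ _ _)) _.
rewrite mulr_sumr.
apply: le_trans (_ : \sum_(i < d) e * rho * (d%:R * (2 * e * rho) * B) <= _).
  apply: ler_sum => i _; rewrite normrM mulrCA ler_pM ?mulr_ge0//.
  exact: le_trans (vnorm_coord _ _) neb.
rewrite sum_const_ord.
case: (posnP d) => [d0|dp].
  by have -> : (d%:R : R) = 0; [rewrite d0|rewrite expr0n /= !mul0r].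
have B0 : 0 <= B.
  by apply: le_trans (H 0 (Ordinal dp) (Ordinal dp) _); rewrite ?mulr_ge0// normr0 mulr_ge0.
move: (d%:R : R) => D.
have HH := mulr_ge0 (mulr_ge0 (sqr_ge0 D) (sqr_ge0 (e * rho))) B0.
rewrite [leLHS](_ : _ = D ^+ 2 * 2 * rho ^+ 2 * B * e ^+ 2); last by ring.
rewrite (_ : D ^+ 2 * (e * rho) ^+ 2 * B = D ^+ 2 * rho ^+ 2 * B * e ^+ 2) in HH; last by ring.
lra.
Qed.

Lemma RBW_sdiff s t h rho : 0 <= s -> 0 < t -> 0 < h -> 0 <= rho ->
  exists2 C : R, 0 <= C & forall M g b e, smoothR g -> RBW s t h M g -> `|b| <= rho -> 0 < e -> e <= 1 ->
   RBW s t ((2 `^ s + 2) * h) (C * M) (sdiff b e g).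
Proof.
move=> s0 t0 h0 r0.
have r30 : 0 <= 3 * rho by rewrite mulr_ge0.
have [E E0 HE] := RBW_near s t0 h0 r30.
(* [2^s] comes from splitting off the two derivatives by [bd_cat2], and [2] from [RBW_near]. *)
set h' := 2 `^ s * h; set h2 := (2 `^ s + 2) * h.
have h'0 : 0 <= h' by rewrite mulr_ge0 ?powR_ge0// ltW.
have q0 : 0 <= 2 `^ s :> R := powR_ge0 _ _.
set h'' := 2 `^ s * h'.
have h'h2 : h' <= h2 by rewrite /h' /h2 ler_wpM2r ?(ltW h0)//; lra.
have hh2 : 2 * h <= h2 by rewrite /h2 ler_wpM2r ?(ltW h0)//; lra.
pose K := \sum_(i < d) \sum_(j < d) bd s h' [:: j; i].
have K0 i j : bd s h' [:: j; i] <= K.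
  rewrite /K (bigD1 i)//= (bigD1 j)//= -addrA ler_wpDr// addr_ge0// sumr_ge0// => *;
    rewrite ?sumr_ge0// => *; exact: bd_ge0.
have K00 : 0 <= K by rewrite sumr_ge0// => i _; rewrite sumr_ge0// => j _; exact: bd_ge0.
exists (d%:R ^+ 2 * 3 * rho ^+ 2 * (E * K)).
  by rewrite !mulr_ge0.
move=> M g b e sg Hg br e0 e1 l p x; have M0 := RBW_ge0 Hg.
rewrite partials_sdiff//.
apply: le_trans (sdiff_bound (B := E * M * (K * bd s h' l * bd t (2 * h) p) * w2 x) e0 e1 br _ _ _) _.
- exact: normr_ge0.
- exact: smooth_partials.
- move=> c i j cr.
  apply: le_trans (HE M g c x (j :: i :: l) p Hg cr) _.
  rewrite ler_wpM2r ?w2_ge0// ler_wpM2l ?mulr_ge0// ler_wpM2r ?bd_ge0 ?mulr_ge0 ?(ltW h0)//.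
  apply: le_trans (bd_cat2 [:: j; i] l s0 (ltW h0)) _.
  by rewrite ler_wpM2r ?bd_ge0.
rewrite [leLHS](_ : _ = d%:R ^+ 2 * 3 * rho ^+ 2 * (E * K) * M * (bd s h' l * bd t (2 * h) p) * w2 x); last by ring.
rewrite ler_wpM2r ?w2_ge0// ler_wpM2l//; first by rewrite !mulr_ge0.
by apply: ler_pM; rewrite ?bd_ge0 ?bd_mono ?mulr_ge0// ltW.
Qed.

End Bounds.

(** * Trigonometric functions and integrals of derivatives *)

Section Trig.
Local Open Scope ring_scope.
Local Open Scope classical_set_scope.
Context {R : realType} {d : nat}.
Local Notation vec := 'rV[R]_d.
Implicit Types (x y z c : vec) (g f w : vec -> R) (j i : 'I_d) (l p : seq 'I_d)
  (s t h M rho e : R).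
Local Notation I := (@intRd R d).

Lemma innerDl x y z : inner (x + y) z = inner x z + inner y z.
Proof. by rewrite /inner -big_split /=; apply: eq_bigr => j _; rewrite mxE mulrDl. Qed.

Lemma innerZl (a : R) x z : inner (a *: x) z = a * inner x z.
Proof. by rewrite /inner mulr_sumr; apply: eq_bigr => j _; rewrite mxE mulrA. Qed.

Lemma innerC x y : inner x y = inner y x.
Proof. by apply: eq_bigr => j _; rewrite mulrC. Qed.

Lemma innerNl x z : inner (- x) z = - inner x z.
Proof. by rewrite -scaleN1r innerZl mulN1r. Qed.

Lemma innerDr x y z : inner x (y + z) = inner x y + inner x z.
Proof. by rewrite innerC innerDl !(innerC x). Qed.

Lemma innerNr x z : inner x (- z) = - inner x z.
Proof. by rewrite innerC innerNl innerC. Qed.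

Lemma inner_ej j z : inner (ej j) z = z 0 j.
Proof.
rewrite /inner (bigD1 j)//= ejE eqxx mul1r big1 ?addr0// => i ij.
by rewrite ejE (negbTE ij) mul0r.
Qed.

Lemma diff_inner z x : differentiable (fun x => inner x z) x.
Proof.
rewrite (_ : (fun x => inner x z) = fun x : vec => \sum_(j < d) (z 0 j * x 0 j)); last first.
  by apply/funext => y; apply: eq_bigr => j _; rewrite mulrC.
rewrite (_ : (fun x => _) = \sum_(j < d) (fun x : vec => z 0 j * x 0 j)); last first.
  by apply/funext => y; rewrite fct_sumE.
apply: differentiable_sum => j.
exact: (@differentiableZ _ _ _ (fun x : vec => x 0 j) (z 0 j) x (differentiable_coord x 0 j)).
Qed.

(** A family stable under partial derivatives: they only act on the pair [(a, b)], and [|a| + |b|]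
    is multiplied by [|z_j|]. Real and imaginary parts of complex exponentials both belong to it. *)
Definition trig (a b : R) z x : R := a * cos (inner x z) + b * sin (inner x z).

Lemma diff_trig a b z x : differentiable (trig a b z) x.
Proof.
have dc : differentiable (fun x => cos (inner x z)) x.
  apply: (@differentiable_comp _ _ _ _ (fun x => inner x z) cos); first exact: diff_inner.
  by apply/derivable1_diffP; exact: derivable_cos.
have ds : differentiable (fun x => sin (inner x z)) x.
  apply: (@differentiable_comp _ _ _ _ (fun x => inner x z) sin); first exact: diff_inner.
  by apply/derivable1_diffP; exact: derivable_sin.
apply: differentiableD.
  exact: (@differentiableZ _ _ _ _ a x dc).
exact: (@differentiableZ _ _ _ _ b x ds).
Qed.

Lemma partial_trig j a b z : partial j (trig a b z) = trig (b * z 0 j) (- (a * z 0 j)) z.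
Proof.
apply/funext => x; rewrite /partial.
have H := @line_derive R d (trig a b z) x (ej j) 0 (diff_trig _ _ _ _).
rewrite scale0r addr0 in H; rewrite -(@derive_val _ _ _ _ _ _ _ H).
have -> : (fun t : R => trig a b z (x + t *: ej j)) =
   (fun t => a * cos (inner x z + t * z 0 j) + b * sin (inner x z + t * z 0 j)).
  by apply/funext => t; rewrite /trig innerDl innerZl inner_ej.
have D : is_derive (0 : R) 1 (fun t : R => inner x z + t * z 0 j) (z 0 j).
  rewrite (_ : (fun t : R => _) = (cst (inner x z)) + (z 0 j *: id)); last first.
    by apply/funext => t /=; rewrite mulrC.
  have := is_deriveD (is_derive_cst (inner x z) (0 : R) 1) (is_deriveZ (z 0 j) (is_derive_id (0 : R) 1)).
  by rewrite add0r /GRing.scale/= mulr1.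
have Dc := @is_derive1_comp _ cos _ 0 _ _ (is_derive_cos _) D.
have Ds := @is_derive1_comp _ sin _ 0 _ _ (is_derive_sin _) D.
have -> : (fun t : R => a * cos (inner x z + t * z 0 j) + b * sin (inner x z + t * z 0 j)) =
  (a *: (cos \o (fun t : R => inner x z + t * z 0 j))) + (b *: (sin \o (fun t : R => inner x z + t * z 0 j))).
  by apply/funext => t.
rewrite (@derive_val _ _ _ _ _ _ _ (is_deriveD (is_deriveZ a Dc) (is_deriveZ b Ds))).
by rewrite mul0r addr0 /trig /GRing.scale/=; ring.
Qed.

Lemma smooth_trig a b z : smoothR (trig a b z).
Proof.
apply: (smooth_ind (C := fun f => exists a b, f = trig a b z)); last by exists a, b.
- by move=> _ [a' [b' ->]] x; exact: diff_trig.
- by move=> _ j [a' [b' ->]]; rewrite partial_trig; eexists; eexists.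
Qed.

Lemma partials_trig l a b z : exists a' b', partials l (trig a b z) = trig a' b' z /\
  `|a'| + `|b'| = `|xp z l| * (`|a| + `|b|).
Proof.
elim: l => [|j l [a' [b' [E N]]]].
  by exists a, b; rewrite /xp big_nil normr1 mul1r.
exists (b' * z 0 j), (- (a' * z 0 j)); rewrite /= E partial_trig; split => //.
by rewrite /xp big_cons -/(xp z l) normrN !normrM -[RHS]mulrA -N; ring.
Qed.

Lemma trig_le a b z x : `|trig a b z x| <= `|a| + `|b|.
Proof.
rewrite /trig; apply: le_trans (ler_normD _ _) _; rewrite !normrM lerD//.
  by rewrite ler_piMr// ler_norml cos_geN1 cos_le1.
by rewrite ler_piMr// ler_norml sin_geN1 sin_le1.
Qed.

Lemma trig_xp l a b z x : `|partials l (trig a b z) x| <= `|xp z l| * (`|a| + `|b|).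
Proof. by have [a' [b' [-> <-]]] := partials_trig l a b z; exact: trig_le. Qed.

Lemma WB_trig s h rho a b z : 0 < s -> 0 < h -> 0 <= rho -> `|z| <= rho ->
  WB (fun=> 1) s h (expt s (rho / h) ^+ d * (`|a| + `|b|)) (trig a b z).
Proof.
move=> s0 h0 r0 zr l x; rewrite mulr1; apply: le_trans (trig_xp _ _ _ _ _) _.
by rewrite [leRHS]mulrAC ler_wpM2r ?addr_ge0// xp_expt.
Qed.

(** A consequence of translation invariance: the integral of [g (x + e ej) - g x] is 0, while the
    integrand is [e * partial j g x] up to an error of order [e^2] with integrable weight. Dividing
    by [e] and letting [e] tend to 0 gives the claim. *)
Lemma I_partial M M' g j : (forall x, differentiable g x) -> lip w1 M g ->
  lip w1 M' (partial j g) -> I (partial j g) = 0.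
Proof.
move=> dg Lg Lp.
have M0 : 0 <= M by have := le_trans (normr_ge0 _) (Lg.1 0); rewrite pmulr_lge0// w1_gt0.
have M'0 : 0 <= M' by have := le_trans (normr_ge0 _) (Lp.1 0); rewrite pmulr_lge0// w1_gt0.
have C0 : 0 <= @CI R d by exact: CI_ge0.
suff H : forall e, 0 < e -> e <= 1 -> `|I (partial j g)| <= e * (M' * @CI R d).
  apply/eqP; rewrite -normr_le0; apply/ler_addgt0Pr => e e0; rewrite add0r.
  set K := M' * @CI R d; have K0 : 0 <= K by rewrite mulr_ge0.
  have m0 : 0 < Num.min 1 (e / (K + 1)).
    by rewrite lt_min ltr01 divr_gt0// ltr_wpDl.
  apply: le_trans (H _ m0 _) _; first by rewrite ge_min lexx.
  apply: le_trans (_ : e / (K + 1) * K <= _).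
    by rewrite ler_wpM2r// ge_min lexx orbT.
  rewrite mulrAC ler_pdivrMr ?ltr_wpDl// ler_wpM2l ?(ltW e0)// lerDl//.
move=> e e0 e1.
have Ls : lip w1 (M * (2 ^+ d * (1 + `|e *: ej j| ^+ 2) ^+ d)) (fun x => g (x + e *: ej j)).
  by apply: lip_shift => // x; exact: w1D.
have Ls0 : 0 <= M * (2 ^+ d * (1 + `|e *: ej j| ^+ 2) ^+ d).
  by rewrite !mulr_ge0// exprn_ge0// addr_ge0// sqr_ge0.
have L1 := lipZ (-1) Lg; have L2 := lipZ (- e) Lp.
have L12 := lipD L1 L2.
have n1 : 0 <= `|(-1 : R)| * M by rewrite mulr_ge0.
have n2 : 0 <= `|- e| * M' by rewrite mulr_ge0.
have L := lipD Ls L12.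
have EI : I (fun x => g (x + e *: ej j) + (-1 * g x + - e * partial j g x)) = - e * I (partial j g).
  rewrite (I_add _ _ Ls L12)// ?addr_ge0// (I_add _ _ L1 L2)// (I_scale _ _ Lg)// (I_scale _ _ Lp)//.
  by rewrite (I_shift _ _ Lg)// mulN1r addrA subrr add0r.
have : `|- e * I (partial j g)| <= (M' * e ^+ 2) * @CI R d.
  rewrite -EI; apply: I_bound L _; first by rewrite !addr_ge0.
  move=> x; have [t /andP[t0 t1] E] := mvt_coord x j e dg.
  rewrite mulN1r addrA E mulNr -mulrBr normrM gtr0_norm//.
  have te : `|(t * e) *: ej j : vec| <= e.
    rewrite normrZ ger0_norm ?mulr_ge0 ?(ltW e0)//.
    by apply: le_trans (ler_piMr _ (norm_ej j)) _; rewrite ?mulr_ge0 ?(ltW e0)// ler_piMl ?(ltW e0).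
  have := Lp.2 x ((t * e) *: ej j) (le_trans te e1) => H.
  apply: le_trans (ler_wpM2l (ltW e0) H) _.
  rewrite [leRHS](_ : _ = e * (M' * e * w1 x)); last by ring.
  by rewrite ler_wpM2l ?(ltW e0)// ler_wpM2r ?w1_ge0// ler_wpM2l.
rewrite normrM normrN (gtr0_norm e0) => Q; rewrite -(ler_pM2l e0); apply: le_trans Q _.
by apply: le_eq; ring.
Qed.

End Trig.

(** * Sums over the lattice and Riemann sums *)

Section ZSum.
Local Open Scope ring_scope.
Local Open Scope classical_set_scope.
Context {R : realType}.

(** The induction needs the sharper bound stated first. It telescopes because [(N + k)(N + k + 1) <=
    2 (N^2 + (k + 1)^2)]. *)
Lemma sum_rho1_bound (N : R) (K : nat) : 1 <= N ->
  \sum_(m < K.*2.+1) rho1 (((m : nat)%:Z - K%:Z)%:~R / N) <= 5 * N.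
Proof.
move=> N1; have N0 : 0 < N by rewrite (lt_le_trans ltr01).
suff H : \sum_(m < K.*2.+1) rho1 (((m : nat)%:Z - K%:Z)%:~R / N) <=
   1 + 4 * N - 4 * N ^+ 2 / (N + K%:R).
  apply: le_trans H _.
  have : 0 <= 4 * N ^+ 2 / (N + K%:R).
    by rewrite divr_ge0 ?addr_ge0 ?mulr_ge0 ?sqr_ge0// ltW.
  lra.
elim: K => [|K IH].
  rewrite big_ord1 subrr mul0r /rho1 expr0n addr0 invr1 addr0.
  by rewrite expr2 mulrA mulfK ?gt_eqF//; lra.
rewrite doubleS big_ord_recl big_ord_recr /=.
rewrite (eq_bigr (fun m : 'I_(K.*2.+1) => rho1 (((m : nat)%:Z - K%:Z)%:~R / N))); last first.
  move=> m _; congr (rho1 (_%:~R / _)); rewrite /bump /= add1n; lia.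
have e1 : (0%:Z - K.+1%:Z)%:~R / N = - (K.+1%:R / N).
  by rewrite add0r mulrNz mulNr.
have e2 : ((bump 0 K.*2.+1)%:Z - K.+1%:Z)%:~R / N = K.+1%:R / N.
  rewrite (_ : (bump 0 K.*2.+1)%:Z - K.+1%:Z = K.+1%:Z)// /bump /=; lia.
rewrite e1 e2 /rho1 sqrrN.
set S := \sum_(_ < _) _ in IH *.
have k0 : 0 <= K%:R :> R by [].
have -> : (K.+1%:R : R) = K%:R + 1 by rewrite -natr1.
move: (K%:R : R) k0 IH => k k0 IH.
have d1 : 0 < N + k by rewrite ltr_wpDr.
have d2 : 0 < N + (k + 1) by rewrite ltr_wpDr// addr_ge0.
have d3 : 0 < N ^+ 2 + (k + 1) ^+ 2 by rewrite ltr_wpDr ?sqr_ge0// exprn_gt0.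
have -> : (1 + ((k + 1) / N) ^+ 2)^-1 = N ^+ 2 / (N ^+ 2 + (k + 1) ^+ 2).
  by field; rewrite !gt_eqF//= mulrn_eq0/= expf_neq0// gt_eqF.
have key : N ^+ 2 / (N ^+ 2 + (k + 1) ^+ 2) <= 2 * N ^+ 2 / (N + k) - 2 * N ^+ 2 / (N + (k + 1)).
  have -> : 2 * N ^+ 2 / (N + k) - 2 * N ^+ 2 / (N + (k + 1)) = N ^+ 2 * (2 / ((N + k) * (N + (k + 1)))).
    by field; rewrite !gt_eqF.
  rewrite ler_wpM2l ?sqr_ge0// -[leLHS]mul1r ler_pdivrMr//.
  rewrite mulrAC ler_pdivlMr ?mulr_gt0// mul1r.
  by have := sqr_ge0 (N - (k + 1)); nra.
have -> : 4 * N ^+ 2 / (N + (k + 1)) = 2 * (2 * N ^+ 2 / (N + (k + 1))) by ring.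
have E4 : 4 * N ^+ 2 / (N + k) = 2 * (2 * N ^+ 2 / (N + k)) by ring.
rewrite E4 in IH; lra.
Qed.

Lemma sum_uniq_cat (V : zmodType) (T : eqType) (s1 s2 : seq T) (a : T -> V) :
  uniq s1 -> uniq s2 -> {subset s1 <= s2} ->
  \sum_(k <- s2) a k = \sum_(k <- s1) a k + \sum_(k <- s2 | k \notin s1) a k.
Proof.
move=> u1 u2 sub; rewrite (bigID (fun k => k \in s1)) /=; congr (_ + _).
rewrite -big_filter; apply: perm_big; apply: uniq_perm => //.
  exact: filter_uniq.
move=> k; rewrite mem_filter; case: (boolP (k \in s1)) => //= /sub ->//.
Qed.

Lemma sum_sub_le (T : eqType) (s1 s2 : seq T) (a : T -> R) :
  uniq s1 -> uniq s2 -> {subset s1 <= s2} -> (forall k, 0 <= a k) ->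
  \sum_(k <- s1) a k <= \sum_(k <- s2) a k.
Proof.
move=> u1 u2 sub a0; rewrite (sum_uniq_cat _ u1 u2 sub) lerDl.
by apply: sumr_ge0.
Qed.

Context {d : nat}.
Local Notation ivec := 'rV[int]_d.
Local Notation vec := 'rV[R]_d.
Implicit Types (k m : ivec) (a b : ivec -> R) (s : seq ivec) (M e : R) (K n : nat).

(** The index set of [boxsum] as a duplicate-free list, so that sums over nested or translated boxes
    can be compared. *)
Definition zbox K : seq ivec := [seq boxpt f | f <- enum {ffun 'I_d -> 'I_(K.*2.+1)}].

Lemma bsumE (V : zmodType) K (a : ivec -> V) :
  \sum_(f : {ffun 'I_d -> 'I_(K.*2.+1)}) a (boxpt f) = \sum_(k <- zbox K) a k.
Proof. by rewrite big_map big_enum. Qed.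

Lemma mem_zbox K k : (k \in zbox K) = [forall j, (`|k 0%R j| <= K)%N].
Proof.
apply/mapP/forallP => [[f _ ->] j|H].
  rewrite mxE; move: (ltn_ord (f j)); move: (nat_of_ord (f j)) => u; lia.
have P j : (`|(k 0 j + K%:Z)%R| < K.*2.+1)%N by have := H j; lia.
exists [ffun j => Ordinal (P j)]; first by rewrite mem_enum.
by apply/rowP => j; rewrite !mxE ffunE /=; have := H j; lia.
Qed.

Lemma uniq_zbox K : uniq (zbox K).
Proof.
rewrite map_inj_uniq ?enum_uniq// => f g /rowP H; apply/ffunP => j.
by have := H j; rewrite !mxE => /addIr [] /ord_inj.
Qed.

Lemma zbox_sub K K' : (K <= K')%N -> {subset zbox K <= zbox K'}.
Proof.
by move=> KK k; rewrite !mem_zbox => /forallP H; apply/forallP => j; exact: leq_trans (H j) KK.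
Qed.

Lemma in_some_zbox s : exists K, {subset s <= zbox K}.
Proof.
elim: s => [|k s [K H]]; first by exists 0%N.
exists (maxn K (\max_(j < d) `|k 0%R j|)%N) => m; rewrite inE => /orP[/eqP ->|/H].
  rewrite mem_zbox; apply/forallP => j; rewrite leq_max; apply/orP; right.
  exact: (@leq_bigmax 'I_d (fun j => `|k 0%R j|%N) j).
by apply: zbox_sub; exact: leq_maxl.
Qed.

Definition omega (N : R) k : R := \prod_(j < d) rho1 ((k 0 j)%:~R / N).

Lemma omega_ge0 N k : 0 <= omega N k.
Proof. by apply: prodr_ge0 => j _; exact: rho1_ge0. Qed.

Lemma sum_omega_zbox N K :
  \sum_(k <- zbox K) omega N k = (\sum_(m < K.*2.+1) rho1 (((m : nat)%:Z - K%:Z)%:~R / N)) ^+ d.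
Proof.
rewrite -bsumE -[X in _ ^+ X]card_ord -prodr_const bigA_distr_bigA /=.
apply: eq_bigr => f _; apply: eq_bigr => j _; by rewrite mxE.
Qed.

Lemma sum_omega_le N s : 1 <= N -> uniq s -> \sum_(k <- s) omega N k <= (5 * N) ^+ d.
Proof.
move=> N1 us; have [K sK] := in_some_zbox s.
apply: le_trans (sum_sub_le us (uniq_zbox K) sK (omega_ge0 N)) _.
rewrite sum_omega_zbox lerXn2r ?nnegrE ?sumr_ge0//; last exact: sum_rho1_bound.
- by move=> i _; exact: rho1_ge0.
- by rewrite mulr_ge0// (le_trans ler01).
Qed.

Definition box_weight K : R := \sum_(k <- zbox K) omega 1 k.

Lemma box_weight_nd : {homo box_weight : K K' / (K <= K')%N >-> K <= K'}.
Proof.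
move=> K K' KK; apply: sum_sub_le; [exact: uniq_zbox|exact: uniq_zbox|exact: zbox_sub|exact: omega_ge0].
Qed.

Lemma box_weight_cvg : cvgn box_weight.
Proof.
apply: nondecreasing_is_cvgn; first exact: box_weight_nd.
by exists ((5 * 1) ^+ d) => _ [K _ <-]; apply: sum_omega_le => //; exact: uniq_zbox.
Qed.

(** Total weight [omega 1] outside the box [K]; all truncation errors are expressed as multiples of
    it. *)
Definition tau K : R := limn box_weight - box_weight K.

Lemma tau_ge0 K : 0 <= tau K.
Proof. by rewrite subr_ge0; apply: nondecreasing_cvgn_le; [exact: box_weight_nd|exact: box_weight_cvg]. Qed.

Lemma tau_small e : 0 < e -> exists K0, forall K, (K0 <= K)%N -> tau K <= e.
Proof.
move=> e0; have /cvgrPdist_le/(_ _ e0)[K0 _ H] := box_weight_cvg.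
by exists K0 => K KK; have := H K KK; apply: le_trans; exact: ler_norm.
Qed.

Lemma sum_tail M a s K : 0 <= M -> (forall k, `|a k| <= M * omega 1 k) -> uniq s ->
  {subset zbox K <= s} -> `|\sum_(k <- s) a k - \sum_(k <- zbox K) a k| <= M * tau K.
Proof.
move=> M0 H us sub; rewrite (sum_uniq_cat _ (uniq_zbox K) us sub) addrC addKr.
apply: le_trans (ler_norm_sum _ _ _) _.
apply: le_trans (_ : M * \sum_(k <- s | k \notin zbox K) omega 1 k <= _).
  by rewrite mulr_sumr; apply: ler_sum.
rewrite ler_wpM2l// /tau lerBrDr addrC /box_weight -(sum_uniq_cat _ (uniq_zbox K) us sub).
have [K' sK] := in_some_zbox s.
apply: le_trans (sum_sub_le us (uniq_zbox K') sK (omega_ge0 1)) _.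
by apply: (nondecreasing_cvgn_le box_weight_nd box_weight_cvg).
Qed.

(* Meaningful only for families dominated by [omega]. *)
Definition zsum a : R := limn (fun K => \sum_(k <- zbox K) a k).

Lemma zsum_cvg M a : 0 <= M -> (forall k, `|a k| <= M * omega 1 k) ->
  cvgn (fun K => \sum_(k <- zbox K) a k).
Proof.
move=> M0 H.
(* Adding [M * omega] makes the terms nonnegative, hence the partial sums monotone. *)
have -> : (fun K => \sum_(k <- zbox K) a k) =
    (fun K => \sum_(k <- zbox K) (a k + M * omega 1 k)) \+ (fun K => - M * box_weight K).
  apply/funext => K /=; rewrite big_split /= mulNr /box_weight mulr_sumr addrK//.
apply: is_cvgD; last by apply: is_cvgM; [exact: is_cvg_cst|exact: box_weight_cvg].
apply: nondecreasing_is_cvgn.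
  move=> K K' KK; apply: sum_sub_le; [exact: uniq_zbox|exact: uniq_zbox|exact: zbox_sub|].
  by move=> k; have := H k; rewrite ler_norml => /andP[h _]; lra.
exists (2 * M * (5 * 1) ^+ d) => _ [K _ <-].
apply: le_trans (_ : \sum_(k <- zbox K) (2 * M * omega 1 k) <= _).
  by apply: ler_sum => k _; have := H k; rewrite ler_norml => /andP[_ h]; lra.
by rewrite -mulr_sumr ler_wpM2l ?mulr_ge0//; apply: sum_omega_le => //; exact: uniq_zbox.
Qed.

Lemma zsum_approx M a s K : 0 <= M -> (forall k, `|a k| <= M * omega 1 k) -> uniq s ->
  {subset zbox K <= s} -> `|zsum a - \sum_(k <- s) a k| <= 2 * (M * tau K).
Proof.
move=> M0 H us sub.
have h1 := sum_tail M0 H us sub.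
have h2 : `|zsum a - \sum_(k <- zbox K) a k| <= M * tau K.
  rewrite distrC; apply/ler_addgt0Pr => e e0.
  have /cvgrPdist_le/(_ _ e0)[K0 _ G] := zsum_cvg M0 H.
  pose K' := maxn K0 K.
  have g1 := G K' (leq_maxl _ _).
  have g2 := sum_tail M0 H (uniq_zbox K') (zbox_sub (leq_maxr K0 K)).
  apply: le_trans (ler_distD (\sum_(k <- zbox K') a k) _ _) _.
  rewrite distrC; apply: le_trans (lerD g2 _) _; last exact: lexx.
  by rewrite distrC.
apply: le_trans (ler_distD (\sum_(k <- zbox K) a k) _ _) _.
by rewrite mulr_natl mulr2n lerD// distrC.
Qed.

Lemma zsum_bound M a (Q : R) : 0 <= M -> (forall k, `|a k| <= M * omega 1 k) ->
  (forall s, uniq s -> `|\sum_(k <- s) a k| <= Q) -> `|zsum a| <= Q.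
Proof.
move=> M0 H hQ; apply/ler_addgt0Pr => e e0.
have e2 : 0 < e / (2 * M + 1) by rewrite divr_gt0// ltr_wpDl// mulr_ge0.
have [K HK] := tau_small e2.
have h1 := zsum_approx M0 H (uniq_zbox K) (fun k h => h).
have h2 := hQ _ (uniq_zbox K).
have h3 : 2 * (M * tau K) <= e.
  have := HK K (leqnn _); rewrite ler_pdivlMr ?ltr_wpDl ?mulr_ge0//.
  by have := tau_ge0 K; lra.
have := ler_normD (zsum a - \sum_(k <- zbox K) a k) (\sum_(k <- zbox K) a k).
by rewrite subrK; lra.
Qed.

Lemma zsum_ge M a s : 0 <= M -> (forall k, `|a k| <= M * omega 1 k) ->
  (forall k, 0 <= a k) -> uniq s -> \sum_(k <- s) a k <= zsum a.
Proof.
move=> M0 H a0 us; have [K sK] := in_some_zbox s.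
apply: le_trans (sum_sub_le us (uniq_zbox K) sK a0) _.
apply: (nondecreasing_cvgn_le _ (zsum_cvg M0 H)).
move=> K1 K2 KK; apply: sum_sub_le; [exact: uniq_zbox|exact: uniq_zbox|exact: zbox_sub|exact: a0].
Qed.

Lemma size_zbox K : size (zbox K) = (K.*2.+1 ^ d)%N.
Proof. by rewrite size_map -cardE card_ffun !card_ord. Qed.

Lemma zsum_eq M a (L : R) : 0 <= M -> (forall k, `|a k| <= M * omega 1 k) ->
  (forall e, 0 < e -> exists K0, forall K, (K0 <= K)%N -> `|L - \sum_(k <- zbox K) a k| <= e) ->
  zsum a = L.
Proof.
move=> M0 H hL; apply: cvg_lim => //.
apply/cvgrPdist_le => e e0; have [K0 h] := hL e e0.
by exists K0 => // K /h.
Qed.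

Lemma zsumD M M' a b : 0 <= M -> 0 <= M' -> (forall k, `|a k| <= M * omega 1 k) ->
  (forall k, `|b k| <= M' * omega 1 k) -> zsum (fun k => a k + b k) = zsum a + zsum b.
Proof.
move=> M0 M'0 H H'; rewrite /zsum -limD; [|exact: zsum_cvg H|exact: zsum_cvg H'].
by congr (limn _); apply/funext => K /=; rewrite big_split.
Qed.

Lemma zsumZ M (c : R) a : 0 <= M -> (forall k, `|a k| <= M * omega 1 k) ->
  zsum (fun k => c * a k) = c * zsum a.
Proof.
move=> M0 H; apply: cvg_lim => //.
rewrite (_ : (fun K => _) = fun K => c * \sum_(k <- zbox K) a k); last first.
  by apply/funext => K; rewrite mulr_sumr.
by apply: cvgM; [exact: cvg_cst|exact: zsum_cvg H].
Qed.

Lemma omega_shift k m : omega 1 (k + m) <= (\prod_(j < d) (2 * (1 + ((m 0 j)%:~R : R) ^+ 2))) * omega 1 k.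
Proof.
rewrite /omega -big_split /=; apply: ler_prod => j _; rewrite rho1_ge0/= !divr1 mxE rmorphD.
exact: rho1D.
Qed.

Lemma zsum_shift M a m : 0 <= M -> (forall k, `|a k| <= M * omega 1 k) ->
  zsum (fun k => a (k + m)) = zsum a.
Proof.
move=> M0 H; set P := \prod_(j < d) (2 * (1 + ((m 0 j)%:~R : R) ^+ 2)).
have P0 : 0 <= P by apply: prodr_ge0 => j _; rewrite mulr_ge0// addr_ge0// sqr_ge0.
apply: (@zsum_eq (M * P)); first by rewrite mulr_ge0.
  by move=> k; apply: le_trans (H _) _; rewrite -mulrA ler_wpM2l// omega_shift.
move=> e e0.
have e2 : 0 < e / (2 * M + 1) by rewrite divr_gt0// ltr_wpDl// mulr_ge0.
have [K1 HK] := tau_small e2.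
pose r := (\max_(j < d) `|m 0%R j|)%N.
(* The translate by [m] of a box of radius at least [K1 + r] still contains the box of radius
   [K1]. *)
exists (K1 + r)%N => K KK.
rewrite -(big_map (fun k => k + m) predT a).
have us : uniq [seq k + m | k <- zbox K] by rewrite map_inj_uniq ?uniq_zbox//; exact: addIr.
have sub : {subset zbox K1 <= [seq k + m | k <- zbox K]}.
  move=> k; rewrite mem_zbox => /forallP hk; apply/mapP; exists (k - m); last by rewrite subrK.
  rewrite mem_zbox; apply/forallP => j; rewrite !mxE.
  have := hk j; have : (`|m 0%R j| <= r)%N by exact: (@leq_bigmax 'I_d (fun j => `|m 0%R j|%N) j).
  by move: (k 0 j) (m 0 j) KK; clearbody r => u v; lia.
apply: le_trans (zsum_approx M0 H us sub) _.
have := HK K1 (leqnn _); rewrite ler_pdivlMr ?ltr_wpDl ?mulr_ge0//.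
by have := tau_ge0 K1; lra.
Qed.

Lemma boxsumE K (a : ivec -> R[i]) : boxsum K a = \sum_(k <- zbox K) a k.
Proof. exact: bsumE. Qed.

End ZSum.

(** * Riemann sums over refined lattices *)

Section Lattice.
Local Open Scope ring_scope.
Local Open Scope classical_set_scope.
Context {R : realType} {d : nat}.
Local Notation ivec := 'rV[int]_d.
Local Notation vec := 'rV[R]_d.
Implicit Types (k m : ivec) (x y z c r : vec) (F G g f : vec -> R) (s : seq ivec)
  (M MF MG e N : R) (K n : nat).
Local Notation I := (@intRd R d).

Definition mxn (A : 'M[R]_d) : R := \sum_(i < d) \sum_(j < d) `|A i j|.

Lemma mxn_ge0 A : 0 <= mxn A.
Proof. by apply: sumr_ge0 => i _; apply: sumr_ge0. Qed.

Lemma norm_mulmx x (A : 'M[R]_d) : `|x *m A| <= mxn A * `|x|.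
Proof.
apply: vnorm_le; first by rewrite mulr_ge0// mxn_ge0.
move=> j; rewrite mxE; apply: le_trans (ler_norm_sum _ _ _) _.
rewrite /mxn mulr_suml; apply: ler_sum => i _; rewrite normrM mulrC.
apply: ler_pM => //; last exact: vnorm_coord.
by rewrite (bigD1 j)//= lerDl; apply: sumr_ge0.
Qed.

Variable B : 'M[R]_d.
Hypothesis uB : B \in unitmx.

Definition grid_pt N k : vec := N^-1 *: latt B k.

Definition cB : R := ((mxn (invmx B) + 1) ^+ 2) ^+ d.
Lemma cB_ge0 : 0 <= cB. Proof. by rewrite exprn_ge0// sqr_ge0. Qed.

Lemma w1_mulmx x : w1 (x *m B) <= cB * w1 x.
Proof.
set b := mxn (invmx B) + 1.
have m0 := mxn_ge0 (invmx B).
have b1 : 1 <= b by rewrite lerDr.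
have b0 : 0 <= b by exact: le_trans ler01 b1.
rewrite /cB /w1 -/b -exprMn; apply: lerXn2r; rewrite ?nnegrE ?rho1_ge0//.
  by rewrite mulr_ge0 ?rho1_ge0// sqr_ge0.
have h : `|x| <= b * `|x *m B|.
  rewrite -{1}(mulmxK uB x); apply: le_trans (norm_mulmx _ _) _.
  by rewrite ler_wpM2r// lerDl.
rewrite /rho1 ler_pdivlMr ?ltr_pwDl ?sqr_ge0// mulrC ler_pdivrMr ?ltr_pwDl ?sqr_ge0//.
have h2 : `|x| ^+ 2 <= (b * `|x *m B|) ^+ 2 by apply: lerXn2r; rewrite ?nnegrE// mulr_ge0.
rewrite exprMn in h2.
have : 1 <= b ^+ 2 by rewrite exprn_ege1.
nra.
Qed.

Lemma w1_grid_pt N k : w1 (grid_pt N k) <= cB * omega N k.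
Proof.
rewrite /grid_pt /latt scalemxAl; apply: le_trans (w1_mulmx _) _.
rewrite ler_wpM2l ?cB_ge0// /w1; set x := _ *: _.
have hx j : `|(k 0 j)%:~R / N| <= `|x|.
  by have := vnorm_coord x j; rewrite !mxE mulrC.
move: `|x| hx => r hr; rewrite -[X in _ ^+ X]card_ord -prodr_const /omega.
apply: ler_prod => i _; rewrite rho1_ge0/=; apply: rho1_le.
exact: le_trans (hr i) (ler_norm _).
Qed.

Lemma omega_N N k : 1 <= N -> omega N k <= (N ^+ 2) ^+ d * omega 1 k.
Proof.
move=> N1; have N0 : 0 < N by rewrite (lt_le_trans ltr01).
rewrite /omega; set X := (N ^+ 2) ^+ d.
have -> : X = \prod_(j < d) (N ^+ 2) by rewrite prodr_const card_ord.
rewrite -big_split /=; apply: ler_prod => j _; rewrite rho1_ge0/= divr1.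
move: ((k 0 j)%:~R : R) => a; rewrite /rho1.
rewrite ler_pdivlMr ?ltr_pwDl ?sqr_ge0// mulrC ler_pdivrMr ?ltr_pwDl ?sqr_ge0//.
rewrite exprMn exprVn mulrDr mulr1 mulrCA divff ?expf_neq0 ?gt_eqF// mulr1 lerD2r.
by rewrite exprn_ege1.
Qed.

(** This domination deteriorates with [N]; it makes the sums converge and controls their tails for
    fixed [N]. Bounds uniform in [N] come from [w1_grid_pt] through [sum_w1_grid_pt]. *)
Lemma w1_grid_pt1 N k : 1 <= N -> w1 (grid_pt N k) <= cB * (N ^+ 2) ^+ d * omega 1 k.
Proof.
move=> N1; apply: le_trans (w1_grid_pt N k) _; rewrite -mulrA ler_wpM2l ?cB_ge0//.
exact: omega_N.
Qed.

Definition CL : R := cB * 5 ^+ d.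
Lemma CL_ge0 : 0 <= CL. Proof. by rewrite mulr_ge0 ?cB_ge0// exprn_ge0. Qed.

Lemma sum_w1_grid_pt N s : 1 <= N -> uniq s -> N ^- d * \sum_(k <- s) w1 (grid_pt N k) <= CL.
Proof.
move=> N1 us; have N0 : 0 < N by rewrite (lt_le_trans ltr01).
rewrite mulrC ler_pdivrMr ?exprn_gt0//.
apply: le_trans (_ : \sum_(k <- s) cB * omega N k <= _).
  by apply: ler_sum => k _; exact: w1_grid_pt.
by rewrite -mulr_sumr /CL -mulrA -exprMn ler_wpM2l ?cB_ge0// sum_omega_le.
Qed.

(* Riemann sum over the refined lattice, without the cell volume [|det B|]; the factor [kap]
   below makes up for it, which avoids the change of variables formula. *)
Definition LN N G : R := N ^- d * zsum (fun k => G (grid_pt N k)).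

Definition CN N : R := cB * (N ^+ 2) ^+ d.
Lemma CN_ge0 N : 0 <= CN N. Proof. by rewrite mulr_ge0 ?cB_ge0// exprn_ge0// sqr_ge0. Qed.

Lemma MCN_ge0 N M : 0 <= M -> 0 <= M * CN N.
Proof. by move=> M0; apply: mulr_ge0 => //; exact: CN_ge0. Qed.

Lemma dom_grid_pt N M G : 1 <= N -> 0 <= M -> (forall x, `|G x| <= M * w1 x) ->
  forall k, `|G (grid_pt N k)| <= M * CN N * omega 1 k.
Proof.
move=> N1 M0 H k; apply: le_trans (H _) _; rewrite -mulrA ler_wpM2l//; exact: w1_grid_pt1.
Qed.

Lemma grid_ptD N k m : grid_pt N (k + m) = grid_pt N k + grid_pt N m.
Proof. by rewrite /grid_pt /latt /intvec map_mxD mulmxDl scalerDr. Qed.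

Lemma grid_ptN N k : grid_pt N (- k) = - grid_pt N k.
Proof. by rewrite /grid_pt /latt /intvec map_mxN mulNmx scalerN. Qed.

Lemma LN_shift N M G m : 1 <= N -> 0 <= M -> (forall x, `|G x| <= M * w1 x) ->
  LN N (fun z => G (z + grid_pt N m)) = LN N G.
Proof.
move=> N1 M0 H; rewrite /LN; congr (_ * _).
rewrite -(zsum_shift m (MCN_ge0 N M0) (dom_grid_pt N1 M0 H)).
by congr zsum; apply/funext => k; rewrite grid_ptD.
Qed.

Lemma LN_bound N M G : 1 <= N -> 0 <= M -> (forall x, `|G x| <= M * w1 x) -> `|LN N G| <= CL * M.
Proof.
move=> N1 M0 H; have N0 : 0 < N by rewrite (lt_le_trans ltr01).
rewrite /LN normrM gtr0_norm ?invr_gt0 ?exprn_gt0// mulrC ler_pdivrMr ?exprn_gt0//.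
apply: zsum_bound (MCN_ge0 N M0) (dom_grid_pt N1 M0 H) _.
move=> s us; apply: le_trans (ler_norm_sum _ _ _) _.
apply: le_trans (_ : \sum_(k <- s) M * w1 (grid_pt N k) <= _); first by apply: ler_sum.
rewrite -mulr_sumr; have := sum_w1_grid_pt N1 us; rewrite mulrC ler_pdivrMr ?exprn_gt0// => h.
by apply: le_trans (ler_wpM2l M0 h) _; apply: le_eq; ring.
Qed.

Lemma LN_lip N M G r : 1 <= N -> 0 <= M -> lip w1 M G -> `|r| <= 1 ->
  `|LN N (fun z => G (z + r)) - LN N G| <= CL * (M * `|r|).
Proof.
move=> N1 M0 [b l] r1.
have W0 : 0 <= 2 ^+ d * (1 + `|r| ^+ 2) ^+ d.
  by rewrite mulr_ge0 ?exprn_ge0// addr_ge0// sqr_ge0.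
have b' x : `|G (x + r)| <= M * (2 ^+ d * (1 + `|r| ^+ 2) ^+ d) * w1 x.
  by apply: le_trans (b _) _; rewrite -[leRHS]mulrA ler_wpM2l// w1D.
have M'0 : 0 <= M * (2 ^+ d * (1 + `|r| ^+ 2) ^+ d) by rewrite mulr_ge0.
have -> : LN N (fun z => G (z + r)) - LN N G = LN N (fun z => G (z + r) + -1 * G z).
  rewrite /LN -mulrBr; congr (_ * _).
  have bN k : `|-1 * G (grid_pt N k)| <= M * CN N * omega 1 k.
    by rewrite mulN1r normrN; exact: dom_grid_pt.
  rewrite (zsumD (MCN_ge0 N M'0) (MCN_ge0 N M0) (dom_grid_pt N1 M'0 b') bN).
  by rewrite (zsumZ _ (MCN_ge0 N M0) (dom_grid_pt N1 M0 b)) mulN1r.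
apply: LN_bound => //; first by rewrite mulr_ge0.
by move=> x; rewrite mulN1r; exact: l.
Qed.

Lemma LN_near N x : 1 <= N -> exists m, `|x - grid_pt N m| <= mxn B / N.
Proof.
move=> N1; have N0 : 0 < N by rewrite (lt_le_trans ltr01).
pose y := N *: (x *m invmx B).
exists (\row_j Num.floor (y 0 j)).
have -> : x - grid_pt N (\row_j Num.floor (y 0 j)) =
   (N^-1 *: (y - intvec (\row_j Num.floor (y 0 j)))) *m B.
  have E : N^-1 *: y *m B = x by rewrite /y scalerA mulVf ?gt_eqF// scale1r mulmxKV.
  by rewrite scalerBr mulmxBl E /grid_pt /latt scalemxAl.
apply: le_trans (norm_mulmx _ _) _; rewrite ler_wpM2l ?mxn_ge0//.
rewrite normrZ gtr0_norm ?invr_gt0// ler_piMr ?invr_ge0 ?(ltW N0)//.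
apply: vnorm_le => // j; rewrite !mxE.
move: (N * _) => a; rewrite ger0_norm ?subr_ge0 ?ge_floor//.
have := lt_succ_floor a; rewrite rmorphD /= => h; lra.
Qed.

(** Grid translations leave [LN] unchanged, and modulo the grid [x] has norm at most [mxn B / N].
    The bound is therefore uniform in [x]. *)
Lemma LN_trans N M G x : 1 <= N -> mxn B <= N -> 0 <= M -> lip w1 M G ->
  `|LN N (fun z => G (z + x)) - LN N G| <= CL * (M * (mxn B / N)).
Proof.
move=> N1 BN M0 L; have N0 : 0 < N by rewrite (lt_le_trans ltr01).
have [m hm] := LN_near x N1.
have r1 : `|x - grid_pt N m| <= 1.
  by apply: le_trans hm _; rewrite ler_pdivrMr// mul1r.
have -> : LN N (fun z => G (z + x)) = LN N (fun z => G (z + (x - grid_pt N m))).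
  set W := 2 ^+ d * (1 + `|x - grid_pt N m| ^+ 2) ^+ d.
  have W0 : 0 <= W by rewrite mulr_ge0 ?exprn_ge0// addr_ge0// sqr_ge0.
  have b' y : `|G (y + (x - grid_pt N m))| <= M * W * w1 y.
    by apply: le_trans (L.1 _) _; rewrite -[leRHS]mulrA ler_wpM2l// w1D.
  rewrite -(LN_shift m N1 _ b') ?mulr_ge0//; congr LN; apply/funext => z; congr G.
  by rewrite -addrA [grid_pt N m + _]addrC subrK.
apply: le_trans (LN_lip N1 M0 L r1) _.
by rewrite ler_wpM2l ?CL_ge0// ler_wpM2l.
Qed.

(** The prefactor [w1 x] absorbs the translation, as [w1 x * w1 (y - x) <= 2^d w1 y]; this makes the
    truncation error uniform in [x]. *)
Lemma LN_tail N M G x K : 1 <= N -> 0 <= M -> (forall x, `|G x| <= M * w1 x) ->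
  w1 x * `|LN N (fun z => G (z - x)) - N ^- d * \sum_(k <- zbox K) G (grid_pt N k - x)| <=
    2 * (M * 2 ^+ d * CN N * @tau R d K).
Proof.
move=> N1 M0 H; have N0 : 0 < N by rewrite (lt_le_trans ltr01).
set W := 2 ^+ d * (1 + `|- x| ^+ 2) ^+ d.
have W0 : 0 <= W by rewrite mulr_ge0 ?exprn_ge0// addr_ge0// sqr_ge0.
have b' y : `|G (y - x)| <= M * W * w1 y.
  by apply: le_trans (H _) _; rewrite -[leRHS]mulrA ler_wpM2l// w1D.
have b2 y : `|w1 x * G (y - x)| <= M * 2 ^+ d * w1 y.
  rewrite normrM (ger0_norm (w1_ge0 _)); apply: le_trans (ler_wpM2l (w1_ge0 _) (H _)) _.
  rewrite mulrCA -mulrA ler_wpM2l//; apply: le_trans (w1_mul_le _ _) _.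
  by rewrite addrCA subrr addr0.
rewrite -[X in X * _](ger0_norm (w1_ge0 x)) -normrM mulrBr /LN.
have MW0 : 0 <= M * W by exact: mulr_ge0.
have M20 : 0 <= M * 2 ^+ d by rewrite mulr_ge0// exprn_ge0.
rewrite mulrCA -(zsumZ _ (MCN_ge0 N MW0) (dom_grid_pt N1 MW0 b')).
rewrite mulrCA mulr_sumr -mulrBr normrM gtr0_norm ?invr_gt0 ?exprn_gt0//.
apply: le_trans (ler_piMl _ _) _ => //.
  by rewrite invf_le1 ?exprn_gt0// exprn_ege1.
exact: zsum_approx (MCN_ge0 N M20) (dom_grid_pt N1 M20 b2) (uniq_zbox K) (fun k h => h).
Qed.

Lemma I_sum M s (f : ivec -> vec -> R) : 0 <= M -> (forall k, lip w1 M (f k)) ->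
  I (fun x => \sum_(k <- s) f k x) = \sum_(k <- s) I (f k).
Proof.
move=> M0 H; elim: s => [|k s IH].
  rewrite big_nil (_ : (fun x => _) = fun x => 0 * 0); last first.
    by apply/funext => x; rewrite big_nil mulr0.
  rewrite (@I_scale R d 0)//; first by rewrite mul0r.
  by split=> [x|x y _]; rewrite ?subrr ?normr0 ?mul0r.
rewrite big_cons -IH -(I_add _ _ (H k) (lip_sum s H)) ?mulr_ge0//.
by congr I; apply/funext => x; rewrite big_cons.
Qed.

Lemma lip_w21 M G : 0 <= M -> lip w2 M G -> lip w1 M G.
Proof. by move=> M0 L; apply: lip_le L _ => x; rewrite ler_wpM2l// w2_le_w1. Qed.

Lemma lip_w2_const M G : 0 <= M -> lip w2 M G -> lip (fun=> 1) M G.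
Proof. by move=> M0 L; apply: lip_le L _ => x; rewrite ler_wpM2l// w2_le1. Qed.

Lemma lip_refl M G z : lip (fun=> 1) M G -> lip (fun=> 1) M (fun x => G (z - x)).
Proof.
move=> [b l]; split=> [x|x y y1]; first exact: b.
by have := l (z - x) (- y); rewrite normrN opprD addrA; apply.
Qed.

Lemma lip_conv MF MG F G z : 0 <= MF -> 0 <= MG -> lip w2 MF F -> lip w2 MG G ->
  lip w1 (3 * (MF * MG)) (fun x => F x * G (z - x)).
Proof.
move=> F0 G0 LF LG; apply: lip_w21; first by rewrite !mulr_ge0.
apply: lipM => //; first exact: w2_ge0.
exact/lip_refl/lip_w2_const.
Qed.

Lemma I_conv_sym MF MG F G z : 0 <= MF -> 0 <= MG -> lip w2 MF F -> lip w2 MG G ->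
  I (fun x => F x * G (z - x)) = I (fun x => G x * F (z - x)).
Proof.
move=> F0 G0 LF LG.
have M0 : 0 <= 3 * (MF * MG) by rewrite !mulr_ge0.
have L := lip_conv z F0 G0 LF LG.
rewrite -(I_opp M0 L).
have LO : lip w1 (3 * (MF * MG)) (fun x => F (- x) * G (z + x)).
  have := lip_opp (fun x => _) L; rewrite (_ : (fun x => F (- x) * G (z - - x)) = (fun x => F (- x) * G (z + x))).
    by apply => x; rewrite /w1 normrN.
  by apply/funext => x; rewrite opprK.
rewrite (_ : (fun x => _) = (fun x => F (- x) * G (z + x))); last first.
  by apply/funext => x; rewrite opprK.
rewrite -(I_shift (- z) M0 LO); congr I; apply/funext => x.
by rewrite opprD opprK [z + _]addrC subrK mulrC [_ + z]addrC.
Qed.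

(** A Riemann sum over the grid of the convolution of [F] and [G]. It is truncated so that only a
    finite sum is exchanged with the integral. *)
Definition lattice_conv N K F G : R := N ^- d * \sum_(k <- zbox K) I (fun x => F x * G (grid_pt N k - x)).

Lemma lattice_conv_approx N MF MG F G K : 1 <= N -> mxn B <= N -> 0 <= MF -> 0 <= MG ->
  lip w2 MF F -> lip w2 MG G ->
  `|I F * LN N G - lattice_conv N K F G| <=
     (CL * mxn B / N + 2 * 2 ^+ d * CN N * @tau R d K) * (MF * MG) * @CI R d.
Proof.
move=> N1 BN F0 G0 LF LG; have N0 : 0 < N by rewrite (lt_le_trans ltr01).
have LF1 := lip_w21 F0 LF; have LG1 := lip_w21 G0 LG.
have M0 : 0 <= 3 * (MF * MG) by rewrite !mulr_ge0.
have Lk k : lip w1 (3 * (MF * MG)) (fun x => F x * G (grid_pt N k - x)) by exact: lip_conv.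
have LS := lip_sum (zbox K) Lk.
have S0 : 0 <= (size (zbox K : seq ivec))%:R * (3 * (MF * MG)) by rewrite mulr_ge0.
have LZ := lipZ (- N ^- d) LS.
have Z0 : 0 <= `|- N ^- d| * ((size (zbox K : seq ivec))%:R * (3 * (MF * MG))) by rewrite mulr_ge0.
have LFZ := lipZ (LN N G) LF1.
have FZ0 : 0 <= `|LN N G| * MF by rewrite mulr_ge0.
pose E x := LN N G * F x + - N ^- d * \sum_(k <- zbox K) F x * G (grid_pt N k - x).
have IE : I F * LN N G - lattice_conv N K F G = I E.
  rewrite /E (I_add FZ0 Z0 LFZ LZ) (I_scale _ F0 LF1) (I_scale _ S0 LS) (I_sum _ M0 Lk).
  by rewrite /lattice_conv mulNr mulrC.
rewrite IE; apply: I_bound (lipD LFZ LZ) _; first by rewrite addr_ge0.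
move=> x.
have t0 := @tau_ge0 R d K.
set S := \sum_(k <- zbox K) G (grid_pt N k - x).
have EE : E x = F x * (LN N G + - N ^- d * S) by rewrite /E -mulr_sumr -/S; ring.
rewrite -/(E x) EE normrM.
have h1 := LN_trans (- x) N1 BN G0 LG1.
have h2 := LN_tail x K N1 G0 LG1.1.
rewrite -/S in h2.
(* One factor [w1] pays for [LN_tail], the other for the integration in [x]. *)
have fx : `|F x| <= MF * w1 x * w1 x.
  by apply: le_trans (LF.1 x) _; rewrite /w2 expr2 mulrA.
apply: le_trans (ler_wpM2r (normr_ge0 _) fx) _.
rewrite mulNr.
have h3 : `|LN N G - N ^- d * S| <= CL * (MG * (mxn B / N)) + `|LN N (fun z => G (z - x)) - N ^- d * S|.
  apply: le_trans (ler_distD (LN N (fun z => G (z - x))) _ _) _.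
  by rewrite lerD2r distrC.
apply: le_trans (ler_wpM2l _ h3) _; first by rewrite !mulr_ge0 ?w1_ge0.
have w0 := w1_ge0 x; have ww := w1_le1 x.
have a0 : 0 <= CL * (MG * (mxn B / N)).
  by rewrite mulr_ge0 ?CL_ge0// mulr_ge0// divr_ge0 ?mxn_ge0// ltW.
rewrite mulrDr.
have p1 : MF * w1 x * w1 x * (CL * (MG * (mxn B / N))) <= MF * w1 x * (CL * (MG * (mxn B / N))).
  by rewrite ler_wpM2r// ler_piMr// mulr_ge0.
have p2 : MF * w1 x * w1 x * `|LN N (fun z => G (z - x)) - N ^- d * S| <=
    MF * w1 x * (2 * (MG * 2 ^+ d * CN N * @tau R d K)).
  by rewrite -[leLHS]mulrA ler_wpM2l// mulr_ge0.
apply: le_trans (lerD p1 p2) _.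
by apply: le_eq; ring.
Qed.

(* Both products approximate the Riemann sum of the convolution of [F] and [G], which is
   symmetric in [F] and [G]. *)
Lemma I_LN_comm N MF MG F G : 1 <= N -> mxn B <= N -> 0 <= MF -> 0 <= MG ->
  lip w2 MF F -> lip w2 MG G ->
  `|I F * LN N G - I G * LN N F| <= 2 * CL * mxn B * @CI R d / N * (MF * MG).
Proof.
move=> N1 BN F0 G0 LF LG; have N0 : 0 < N by rewrite (lt_le_trans ltr01).
have P0 : 0 <= MF * MG * @CI R d by rewrite !mulr_ge0// CI_ge0.
set Q := 2 * (2 * 2 ^+ d * CN N) * (MF * MG * @CI R d).
have Q0 : 0 <= Q.
  by apply: mulr_ge0 => //; apply: mulr_ge0 => //; apply: MCN_ge0; rewrite mulr_ge0// exprn_ge0.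
apply/ler_addgt0Pr => e e0.
have e2 : 0 < e / (Q + 1) by rewrite divr_gt0// ltr_wpDl.
have [K HK] := @tau_small R d _ e2.
have t := HK K (leqnn _).
have h1 := lattice_conv_approx K N1 BN F0 G0 LF LG.
have h2 := lattice_conv_approx K N1 BN G0 F0 LG LF.
have E : lattice_conv N K F G = lattice_conv N K G F.
  rewrite /lattice_conv; congr (_ * _); apply: eq_bigr => k _.
  exact: I_conv_sym F0 G0 LF LG.
rewrite -E in h2.
apply: le_trans (ler_distD (lattice_conv N K F G) _ _) _.
rewrite [X in _ + X]distrC; apply: le_trans (lerD h1 h2) _.
have q : Q * @tau R d K <= e.
  apply: le_trans (_ : (Q + 1) * @tau R d K <= _); first by rewrite ler_wpM2r ?tau_ge0// lerDl.
  by move: t; rewrite ler_pdivlMr ?ltr_wpDl// mulrC.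
apply: le_trans (lerD (lexx _) q); apply: le_eq; rewrite /Q.
by field; rewrite gt_eqF.
Qed.

(** [F] stays above [F x0 / 2] on a ball around [x0], and the number of grid points in this ball
    grows like [N^d], which compensates the factor [N^-d]. *)
Lemma LN_pos F M x0 : 0 <= M -> lip w1 M F -> (forall x, 0 <= F x) -> 0 < F x0 ->
  exists2 c : R, 0 < c & exists N0 : R, forall N, N0 <= N -> 1 <= N -> c <= LN N F.
Proof.
move=> M0 L Fp Fx0.
pose eta := F x0 / 2; have eta0 : 0 < eta by rewrite divr_gt0.
pose dl := Num.min 1 (eta / (M + 1)).
have dl0 : 0 < dl by rewrite lt_min ltr01 divr_gt0// ltr_wpDl.
have near y : `|y| <= dl -> eta <= F (x0 + y).
  move=> yd.
  have y1 : `|y| <= 1 by apply: le_trans yd _; rewrite ge_min lexx.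
  have := L.2 x0 y y1.
  have : M * `|y| * w1 x0 <= eta.
    apply: le_trans (_ : M * `|y| <= _); first by rewrite ler_piMr ?w1_le1// mulr_ge0.
    have : `|y| <= eta / (M + 1) by apply: le_trans yd _; rewrite ge_min lexx orbT.
    rewrite ler_pdivlMr ?ltr_wpDl//; have := normr_ge0 y; nra.
  rewrite distrC => h1 /(le_trans (ler_norm _)) h2.
  rewrite /eta in h1 *; lra.
pose b := mxn B + 1.
have b0 : 0 < b by rewrite ltr_wpDl// mxn_ge0.
pose q := dl / (2 * b); have q0 : 0 < q by rewrite divr_gt0// mulr_gt0.
exists (q ^+ d * eta); first by rewrite mulr_gt0// exprn_gt0.
exists (2 * b / dl) => N NN N1.
have N0 : 0 < N by rewrite (lt_le_trans ltr01).
have [m hm] := LN_near x0 N1.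
have [n n1 n2] : exists2 n : nat, n%:R <= N * q & N * q < n.+1%:R.
  have Nq0 : 0 <= N * q by exact: mulr_ge0 (ltW N0) (ltW q0).
  by have /andP[n1 n2] := truncn_itv Nq0; exists (Num.truncn (N * q)).
(* The box of radius [n], about [N q], is moved to the grid point [m] close to [x0]. The extent of
   the box and the distance from [m] to [x0] are at most [dl / 2] each. *)
pose s := [seq k + m | k <- zbox n].
have us : uniq s by rewrite map_inj_uniq ?uniq_zbox//; exact: addIr.
have sz : (q * N) ^+ d <= (size s)%:R.
  rewrite size_map size_zbox natrX; apply: lerXn2r; rewrite ?nnegrE//.
    exact: mulr_ge0 (ltW q0) (ltW N0).
  rewrite mulrC; apply: le_trans (ltW n2) _.
  by rewrite ler_nat ltnS -addnn leq_addr.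
have hs k : k \in s -> eta <= F (grid_pt N k).
  move=> /mapP[k' k'n ->]; rewrite grid_ptD.
  have -> : grid_pt N k' + grid_pt N m = x0 + (grid_pt N k' - (x0 - grid_pt N m)) by rewrite opprB addrCA [x0 + _]addrC subrK.
  apply: near.
  apply: le_trans (ler_normB _ _) _.
  have hk : `|grid_pt N k'| <= dl / 2.
    rewrite /grid_pt /latt scalemxAl; apply: le_trans (norm_mulmx _ _) _.
    have : `|N^-1 *: intvec k' : vec| <= q.
      apply: vnorm_le; first exact: ltW.
      move=> j; rewrite !mxE normrM gtr0_norm ?invr_gt0// mulrC ler_pdivrMr// [q * N]mulrC.
      apply: le_trans n1; rewrite mem_zbox in k'n.
      by move/forallP: k'n => /(_ j) h; rewrite -intr_norm -abszE ler_nat.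
    move=> h; apply: le_trans (ler_wpM2l (mxn_ge0 _) h) _.
    rewrite /q invfM mulrCA mulrA [leLHS](_ : _ = dl / 2 * (mxn B / b)); last by field; rewrite gt_eqF.
    by rewrite ler_piMr ?divr_ge0 ?(ltW dl0)// ler_pdivrMr// mul1r lerDl.
  have hb : mxn B / N <= dl / 2.
    rewrite ler_pdivrMr//; move: NN; rewrite ler_pdivrMr// /b; nra.
  by apply: le_trans (lerD hk (le_trans hm hb)) _; lra.
rewrite /LN [leRHS]mulrC ler_pdivlMr ?exprn_gt0//.
apply: le_trans (zsum_ge (MCN_ge0 N M0) (dom_grid_pt N1 M0 L.1) (fun k => Fp _) us).
apply: le_trans (_ : \sum_(k <- s) eta <= _); last by rewrite big_seq [leRHS]big_seq; apply: ler_sum.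
rewrite big_const_seq count_predT iter_addr_0 -mulr_natr mulrAC -exprMn [leLHS]mulrC.
by rewrite ler_wpM2l ?(ltW eta0).
Qed.

End Lattice.

(** * A reference function with compact support *)

Section Tent.
Local Open Scope ring_scope.
Local Open Scope classical_set_scope.
Context {R : realType}.
Implicit Types (a b y : R).

Definition tent y : R := Num.max 0 (1 - `|y|).

Lemma tent_ge0 y : 0 <= tent y. Proof. by rewrite /tent le_max lexx. Qed.
Lemma tent_le1 y : tent y <= 1.
Proof. by rewrite /tent ge_max ler01 /= lerBlDr lerDl normr_ge0. Qed.
Lemma tent_out y : 1 <= `|y| -> tent y = 0.
Proof. by move=> h; rewrite /tent; apply/max_idPl; rewrite subr_le0. Qed.

Lemma tent_lip a b : `|tent a - tent b| <= `|a - b|.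
Proof.
have h := ler_dist_dist a b; move: h; rewrite ler_norml => /andP[h1 h2].
have h0 := normr_ge0 (a - b).
rewrite /tent !maxEle; case: ifP => ha; case: ifP => hb; rewrite ler_norml; apply/andP; split; lra.
Qed.

Lemma tame_tent : tame tent.
Proof.
split.
  move=> y; apply/cvgrPdist_le => /= e e0; near=> z.
  apply: le_trans (tent_lip _ _) _; near: z; exact: cvgr_dist_le.
exists 2 => y; rewrite ger0_norm ?tent_ge0//.
have [h|h] := lerP 1 `|y|; first by rewrite tent_out// mulr_ge0// rho1_ge0.
apply: le_trans (tent_le1 y) _; rewrite /rho1 ler_pdivlMr ?ltr_pwDl ?sqr_ge0// mul1r.
have : `|y| ^+ 2 <= 1 by rewrite exprn_ile1// ltW.
rewrite real_normK ?num_real//; lra.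
Unshelve. all: by end_near.
Qed.

Lemma I1_tent_gt0 : 0 < I1 tent.
Proof.
(* [tent] is at least 1/2 on the interval from 0 to 1/2. *)
apply: (@lt_le_trans _ _ (1 / 4)); first by rewrite divr_gt0.
rewrite -lee_fin /I1 /Rintegral fineK; last first.
  by apply: integrable_fin_num => //; exact: (tame_integrable tame_tent).
have mt : measurable_fun setT (EFin \o tent).
  by apply/measurable_EFinP; exact: continuous_measurable_fun tame_tent.1.
have h1 : (\int[lebesgue_measure]_(x in `[0%R, (1 / 2)%R]) (1 / 2)%:E <=
    \int[lebesgue_measure]_(x in `[0%R, (1 / 2)%R]) (tent x)%:E)%E.
  apply: ge0_le_integral => //=.
  - exact: measurable_funTS mt.
  - move=> x; rewrite in_itv /= => /andP[x0 x1]; rewrite lee_fin /tent le_max ger0_norm//.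
    by apply/orP; right; lra.
apply: le_trans (_ : (\int[lebesgue_measure]_(x in `[0%R, (1 / 2)%R]) (1 / 2 : R)%:E <= _)%E).
  rewrite integral_cst//= lebesgue_measure_itv /= lte_fin divr_gt0// -EFinB -EFinM lee_fin; lra.
apply: le_trans h1 _.
by apply: ge0_subset_integral => //= x _; rewrite lee_fin tent_ge0.
Qed.

Lemma prod_dist (T : Type) (s : seq T) (f g : T -> R) :
  (forall i, `|f i| <= 1) -> (forall i, `|g i| <= 1) ->
  `|\prod_(i <- s) f i - \prod_(i <- s) g i| <= \sum_(i <- s) `|f i - g i|.
Proof.
move=> f1 g1; elim: s => [|i s IH]; first by rewrite !big_nil subrr normr0.
rewrite !big_cons.
set P := \prod_(j <- s) f j in IH *; set Q := \prod_(j <- s) g j in IH *.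
have P1 : `|P| <= 1 by rewrite normr_prod; apply: prodr_ile1 => j _; rewrite normr_ge0 f1.
have -> : f i * P - g i * Q = (f i - g i) * P + g i * (P - Q) by ring.
apply: le_trans (ler_normD _ _) _; rewrite !normrM lerD//.
  by rewrite ler_piMr.
by apply: le_trans IH; rewrite ler_piMl.
Qed.

Context {d : nat}.
Local Notation vec := 'rV[R]_d.

(** The product form makes its iterated integral computable by [intd_prod]. Riemann sums ask only
    for Lipschitz continuity, so the reference function can lie outside the test space. *)
Definition Tent (x : vec) : R := \prod_(j < d) tent (x 0 j).

Lemma Tent_ge0 x : 0 <= Tent x.
Proof. by apply: prodr_ge0 => j _; exact: tent_ge0. Qed.

Lemma Tent0 : Tent 0 = 1.
Proof.
rewrite /Tent big1// => j _; rewrite mxE /tent normr0 subr0.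
by apply/max_idPr; exact: ler01.
Qed.

Lemma Tent_out x : 1 <= `|x| -> Tent x = 0.
Proof.
move=> x1; have xn0 : `|x| != 0 by rewrite gt_eqF// (lt_le_trans ltr01).
have [[i0 j] Ej] := mx_norm_neq0 xn0; rewrite /= ord1 in Ej.
by rewrite /Tent (bigD1 j)//= tent_out ?mul0r// -Ej.
Qed.

Lemma lip_Tent : lip w2 ((1 + d%:R) * 25 ^+ d) Tent.
Proof.
have T1 j (x : vec) : `|tent (x 0 j)| <= 1 by rewrite ger0_norm ?tent_ge0 ?tent_le1.
(* For [|x| <= 2] the value of [rho1] is at least 1/5, and [w2] is its power [2 d]. *)
have W (x : vec) : `|x| <= 2 -> 1 <= 25 ^+ d * w2 x.
  move=> x2; rewrite /w2 /w1 -exprM mulnC exprM -exprMn exprn_ege1//.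
  have h : `|x| ^+ 2 <= 4 by have := normr_ge0 x; nra.
  have h5 : 5^-1 <= rho1 `|x| by rewrite /rho1 lef_pV2 ?posrE ?ltr_pwDl ?sqr_ge0//; lra.
  have : (5^-1 : R) ^+ 2 <= rho1 `|x| ^+ 2 by rewrite lerXn2r ?nnegrE ?rho1_ge0.
  have : (5^-1 : R) ^+ 2 = 25^-1 by field.
  lra.
have d0 : 0 <= d%:R :> R by [].
have P0 : 0 <= 25 ^+ d :> R by rewrite exprn_ge0.
split=> [x|x y y1].
  have [x1|x1] := lerP 1 `|x|.
    by rewrite Tent_out// normr0 mulr_ge0 ?w2_ge0// mulr_ge0// addr_ge0.
  have : `|Tent x| <= 1.
    by rewrite normr_prod; apply: prodr_ile1 => j _; rewrite normr_ge0 T1.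
  have := W x (le_trans (ltW x1) (ler1n _ 2)).
  rewrite -mulrA => h1 h2; apply: le_trans h2 (le_trans h1 _).
  by rewrite ler_peMl// ?lerDl// mulr_ge0// w2_ge0.
(* Beyond norm 2 both [x] and [x + y] lie outside the support. *)
have [x2|x2] := lerP `|x| 2; last first.
  have xy : 1 <= `|x + y|.
    have := lerB_dist x (- y); rewrite opprK normrN; lra.
  rewrite !Tent_out//; last by lra.
  rewrite subrr normr0; apply: mulr_ge0; last exact: w2_ge0.
  by apply: mulr_ge0 => //; apply: mulr_ge0 => //; exact: addr_ge0.
apply: le_trans (prod_dist _ _ _) _ => //.
apply: le_trans (_ : \sum_(j < d) `|y| <= _).
  apply: ler_sum => j _; apply: le_trans (tent_lip _ _) _.
  by rewrite mxE addrAC subrr add0r vnorm_coord.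
rewrite sum_const_ord; have := W x x2 => h.
apply: le_trans (_ : (1 + d%:R) * `|y| * 1 <= _).
  by rewrite mulr1 ler_wpM2r// lerDr.
rewrite [leRHS](_ : _ = (1 + d%:R) * `|y| * (25 ^+ d * w2 x)); last by ring.
by rewrite ler_wpM2l// mulr_ge0// addr_ge0.
Qed.

Lemma I_Tent_gt0 : 0 < intRd Tent.
Proof.
rewrite /intRd (_ : (fun v => _) = fun v : nat -> R => 1 * \prod_(j < d) tent (v j)); last first.
  apply/funext => v; rewrite mul1r; apply: eq_bigr => j _; by rewrite mxE.
by rewrite (intd_prod d 1 tame_tent) mul1r exprn_gt0// I1_tent_gt0.
Qed.

End Tent.

(** * Proportionality of Riemann sums and integrals *)

Section Kappa.
Local Open Scope ring_scope.
Local Open Scope classical_set_scope.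
Context {R : realType} {d : nat}.
Local Notation ivec := 'rV[int]_d.
Local Notation vec := 'rV[R]_d.
Implicit Types (k m : ivec) (x y z c r : vec) (F G g f psi : vec -> R)
  (M e N s t h : R) (K n : nat).
Local Notation I := (@intRd R d).
Local Notation MT := ((1 + d%:R) * 25 ^+ d : R).

Lemma MT_ge0 : 0 <= MT. Proof. by rewrite mulr_ge0 ?exprn_ge0// addr_ge0. Qed.

(** Plays the role of [1 / |det B|], with the proportion between Riemann sum and integral read off
    from [Tent]. *)
Definition kap (B : 'M[R]_d) N : R := LN B N Tent / I Tent.

Lemma lip_ge0 w M G : 0 < w 0 -> lip w M G -> 0 <= M.
Proof. by move=> w0 [b _]; have := le_trans (normr_ge0 _) (b 0); rewrite pmulr_lge0. Qed.

(** [I_LN_comm] against [Tent], divided by [I Tent]: the factor [kap B N] is the same for every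
    [G]. *)
Lemma LN_kap (B : 'M[R]_d) : B \in unitmx -> exists2 C : R, 0 <= C & forall N M G, 1 <= N -> mxn B <= N ->
  lip w2 M G -> `|LN B N G - kap B N * I G| <= C / N * M.
Proof.
move=> uB; have T0 := @I_Tent_gt0 R d.
exists (2 * CL B * mxn B * @CI R d * MT / I Tent).
  by rewrite divr_ge0 ?(ltW T0)// mulr_ge0 ?MT_ge0// mulr_ge0 ?CI_ge0// mulr_ge0 ?mxn_ge0// mulr_ge0 ?CL_ge0.
move=> N M G N1 BN L; have M0 := lip_ge0 (w2_gt0 _) L.
have N0 : 0 < N by rewrite (lt_le_trans ltr01).
have := I_LN_comm uB N1 BN MT_ge0 M0 lip_Tent L => h.
have -> : LN B N G - kap B N * I G = (I Tent * LN B N G - I G * LN B N Tent) / I Tent.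
  by rewrite /kap; field; rewrite gt_eqF.
rewrite normrM normfV [`|I Tent|]gtr0_norm// ler_pdivrMr//; apply: le_trans h _.
by apply: le_eq; field; rewrite !gt_eqF.
Qed.

Lemma kap_lb (B : 'M[R]_d) : B \in unitmx -> exists2 c : R, 0 < c & exists N0 : R, forall N, N0 <= N -> 1 <= N -> c <= kap B N.
Proof.
move=> uB; have T0 := @I_Tent_gt0 R d.
have T00 : 0 < @Tent R d 0 by rewrite Tent0.
have [c c0 [N0 H]] := LN_pos uB MT_ge0 (lip_w21 MT_ge0 lip_Tent) (@Tent_ge0 R d) T00.
exists (c / I Tent); first by rewrite divr_gt0.
by exists N0 => N NN N1; rewrite /kap ler_pM2r ?invr_gt0// H.
Qed.

(** Positivity is read off from Riemann sums over the standard lattice: they stay above some [c > 0]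
    by [LN_pos], whereas [I F <= 0] would make them at most [C M / N] by [LN_kap]. The term
    [C * M / c] in [N] yields the contradiction. *)
Lemma I_pos F M x0 : lip w2 M F -> (forall x, 0 <= F x) -> 0 < F x0 -> 0 < I F.
Proof.
move=> L Fp Fx0; have M0 := lip_ge0 (w2_gt0 _) L.
pose B : 'M[R]_d := 1%:M; have uB : B \in unitmx by exact: unitmx1.
have [c c0 [N0 H]] := LN_pos uB M0 (lip_w21 M0 L) Fp Fx0.
have [c' c'0 [N1 H1]] := kap_lb uB.
have [C C0 H2] := LN_kap uB.
rewrite ltNge; apply/negP => I0.
pose N := 1 + mxn B + `|N0| + `|N1| + C * M / c.
have q0 : 0 <= C * M / c by rewrite divr_ge0 ?mulr_ge0// ltW.
have m0 := mxn_ge0 B.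
have [n0 n1] : 0 <= `|N0| /\ 0 <= `|N1| by [].
have N01 : 1 <= N by rewrite /N; lra.
have h0 : c <= LN B N F by apply: H => //; have := ler_norm N0; rewrite /N; lra.
have h1 : c' <= kap B N by apply: H1 => //; have := ler_norm N1; rewrite /N; lra.
have BN : mxn B <= N by rewrite /N; lra.
have := H2 N M F N01 BN L; move=> /(le_trans (ler_norm _)).
have : kap B N * I F <= 0 by rewrite mulr_ge0_le0// (le_trans (ltW c'0)).
have : C / N * M < c.
  have : C * M / c < N by rewrite /N; lra.
  by rewrite ltr_pdivrMr// mulrAC ltr_pdivrMr ?(lt_le_trans ltr01 N01)// [N * c]mulrC.
lra.
Qed.

Lemma I_partials l g s h M : 0 <= s -> 0 <= h -> smoothR g -> WB w2 s h M g -> l != [::] ->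
  I (partials l g) = 0.
Proof.
case: l => // j l s0 h0 sg H _.
have L := WB_lip l s0 h0 sg H; have L' := WB_lip (j :: l) s0 h0 sg H.
apply: (I_partial (M := _) (M' := _) (fun x => smooth_diff x (smooth_partials l sg))).
  exact: lip_w21 (lip_ge0 (w2_gt0 _) L) L.
exact: lip_w21 (lip_ge0 (w2_gt0 _) L') L'.
Qed.

Lemma partials_cst l (c : R) : partials l (fun _ : vec => c) = fun=> if l is [::] then c else 0.
Proof.
elim: l => [|j l IH] //=; rewrite IH; exact: partial_cst.
Qed.

(** The error made when the Riemann sum of translates of [G] replaces its integral. The sum is
    nearly constant in [y] without decaying; the factor [psi] brings the error into the test
    space. *)
Definition conv_err (B : 'M[R]_d) N K psi G : vec -> R := fun y =>
  psi y * (N ^- d * \sum_(k <- zbox K) G (y - grid_pt B N k) + - (kap B N * I G)).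

Lemma smooth_conv_err (B : 'M[R]_d) N K psi G : smoothR psi -> smoothR G -> smoothR (conv_err B N K psi G).
Proof.
move=> sp sG; apply: smoothM => //; apply: smoothD; last exact: smooth_cst.
by apply: smoothZ; apply: smooth_sum => k; exact: smooth_shift.
Qed.

(** [C / N] collects [LN_trans] and [LN_kap], and [D N * tau K] is the truncation to the box [K].
    [D] may grow with [N], since [K] is sent to infinity for fixed [N]. The weight [w1] required by
    [LN_tail] is borrowed from [psi]. *)
Lemma conv_err_bound (B : 'M[R]_d) s t h : B \in unitmx -> 0 <= s -> 0 <= h -> exists2 C : R, 0 <= C &
  exists D : R -> R, forall N M M' psi G K, 1 <= N -> mxn B <= N -> smoothR psi -> smoothR G ->
   RBW s t h M psi -> RBW s t h M' G ->
   RB s t (2 * (2 `^ s * h)) (M * M' * (C / N + D N * @tau R d K)) (conv_err B N K psi G).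
Proof.
move=> uB s0 h0; have [C C0 HC] := LN_kap uB.
set h' := 2 `^ s * h.
have hh' : h <= h' by rewrite ler_peMl// ge1_2powR.
have h'0 : 0 <= h' by rewrite (le_trans h0).
set E := 1 + d%:R * h' * (4 ^+ d) ^+ 2.
have E0 : 0 <= E by rewrite addr_ge0// !mulr_ge0 ?exprn_ge0.
exists (E * (CL B * mxn B + C)).
  by rewrite mulr_ge0// addr_ge0// mulr_ge0 ?mxn_ge0// CL_ge0.
exists (fun N => E * (2 * (2 ^+ d * CN B N))) => N M M' psi G K N1 BN sp sG Hp HG l p x.
have N0 : 0 < N by rewrite (lt_le_trans ltr01).
have M0 := RBW_ge0 Hp; have M'0 := RBW_ge0 HG.
set de := E * (CL B * mxn B + C) / N + E * (2 * (2 ^+ d * CN B N)) * @tau R d K.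
pose th := fun y => N ^- d * \sum_(k <- zbox K) G (y - grid_pt B N k) + - (kap B N * I G).
have s1 : smoothR (fun y => \sum_(k <- zbox K) G (y - grid_pt B N k)).
  by apply: smooth_sum => k; exact: smooth_shift.
have sth : smoothR th by apply: smoothD; [exact: smoothZ|exact: smooth_cst].
have key l2 : w1 x * `|partials l2 th x| <= M' * bd s h' l2 * de.
  (* For nonempty [l2] the constant [kap * I G] disappears, but so does the integral of
     [partials l2 G] by [I_partials]. One formula thus covers all orders, with [partials l2 G] in
     the place of [G]. *)
  have -> : partials l2 th x = N ^- d * \sum_(k <- zbox K) partials l2 G (x - grid_pt B N k)
       - kap B N * I (partials l2 G).
    rewrite /th partialsD//; [|exact: smoothZ|exact: smooth_cst].
    rewrite partialsZ// partials_sum; last by move=> k; exact: smooth_shift.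
    rewrite partials_cst; congr (_ * _ + _).
      by apply: eq_bigr => k _; rewrite partials_shift.
    case: (eqVneq l2 [::]) => [->//|n]; rewrite (I_partials s0 h0 sG (RBW_WB HG) n) mulr0 oppr0.
    by case: l2 n.
  (* The reflection turns translates [G (x - z)] into the form [Gl (z - x)] treated by [LN_tail] and
     [LN_trans]. *)
  pose Gl := fun z => partials l2 G (- z).
  have L0 := WB_lip l2 s0 h0 sG (RBW_WB HG); rewrite -/h' -/E in L0.
  have L0' := lip_ge0 (w2_gt0 _) L0.
  have L : lip w2 (E * M' * bd s h' l2) Gl.
    by apply: lip_opp L0 => y; rewrite /w2 /w1 normrN.
  have IGl : I Gl = I (partials l2 G) by exact: I_opp L0' (lip_w21 L0' L0).
  rewrite -IGl (eq_bigr (fun k => Gl (grid_pt B N k - x))); last first.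
    by move=> k _; rewrite /Gl opprB.
  set S := \sum_(k <- zbox K) _.
  have b1 := LN_tail uB x K N1 L0' (lip_w21 L0' L).1; rewrite -/S in b1.
  have b2 := LN_trans uB (- x) N1 BN L0' (lip_w21 L0' L).
  have b3 := HC N _ Gl N1 BN L.
  set P := LN B N (fun z => Gl (z - x)) in b1 b2.
  have b4 : `|N ^- d * S - kap B N * I Gl| <= `|P - N ^- d * S| + (`|P - LN B N Gl| + `|LN B N Gl - kap B N * I Gl|).
    apply: le_trans (ler_distD P _ _) _; rewrite distrC lerD2l.
    exact: ler_distD.
  apply: le_trans (ler_wpM2l (w1_ge0 x) b4) _; rewrite mulrDr.
  have b5 : w1 x * (`|P - LN B N Gl| + `|LN B N Gl - kap B N * I Gl|) <=
     CL B * (E * M' * bd s h' l2 * (mxn B / N)) + C / N * (E * M' * bd s h' l2).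
    apply: le_trans (ler_piMl _ (w1_le1 _)) _; first by rewrite addr_ge0.
    exact: lerD b2 b3.
  apply: le_trans (lerD b1 b5) _.
  by apply: le_eq; rewrite /de; field; rewrite gt_eqF.
have de0 : 0 <= de.
  rewrite /de addr_ge0//.
    by rewrite divr_ge0 ?(ltW N0)// mulr_ge0// addr_ge0// mulr_ge0 ?mxn_ge0// CL_ge0.
  apply: mulr_ge0; last exact: tau_ge0.
  by apply: mulr_ge0 => //; apply: mulr_ge0 => //; apply: mulr_ge0; rewrite ?exprn_ge0 ?CN_ge0.
have B0 q := bd_ge0 s q h0; have B0' q := bd_ge0 s q h'0; have Bt := bd_ge0 t p h0.
apply: le_trans (leibniz_bound_scaled (Bd := bd s h') (M := M * M' * de * bd t h p) l sp sth (normr_ge0 _) _ _) _.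
- by move=> *; exact: bd_perm.
- move=> l1 l2; rewrite [leLHS]mulrA.
  apply: le_trans (ler_wpM2r (normr_ge0 _) (Hp l1 p x)) _.
  rewrite /w2 expr2 [leLHS](_ : _ = M * (bd s h l1 * bd t h p) * w1 x * (w1 x * `|partials l2 th x|)); last by ring.
  apply: le_trans (ler_wpM2l _ (key l2)) _.
    by rewrite mulr_ge0 ?w1_ge0// mulr_ge0// mulr_ge0.
  apply: le_trans (_ : M * (bd s h' l1 * bd t h p) * 1 * (M' * bd s h' l2 * de) <= _).
    apply: ler_wpM2r; first by rewrite mulr_ge0// mulr_ge0.
    apply: ler_pM; rewrite ?w1_le1 ?w1_ge0//; first by rewrite mulr_ge0// mulr_ge0.
    by rewrite ler_wpM2l// ler_wpM2r// bd_mono.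
  apply: le_trans (_ : M * M' * de * bd t h p * (bd s h' l1 * bd s h' l2) <= _).
    by apply: le_eq; ring.
  by apply: ler_wpM2l; [rewrite mulr_ge0// mulr_ge0// mulr_ge0|exact: bd_cat].
rewrite (bd_scale s h' 2) (bd_scale t h' 2).
have P1 : 1 <= 2 ^+ size p :> R by rewrite exprn_ege1// ler1n.
have bt : bd t h p <= 2 ^+ size p * bd t h' p.
  by apply: le_trans (bd_mono t p h0 hh') _; rewrite ler_peMl// bd_ge0.
rewrite [leLHS](_ : _ = M * M' * de * (2 ^+ size l * bd s h' l) * bd t h p); last by ring.
rewrite [leRHS](_ : _ = M * M' * de * (2 ^+ size l * bd s h' l) * (2 ^+ size p * bd t h' p)); last by rewrite /de; ring.
apply: ler_wpM2l bt; apply: mulr_ge0; first by rewrite mulr_ge0// mulr_ge0.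
by apply: mulr_ge0; [rewrite exprn_ge0|exact: bd_ge0].
Qed.

End Kappa.

(** * Complex test functions *)

Section ComplexNum.
Local Open Scope ring_scope.
Local Open Scope classical_set_scope.
Context {R : realType}.
Local Notation C := R[i].
Implicit Types (z w : C) (a b : R).

Lemma cabsE z : cabs z = Normc.normc z. Proof. by case: z. Qed.
Lemma cabs_ge0 z : 0 <= cabs z. Proof. exact: sqrtr_ge0. Qed.
Lemma cabsM z w : cabs (z * w) = cabs z * cabs w. Proof. by rewrite !cabsE Normc.normcM. Qed.
Lemma cabsD z w : cabs (z + w) <= cabs z + cabs w. Proof. by rewrite !cabsE le_normcD. Qed.
Lemma cabs0 : cabs (0 : C) = 0. Proof. by rewrite cabsE Normc.normc0. Qed.
Lemma cabsN z : cabs (- z) = cabs z. Proof. by rewrite !cabsE normcN. Qed.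
Lemma cabs_eq0 z : cabs z = 0 -> z = 0. Proof. by rewrite cabsE => /Normc.eq0_normc. Qed.
Lemma cabsB z w : cabs (z - w) <= cabs z + cabs w.
Proof. by apply: le_trans (cabsD _ _) _; rewrite cabsN. Qed.
Lemma cabs_sub z w : cabs (z - w) = cabs (w - z). Proof. by rewrite -cabsN opprB. Qed.
Lemma cabs_dist w z1 z2 : cabs (z1 - z2) <= cabs (z1 - w) + cabs (w - z2).
Proof. by have := cabsD (z1 - w) (w - z2); rewrite addrA subrK. Qed.
Lemma cabs_Rc a : cabs (Rc a) = `|a|.
Proof. by rewrite /cabs /= expr0n addr0 sqrtr_sqr. Qed.
Lemma cabs_cexpi a : cabs (cexpi a) = 1.
Proof. by rewrite /cabs /= cos2Dsin2 sqrtr1. Qed.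
Lemma cabs_sum (T : Type) (s : seq T) (F : T -> C) :
  cabs (\sum_(i <- s) F i) <= \sum_(i <- s) cabs (F i).
Proof.
elim: s => [|i s IH]; first by rewrite !big_nil cabs0.
by rewrite !big_cons; apply: le_trans (cabsD _ _) _; rewrite lerD2l.
Qed.
Lemma cabsV z : cabs z^-1 = (cabs z)^-1.
Proof. by rewrite !cabsE Normc.normcV. Qed.
Lemma cexpiD a b : cexpi (a + b) = cexpi a * cexpi b :> C.
Proof. by apply/eqP; rewrite eq_complex /= cosD sinD eqxx /= addrC eqxx. Qed.
Lemma cexpi0 : cexpi 0 = 1 :> C.
Proof. by rewrite /cexpi cos0 sin0. Qed.
Lemma cexpiNK a : cexpi a * cexpi (- a) = 1 :> C.
Proof. by rewrite -cexpiD subrr cexpi0. Qed.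
Lemma cexpi_conj a : conjc (cexpi a) = cexpi (- a) :> C.
Proof. by rewrite /cexpi /= cosN sinN. Qed.
Lemma cexpi_sum (T : Type) (s : seq T) (f : T -> R) :
  cexpi (\sum_(i <- s) f i) = \prod_(i <- s) cexpi (f i) :> C.
Proof.
elim: s => [|i s IH]; first by rewrite !big_nil cexpi0.
by rewrite !big_cons cexpiD IH.
Qed.
Lemma cexpi_mulrn a n : cexpi (a *+ n) = cexpi a ^+ n :> C.
Proof. by elim: n => [|n IH]; rewrite ?mulr0n ?cexpi0// mulrS exprS cexpiD IH. Qed.
Lemma cexpi_2pi : cexpi (2 * pi) = 1 :> C.
Proof. by rewrite /cexpi mulr_natl cos2pi sin2pi. Qed.
Lemma cexpi_int (m : int) : cexpi (2 * pi * m%:~R) = 1 :> C.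
Proof.
case: m => n.
  by rewrite pmulrn mulr_natr cexpi_mulrn cexpi_2pi expr1n.
rewrite NegzE rmorphN /= mulrN -cexpi_conj pmulrn mulr_natr cexpi_mulrn cexpi_2pi expr1n.
by apply/eqP; rewrite eq_complex /= oppr0 !eqxx.
Qed.

Lemma RcM a b : Rc (a * b) = Rc a * Rc b :> C.
Proof. by apply/eqP; rewrite eq_complex /=; apply/andP; split; apply/eqP; ring. Qed.
Lemma RcD a b : Rc (a + b) = Rc a + Rc b :> C.
Proof. by apply/eqP; rewrite eq_complex /=; apply/andP; split; apply/eqP; ring. Qed.
Lemma Rc1 : Rc 1 = 1 :> C. Proof. by []. Qed.
Lemma Rc_sum (T : Type) (s : seq T) (f : T -> R) :
  Rc (\sum_(i <- s) f i) = \sum_(i <- s) Rc (f i) :> C.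
Proof. by elim: s => [|i s IH]; rewrite ?big_nil// !big_cons RcD IH. Qed.
Lemma cRe_sum (T : Type) (s : seq T) (f : T -> C) :
  complex.Re (\sum_(i <- s) f i) = \sum_(i <- s) complex.Re (f i).
Proof. by elim: s => [|i s IH]; rewrite ?big_nil// !big_cons /= -IH; case: (f i) (\sum_(_ <- _) _) => [? ?] [? ?]. Qed.
Lemma cIm_sum (T : Type) (s : seq T) (f : T -> C) :
  complex.Im (\sum_(i <- s) f i) = \sum_(i <- s) complex.Im (f i).
Proof. by elim: s => [|i s IH]; rewrite ?big_nil// !big_cons /= -IH; case: (f i) (\sum_(_ <- _) _) => [? ?] [? ?]. Qed.
Lemma cReM z w : complex.Re (z * w) = complex.Re z * complex.Re w + -1 * (complex.Im z * complex.Im w).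
Proof. by case: z w => [? ?] [? ?] /=; rewrite mulN1r. Qed.
Lemma cImM z w : complex.Im (z * w) = complex.Re z * complex.Im w + complex.Im z * complex.Re w.
Proof. by case: z w => [? ?] [? ?]. Qed.
Lemma cReD z w : complex.Re (z + w) = complex.Re z + complex.Re w.
Proof. by case: z w => [? ?] [? ?]. Qed.
Lemma cImD z w : complex.Im (z + w) = complex.Im z + complex.Im w.
Proof. by case: z w => [? ?] [? ?]. Qed.

Lemma cos2_quarter : cos (pi / 4 : R) ^+ 2 = 1 / 2.
Proof.
have := cosD (pi / 4 : R) (pi / 4).
rewrite (_ : pi / 4 + pi / 4 = pi / 2 :> R); last by field.
have := cos2Dsin2 (pi / 4 : R); rewrite cos_pihalf !expr2; lra.
Qed.

(** Up to [pi / 4] the derivative [cos] is at least 1/2, so [sin y >= y / 2]. The rest follows from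
    [sin x = 2 sin (x/2) cos (x/2)]. *)
Lemma sin_lb (x : R) : 0 <= x -> x <= pi / 2 -> x / 4 <= sin x.
Proof.
move=> x0 x1; have p2 : pi <= 4 :> R by have := @pihalf_lt2 R; lra.
have pp : 0 < pi :> R by exact: pi_gt0.
have cq : 1 / 2 <= cos (pi / 4 : R).
  have c0 : 0 < cos (pi / 4 : R) by apply: cos_gt0_pihalf; apply/andP; split; lra.
  have := cos2_quarter; rewrite expr2; nra.
have h (y : R) : 0 <= y -> y <= pi / 4 -> 1 / 2 * y <= sin y.
  move=> y0 y1.
  have D (z : R) : z \in `]0, y[%R -> is_derive z 1 sin (cos z : R) by move=> _; exact: is_derive_sin.
  have [|c cI] := MVT_segment y0 D; first by apply: continuous_subspaceT => z; exact: continuous_sin.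
  rewrite sin0 !subr0 => ->; apply: ler_wpM2r => //; apply: le_trans cq _.
  move: cI; rewrite in_itv /= => /andP[c0 cy].
  have [->//|ne] := eqVneq c (pi / 4).
  rewrite ltW// ltr_cos ?in_itv/=.
  - by rewrite lt_neqAle ne (le_trans cy).
  - by apply/andP; split; lra.
  - by apply/andP; split; lra.
have [hx|hx] := lerP x (pi / 4); first by have := h x x0 hx; lra.
rewrite -(@subKr _ x x) subrr subr0.
have -> : x = x / 2 + x / 2 by field.
have h2 : 0 <= x / 2 /\ x / 2 <= pi / 4 by split; lra.
have s1 := h (x / 2) h2.1 h2.2.
have c1 : 1 / 2 <= cos (x / 2).
  apply: le_trans cq _; have [->//|ne] := eqVneq (x / 2) (pi / 4).
  rewrite ltW// ltr_cos ?in_itv/=.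
  - by rewrite lt_neqAle ne h2.2.
  - by apply/andP; split; lra.
  - by apply/andP; split; lra.
rewrite sinD; nra.
Qed.

(** [1 - cos t = 2 sin^2 (t/2)], and [sin_lb] at [|t| / 2] gives [2 (t/8)^2]. *)
Lemma cos_ub (t : R) : `|t| <= pi -> t ^+ 2 / 32 <= 1 - cos t.
Proof.
move=> tp; have -> : cos t = cos `|t|.
  by case: (ger0P t) => // _; rewrite cosN.
rewrite -(real_normK (num_real t)); move: `|t| (normr_ge0 t) tp => r r0 rp.
have h := @sin_lb (r / 2); have hp : 0 <= r / 2 by lra.
have hq : r / 2 <= pi / 2 by lra.
have := h hp hq => s1.
have -> : cos r = cos (r / 2 + r / 2) by congr cos; field.
have := cos2Dsin2 (r / 2); rewrite cosD !expr2; nra.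
Qed.

End ComplexNum.

(** * Closure properties of the test spaces and continuity estimates *)

Section TestSpace.
Local Open Scope ring_scope.
Local Open Scope classical_set_scope.
Context {R : realType} {d : nat}.
Local Notation vec := 'rV[R]_d.
Local Notation C := R[i].
Implicit Types (x y z c eta : vec) (f g : vec -> R) (F G H psi : vec -> C)
  (s t h M A K : R) (sig : bool) (u : (vec -> C) -> C).

Lemma RBWD s t h M M' f g : smoothR f -> smoothR g -> RBW s t h M f -> RBW s t h M' g ->
  RBW s t h (M + M') (fun x => f x + g x).
Proof.
move=> sf sg Hf Hg l p x; rewrite partialsD//.
apply: le_trans (ler_wpM2l (normr_ge0 _) (ler_normD _ _)) _.
by rewrite mulrDr !mulrDl lerD.
Qed.

Lemma RBWZ s t h M (c : R) f : smoothR f -> RBW s t h M f -> RBW s t h (`|c| * M) (fun x => c * f x).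
Proof.
move=> sf Hf l p x; rewrite partialsZ// normrM mulrCA.
have := ler_wpM2l (normr_ge0 c) (Hf l p x); set b := bd s h l * _.
by rewrite !mulrA.
Qed.

Lemma RBD s t h M M' f g : smoothR f -> smoothR g -> RB s t h M f -> RB s t h M' g ->
  RB s t h (M + M') (fun x => f x + g x).
Proof.
move=> sf sg Hf Hg l p x; rewrite partialsD//.
apply: le_trans (ler_wpM2l (normr_ge0 _) (ler_normD _ _)) _.
by rewrite mulrDr !mulrDl lerD.
Qed.

Lemma RBZ s t h M (c : R) f : smoothR f -> RB s t h M f -> RB s t h (`|c| * M) (fun x => c * f x).
Proof.
move=> sf Hf l p x; rewrite partialsZ// normrM mulrCA.
have := ler_wpM2l (normr_ge0 c) (Hf l p x); set b := bd s h l * _.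
by rewrite !mulrA.
Qed.

Lemma smoothC_mul F G : smoothC F -> smoothC G -> smoothC (fun y => F y * G y).
Proof.
move=> [a b] [a' b']; split.
  rewrite (_ : reF _ = fun y => reF F y * reF G y + -1 * (imF F y * imF G y)); last first.
    by apply/funext => y; rewrite /reF cReM.
  by apply: smoothD; [exact: smoothM|apply/smoothZ/smoothM].
rewrite (_ : imF _ = fun y => reF F y * imF G y + imF F y * reF G y); last first.
  by apply/funext => y; rewrite /imF cImM.
by apply: smoothD; exact: smoothM.
Qed.

Lemma smoothC_cst (c : C) : smoothC (fun _ : vec => c).
Proof. by split; exact: smooth_cst. Qed.

Lemma smoothC_add F G : smoothC F -> smoothC G -> smoothC (fun y => F y + G y).
Proof.
move=> [a b] [a' b']; split.
  rewrite (_ : reF _ = fun y => reF F y + reF G y); last by apply/funext => y; rewrite /reF cReD.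
  exact: smoothD.
rewrite (_ : imF _ = fun y => imF F y + imF G y); last by apply/funext => y; rewrite /imF cImD.
exact: smoothD.
Qed.

Lemma smoothC_shift F c : smoothC F -> smoothC (fun y => F (y + c)).
Proof. by move=> [a b]; split; [exact: (smooth_shift c a)|exact: (smooth_shift c b)]. Qed.

Lemma smoothC_conj F : smoothC F -> smoothC (fun y => conjc (F y)).
Proof.
move=> [a b]; split; first by rewrite (_ : reF _ = reF F)//; apply/funext => y; rewrite /reF; case: (F y).
rewrite (_ : imF _ = fun y => -1 * imF F y); first exact: smoothZ.
by apply/funext => y; rewrite /imF mulN1r; case: (F y).
Qed.

Lemma re_cexpi eta (b : R) : reF (fun y => cexpi (inner y eta + b)) = trig (cos b) (- sin b) eta.
Proof. by apply/funext => y; rewrite /reF /trig /= cosD; ring. Qed.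
Lemma im_cexpi eta (b : R) : imF (fun y => cexpi (inner y eta + b)) = trig (sin b) (cos b) eta.
Proof. by apply/funext => y; rewrite /imF /trig /= sinD; ring. Qed.

Lemma smoothC_cexpi eta (b : R) : smoothC (fun y : vec => cexpi (inner y eta + b)).
Proof. by split; rewrite ?re_cexpi ?im_cexpi; exact: smooth_trig. Qed.

Definition GBW s t h M F := [/\ smoothC F, RBW s t h M (reF F) & RBW s t h M (imF F)].
Definition DBC s h M F := [/\ smoothC F, WB (fun=> 1) s h M (reF F) & WB (fun=> 1) s h M (imF F)].

Lemma GBW_mono s t h h' M M' F : 0 <= h -> h <= h' -> M <= M' -> GBW s t h M F -> GBW s t h' M' F.
Proof.
by move=> h0 hh MM [sF a b]; split=> //; apply: (RBW_mono h0 hh _ MM) => //; exact: RBW_ge0 a.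
Qed.

Lemma GBW_ge0 s t h M F : GBW s t h M F -> 0 <= M. Proof. by move=> [_ /RBW_ge0]. Qed.

Lemma GBW_GSbound s t h M F : 0 <= h -> GBW s t h M F -> GSbound s t h (M + M) F.
Proof.
by move=> h0 [_ a b]; apply: RB_GSbound; apply: RBW_RB => //; exact: RBW_ge0 a.
Qed.

(** Introducing the weight multiplies [h] by [2^t], which leaves both quantifiers on [h] intact. *)
Lemma inGSP sig s t F : 0 < s -> 0 < t -> inGS sig s t F <->
  smoothC F /\ if sig then forall h, 0 < h -> exists M, GBW s t h M F
     else exists h, 0 < h /\ exists M, GBW s t h M F.
Proof.
move=> s0 t0.
have up h : 0 < h -> smoothC F -> (exists M, GSbound s t h M F) -> exists M, GBW s t (2 `^ t * h) M F.
  move=> h0 sF [M H]; have [C C0 HC] := RB_RBW (d := d) s h0 t0.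
  have [a b] := GSbound_RB sF H; have M0 := RB_ge0 a.
  by exists (C * M); split=> //; exact: HC.
have p0 : 0 < 2 `^ t :> R by rewrite powR_gt0.
split=> -[sF]; case: sig => H; split=> //.
- move=> h h0; have h'0 : 0 < h / 2 `^ t by rewrite divr_gt0.
  have [M HM] := up _ h'0 sF (H _ h'0); exists M.
  by rewrite mulrC divfK ?gt_eqF in HM.
- have [h [h0 HM]] := H; exists (2 `^ t * h); split; first by rewrite mulr_gt0.
  exact: up.
- move=> h h0; have [M HM] := H h h0; exists (M + M); apply: GBW_GSbound => //; exact: ltW.
- have [h [h0 [M HM]]] := H; exists h; split=> //; exists (M + M); apply: GBW_GSbound => //; exact: ltW.
Qed.

(** Treats both kinds of space at once: an operation that costs a fixed factor [A] on [h] preserves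
    a bound for some [h] as well as bounds for all [h]. In the first case the scales of [F] and [G]
    may differ, and their maximum is used. *)
Lemma inGS_op sig s t F G H A : 0 < s -> 0 < t -> 0 < A ->
  (forall h M, 0 < h -> GBW s t h M F -> GBW s t h M G -> exists M', GBW s t (A * h) M' H) ->
  inGS sig s t F -> inGS sig s t G -> inGS sig s t H.
Proof.
move=> s0 t0 A0 HH /(inGSP _ _ s0 t0)[_ TF] /(inGSP _ _ s0 t0)[_ TG]; apply/(inGSP _ _ s0 t0).
have both h M M' : 0 < h -> GBW s t h M F -> GBW s t h M' G -> exists M', GBW s t (A * h) M' H.
  move=> h0 a b; apply: (HH _ (Num.max M M')) => //.
    by apply: GBW_mono a; rewrite ?(ltW h0)// le_max lexx.
  by apply: GBW_mono b; rewrite ?(ltW h0)// le_max lexx orbT.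
case: sig TF TG => [TF TG|[h [h0 [M a]]] [h' [h'0 [M' b]]]].
  have Q h : 0 < h -> exists M', GBW s t h M' H.
    move=> h0; have hA : 0 < h / A by rewrite divr_gt0.
    have [M a] := TF _ hA; have [M' b] := TG _ hA.
    by have := both _ _ _ hA a b; rewrite mulrC divfK ?gt_eqF.
  by split=> //; have [M' []] := Q 1 ltr01.
have m0 : 0 < Num.max h h' by rewrite lt_max h0.
have [M'' q] : exists M', GBW s t (A * Num.max h h') M' H.
  apply: (both _ M M') => //.
    by apply: GBW_mono a; rewrite ?(ltW h0)// le_max lexx.
  by apply: GBW_mono b; rewrite ?(ltW h'0)// le_max lexx orbT.
split; first by case: q.
by exists (A * Num.max h h'); split; [rewrite mulr_gt0|exists M''].
Qed.

Lemma GBW_mul s t h M M' F G : 0 <= s -> 0 <= h -> GBW s t h M F -> DBC s h M' G ->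
  GBW s t (2 * h) (2 * (M * M')) (fun y => F y * G y).
Proof.
move=> s0 h0 [[s1 s2] a b] [[s1' s2'] a' b'].
have P f g : smoothR f -> smoothR g -> RBW s t h M f -> WB (fun=> 1) s h M' g ->
   RBW s t (2 * h) (M * M') (fun x => f x * g x) by move=> *; exact: RBWM.
split; first exact: smoothC_mul.
  rewrite (_ : reF _ = fun y => reF F y * reF G y + -1 * (imF F y * imF G y)); last first.
    by apply/funext => y; rewrite /reF cReM.
  rewrite (_ : 2 * (M * M') = M * M' + `|-1| * (M * M')); last by rewrite normrN1; ring.
  apply: RBWD; [exact: smoothM|apply/smoothZ/smoothM => //|exact: P|].
  by apply: RBWZ; [exact: smoothM|exact: P].
rewrite (_ : imF _ = fun y => reF F y * imF G y + imF F y * reF G y); last first.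
  by apply/funext => y; rewrite /imF cImM.
rewrite (_ : 2 * (M * M') = M * M' + M * M'); last by ring.
by apply: RBWD; [exact: smoothM|exact: smoothM|exact: P|exact: P].
Qed.

Lemma GBW_DBC s t h M F : 0 <= h -> GBW s t h M F -> DBC s h M F.
Proof. by move=> h0 [sF a b]; split=> //; apply: RB_DB; apply: RBW_RB => //; exact: RBW_ge0 a. Qed.

Lemma DBC_cexpi s h eta (b : R) rho : 0 < s -> 0 < h -> 0 <= rho -> `|eta| <= rho ->
  DBC s h (expt s (rho / h) ^+ d * 2) (fun y : vec => cexpi (inner y eta + b)).
Proof.
move=> s0 h0 r0 er; split; first exact: smoothC_cexpi.
  rewrite re_cexpi; apply: WB_mono (WB_trig _ _ s0 h0 r0 er) => //; first exact: ltW.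
    by rewrite mulr_ge0 ?exprn_ge0 ?expR_ge0// addr_ge0.
  by rewrite ler_wpM2l ?exprn_ge0 ?expR_ge0// normrN lerD// ler_norml ?cos_geN1 ?cos_le1 ?sin_geN1 ?sin_le1.
rewrite im_cexpi; apply: WB_mono (WB_trig _ _ s0 h0 r0 er) => //; first exact: ltW.
  by rewrite mulr_ge0 ?exprn_ge0 ?expR_ge0// addr_ge0.
by rewrite ler_wpM2l ?exprn_ge0 ?expR_ge0// lerD// ler_norml ?cos_geN1 ?cos_le1 ?sin_geN1 ?sin_le1.
Qed.

Lemma GBW_lin s t h M (a b : C) F G : GBW s t h M F -> GBW s t h M G ->
  GBW s t h (2 * (cabs a + cabs b) * M) (fun y => a * F y + b * G y).
Proof.
move=> HF HG; have M0 := GBW_ge0 HF; move: HF HG => [[s1 s2] p q] [[s1' s2'] p' q'].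
have Z (e : R) f : smoothR f -> RBW s t h M f -> RBW s t h (`|e| * M) (fun x => e * f x) by exact: RBWZ.
have SZ (e : R) f : smoothR f -> smoothR (fun x => e * f x) by exact: smoothZ.
have h0 : 0 <= h \/ h < 0 by case: (lerP 0 h); [left|right].
have Q (e e' : R) f g f' g' (c c' : R) : smoothR f -> smoothR g -> smoothR f' -> smoothR g' ->
  RBW s t h M f -> RBW s t h M g -> RBW s t h M f' -> RBW s t h M g' ->
  `|e| <= cabs a -> `|e'| <= cabs a -> `|c| <= cabs b -> `|c'| <= cabs b ->
  RBW s t h (2 * (cabs a + cabs b) * M) (fun y => (e * f y + e' * g y) + (c * f' y + c' * g' y)).
  move=> sf sg sf' sg' hf hg hf' hg' e1 e2 c1 c2.
  have W : RBW s t h ((`|e| * M + `|e'| * M) + (`|c| * M + `|c'| * M))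
    (fun y => (e * f y + e' * g y) + (c * f' y + c' * g' y)).
    by apply: RBWD; [apply: smoothD; exact: SZ|apply: smoothD; exact: SZ|
      apply: RBWD; [exact: SZ|exact: SZ|exact: Z|exact: Z]|
      apply: RBWD; [exact: SZ|exact: SZ|exact: Z|exact: Z]].
  move=> l r x; apply: le_trans (W l r x) _; rewrite ler_wpM2r ?w2_ge0//.
  have X0 : 0 <= M * (bd s h l * bd t h r) * w2 x by apply: le_trans (hf l r x); rewrite mulr_ge0.
  have Y0 : 0 <= M * (bd s h l * bd t h r) by rewrite -(pmulr_lge0 _ (w2_gt0 x)).
  have -> : (`|e| * M + `|e'| * M + (`|c| * M + `|c'| * M)) * (bd s h l * bd t h r) =
     (`|e| + `|e'| + (`|c| + `|c'|)) * (M * (bd s h l * bd t h r)) by ring.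
  rewrite -[leRHS]mulrA ler_wpM2r//; lra.
split.
- by apply: smoothC_add; apply: smoothC_mul => //; exact: smoothC_cst.
- rewrite (_ : reF _ = fun y => (complex.Re a * reF F y + - complex.Im a * imF F y) +
      (complex.Re b * reF G y + - complex.Im b * imF G y)); last first.
    by apply/funext => y; rewrite /reF /imF cReD !cReM; ring.
  by apply: Q; rewrite ?normrN ?cabs_re ?cabs_im.
- rewrite (_ : imF _ = fun y => (complex.Re a * imF F y + complex.Im a * reF F y) +
      (complex.Re b * imF G y + complex.Im b * reF G y)); last first.
    by apply/funext => y; rewrite /reF /imF cImD !cImM; ring.
  by apply: Q; rewrite ?normrN ?cabs_re ?cabs_im.
Qed.

Lemma GBW_shift s t h rho : 0 < t -> 0 < h -> 0 <= rho ->
  exists2 E : R, 0 <= E & forall M F c, GBW s t h M F -> `|c| <= rho ->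
   GBW s t (2 * h) (E * M) (fun x => F (x + c)).
Proof.
move=> t0 h0 r0; have [E E0 H] := RBW_shift (d := d) s t0 h0 r0.
exists E => // M F c [sF a b] cr; split; first exact: smoothC_shift.
  exact: H a cr.
exact: H b cr.
Qed.

Lemma GBW_conj s t h M F : GBW s t h M F -> GBW s t h M (fun y => conjc (F y)).
Proof.
move=> [sF a b]; split; first exact: smoothC_conj.
  by rewrite (_ : reF _ = reF F)//; apply/funext => y; rewrite /reF; case: (F y).
rewrite (_ : imF _ = fun y => -1 * imF F y); last by apply/funext => y; rewrite /imF mulN1r; case: (F y).
by have := RBWZ (-1) sF.2 b; rewrite normrN1 mul1r.
Qed.

Section Closure.
Variables (sig : bool) (s t : R).
Hypotheses (s0 : 0 < s) (t0 : 0 < t).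
Local Notation T := (inGS sig s t).

Lemma T_lin (a b : C) F G : T F -> T G -> T (fun y => a * F y + b * G y).
Proof.
apply: (inGS_op (A := 1)) => // h M h0 HF HG; rewrite mul1r.
by eexists; exact: GBW_lin HF HG.
Qed.

Lemma T_scale (a : C) F : T F -> T (fun y => a * F y).
Proof.
move=> TF; have := T_lin a 0 TF TF; congr T; apply/funext => y.
by rewrite mul0r addr0.
Qed.

Lemma T_add F G : T F -> T G -> T (fun y => F y + G y).
Proof.
move=> TF TG; have := T_lin 1 1 TF TG; congr T; apply/funext => y.
by rewrite !mul1r.
Qed.

Lemma T_shift F c : T F -> T (fun y => F (y + c)).
Proof.
move=> TF; apply: (inGS_op (A := 2) s0 t0 _ _ TF TF) => // h M h0 HF _.
have [E _ HE] := GBW_shift s t0 h0 (normr_ge0 c).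
by exists (E * M); exact: HE.
Qed.

Lemma T_mod F eta (b : R) : T F -> T (fun y => F y * cexpi (inner y eta + b)).
Proof.
move=> TF; apply: (inGS_op (A := 2) s0 t0 _ _ TF TF) => // h M h0 HF _.
by eexists; exact: GBW_mul (ltW s0) (ltW h0) HF (DBC_cexpi b s0 h0 (normr_ge0 eta) (lexx _)).
Qed.

Lemma T_mul F G : T F -> T G -> T (fun y => F y * G y).
Proof.
move=> TF TG; apply: (inGS_op (A := 2) s0 t0 _ _ TF TG) => // h M h0 HF HG.
by eexists; exact: GBW_mul (ltW s0) (ltW h0) HF (GBW_DBC (ltW h0) HG).
Qed.

Lemma T_conj F : T F -> T (fun y => conjc (F y)).
Proof.
move=> TF; apply: (inGS_op (A := 1) s0 t0 _ _ TF TF) => // h M h0 HF _.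
by rewrite mul1r; exists M; exact: GBW_conj.
Qed.

Lemma T_sum (I : Type) (r : seq I) (F : I -> vec -> C) G : T G -> (forall i, T (F i)) ->
  T (fun y => \sum_(i <- r) F i y).
Proof.
move=> TG TF; elim: r => [|i r IH].
  have := T_scale 0 TG; congr T; apply/funext => y; by rewrite big_nil mul0r.
have := T_add (TF i) IH; congr T; apply/funext => y; by rewrite big_cons.
Qed.

(** One estimate for both topologies. For the projective limit, continuity fixes a scale [h0] and
    [h] is [h0 / A]; for the inductive limit, [h] comes from [F] and [G], and continuity is used at
    [A * h]. The factor [A] leaves room for the operations later applied to [F] and [G]. *)
Lemma GS_pick u F G A : GScont sig s t u -> T F -> T G -> 0 < A ->
  exists h M K, [/\ 0 < h, 0 <= K, GBW s t h M F, GBW s t h M G &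
   forall H M', T H -> RB s t (A * h) M' (reF H) -> RB s t (A * h) M' (imF H) -> cabs (u H) <= K * M'].
Proof.
move=> cu /(inGSP _ _ s0 t0)[_ TF] /(inGSP _ _ s0 t0)[_ TG] A0.
have both h M M' : 0 <= h -> GBW s t h M F -> GBW s t h M' G ->
    GBW s t h (Num.max M M') F /\ GBW s t h (Num.max M M') G.
  by move=> h0 a b; split; [apply: GBW_mono a|apply: GBW_mono b]; rewrite // le_max lexx ?orbT.
case: sig cu TF TG => [[h0 [h00 [K HK]]] TF TG|cu [h [h0 [M a]]] [h' [h'0 [M' b]]]].
  have hA : 0 < h0 / A by rewrite divr_gt0.
  have [M a] := TF _ hA; have [M' b] := TG _ hA.
  have [a1 b1] := both _ _ _ (ltW hA) a b.
  exists (h0 / A), (Num.max M M'), (Num.max K 0 * 2); split=> //.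
    by rewrite mulr_ge0// le_max lexx orbT.
  move=> H M'' TH r1 r2; rewrite [A * _]mulrC divfK ?gt_eqF// in r1 r2.
  have M0 := RB_ge0 r1.
  apply: le_trans (HK H (M'' + M'') TH (RB_GSbound r1 r2)) _.
  have : K <= Num.max K 0 by rewrite le_max lexx.
  by have : 0 <= Num.max K 0; [rewrite le_max lexx orbT|nra].
pose m := Num.max h h'; have m0 : 0 < m by rewrite lt_max h0.
have a1 : GBW s t m M F by apply: GBW_mono a; rewrite ?(ltW h0)// le_max lexx.
have b1 : GBW s t m M' G by apply: GBW_mono b; rewrite ?(ltW h'0)// le_max lexx orbT.
have [a2 b2] := both _ _ _ (ltW m0) a1 b1.
have Am : 0 < A * m by rewrite mulr_gt0.
have [K HK] := cu _ Am.
exists m, (Num.max M M'), (Num.max K 0 * 2); split=> //.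
  by rewrite mulr_ge0// le_max lexx orbT.
move=> H M'' TH r1 r2; have M0 := RB_ge0 r1.
apply: le_trans (HK H (M'' + M'') TH.1 (RB_GSbound r1 r2)) _.
have : K <= Num.max K 0 by rewrite le_max lexx.
by have : 0 <= Num.max K 0; [rewrite le_max lexx orbT|nra].
Qed.

Lemma u_scale u (a : C) F : GSlinear sig s t u -> T F -> u (fun y => a * F y) = a * u F.
Proof.
move=> lu TF; have := lu a 0 F F TF TF; rewrite mul0r addr0 => <-.
by congr u; apply/funext => y; rewrite mul0r addr0.
Qed.

End Closure.

Definition lipC M F := lip w1 M (reF F) /\ lip w1 M (imF F).

Lemma lipC_ge0 M F : lipC M F -> 0 <= M.
Proof. by move=> [p _]; exact: (lip_ge0 (w1_gt0 _) p). Qed.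

Lemma GBW_lip2 s t h M F : 0 <= s -> 0 <= h -> GBW s t h M F ->
  exists M', lip w2 M' (reF F) /\ lip w2 M' (imF F).
Proof.
move=> s0 h0 [sF a b].
exists ((1 + d%:R * (2 `^ s * h) * (4 ^+ d) ^+ 2) * M * bd s (2 `^ s * h) ([::] : seq 'I_d)).
by split; [exact: (WB_lip [::] s0 h0 sF.1 (RBW_WB a))|exact: (WB_lip [::] s0 h0 sF.2 (RBW_WB b))].
Qed.

Lemma T_lip2 sig s t F : 0 < s -> 0 < t -> inGS sig s t F ->
  exists M', lip w2 M' (reF F) /\ lip w2 M' (imF F).
Proof.
move=> s0 t0 /(inGSP _ _ s0 t0)[_]; case: sig => [/(_ 1 ltr01)[M H]|[h [h0 [M H]]]];
  apply: GBW_lip2 H; exact: ltW.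
Qed.

Lemma T_lipC sig s t F : 0 < s -> 0 < t -> inGS sig s t F -> exists M, lipC M F.
Proof.
move=> s0 t0 TF; have [M [a b]] := T_lip2 s0 t0 TF; exists M.
by have M0 := lip_ge0 (w2_gt0 _) a; split; exact: lip_w21.
Qed.

Lemma IC_lin M M' (a b : C) F G : lipC M F -> lipC M' G ->
  intC (fun y => a * F y + b * G y) = a * intC F + b * intC G.
Proof.
move=> HF HG; have M0 := lipC_ge0 HF; have M'0 := lipC_ge0 HG.
move: HF HG => [p q] [p' q'].
have Q (e e' c c' : R) f g f' g' : lip w1 M f -> lip w1 M g -> lip w1 M' f' -> lip w1 M' g' ->
  intRd (fun y => (e * f y + e' * g y) + (c * f' y + c' * g' y)) =
  (e * intRd f + e' * intRd g) + (c * intRd f' + c' * intRd g').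
  move=> h1 h2 h3 h4.
  have L1 := lipD (lipZ e h1) (lipZ e' h2); have L2 := lipD (lipZ c h3) (lipZ c' h4).
  rewrite (I_add _ _ L1 L2) ?addr_ge0 ?mulr_ge0//.
  rewrite (I_add _ _ (lipZ e h1) (lipZ e' h2)) ?mulr_ge0//.
  rewrite (I_add _ _ (lipZ c h3) (lipZ c' h4)) ?mulr_ge0//.
  by rewrite (I_scale _ M0 h1) (I_scale _ M0 h2) (I_scale _ M'0 h3) (I_scale _ M'0 h4).
apply/eqP; rewrite eq_complex; apply/andP; split; apply/eqP; rewrite /intC.
  rewrite (_ : reF _ = fun y => (complex.Re a * reF F y + - complex.Im a * imF F y) +
      (complex.Re b * reF G y + - complex.Im b * imF G y)); last first.
    by apply/funext => y; rewrite /reF /imF cReD !cReM; ring.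
  by rewrite [LHS]/= Q// cReD !cReM /=; ring.
rewrite (_ : imF _ = fun y => (complex.Re a * imF F y + complex.Im a * reF F y) +
      (complex.Re b * imF G y + complex.Im b * reF G y)); last first.
  by apply/funext => y; rewrite /reF /imF cImD !cImM; ring.
by rewrite [LHS]/= Q// cImD !cImM /=; ring.
Qed.

Lemma IC_bound M (m : R) F : lipC M F -> (forall x, cabs (F x) <= m * w1 x) ->
  cabs (intC F) <= 2 * m * @CI R d.
Proof.
move=> HF H; have M0 := lipC_ge0 HF; move: HF => [p q].
apply: le_trans (cabs_le _) _; rewrite /intC /=.
have h1 : `|intRd (reF F)| <= m * @CI R d.
  by apply: I_bound M0 p _ => x; apply: le_trans (H x); exact: cabs_re.
have h2 : `|intRd (imF F)| <= m * @CI R d.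
  by apply: I_bound M0 q _ => x; apply: le_trans (H x); exact: cabs_im.
by apply: le_trans (lerD h1 h2) _; apply: le_eq; ring.
Qed.

Lemma IC_shift M c F : lipC M F -> intC (fun y => F (y + c)) = intC F.
Proof.
move=> HF; have M0 := lipC_ge0 HF; move: HF => [p q].
by rewrite /intC; congr (_ +i* _)%C; [exact: (I_shift c M0 p)|exact: (I_shift c M0 q)].
Qed.

End TestSpace.

(** * Discrete Fourier coefficients of a periodic distribution *)

Section Dft.
Local Open Scope ring_scope.
Local Open Scope classical_set_scope.
Context {R : realType} {d : nat}.
Local Notation ivec := 'rV[int]_d.
Local Notation vec := 'rV[R]_d.
Local Notation C := R[i].
Implicit Types (k m q : ivec) (x y z b : vec) (F G psi : vec -> C) (n K : nat) (e : R).

(** Odd, so that the symmetric box of radius [n] is a complete system of residues modulo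
    [2 n + 1]. *)
Definition gridN n : R := (n.*2.+1)%:R.
Lemma gridN_ge1 n : 1 <= gridN n. Proof. by rewrite /gridN ler1n. Qed.
Lemma gridN_gt0 n : 0 < gridN n. Proof. exact: lt_le_trans ltr01 (gridN_ge1 n). Qed.
Lemma gridN_large (A : R) : exists n0, forall n, (n0 <= n)%N -> A <= gridN n.
Proof.
exists (Num.truncn `|A|).+1 => n hn; apply: le_trans (ler_norm A) _.
apply: le_trans (ltW (truncnS_gt _)) _; rewrite /gridN ler_nat.
by apply: leq_trans hn _; rewrite -addnn; lia.
Qed.

Lemma RcX (a : R) n : Rc (a ^+ n) = Rc a ^+ n :> C.
Proof. by elim: n => [|n IH]; rewrite ?expr0// !exprS RcM IH. Qed.

Lemma cReN (z : C) : complex.Re (- z) = - complex.Re z.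
Proof. by case: z. Qed.
Lemma cImN (z : C) : complex.Im (- z) = - complex.Im z.
Proof. by case: z. Qed.

Lemma ler_sum_in (T : eqType) (r : seq T) (f g : T -> R) :
  (forall i, i \in r -> f i <= g i) -> \sum_(i <- r) f i <= \sum_(i <- r) g i.
Proof. by move=> H; rewrite big_seq [leRHS]big_seq; apply: ler_sum. Qed.

Definition idot m k : int := \sum_(j < d) m 0 j * k 0 j.

Lemma inner_mulmx x y (A : 'M[R]_d) : inner (x *m A) y = inner x (y *m A^T).
Proof.
rewrite /inner.
under eq_bigr => j _ do rewrite mxE mulr_suml.
rewrite exchange_big /=; apply: eq_bigr => i _; rewrite mxE mulr_sumr.
by apply: eq_bigr => j _; rewrite mxE; ring.
Qed.

Lemma inner_latt (B : 'M[R]_d) m k : B \in unitmx ->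
  inner (latt B m) (dlatt B k) = 2 * pi * (idot m k)%:~R.
Proof.
move=> uB; rewrite /latt /dlatt inner_mulmx -mulmxA -scalemxAl -trmx_mul mulmxV// trmx1.
rewrite -scalemxAr mulmx1 /inner /idot rmorph_sum mulr_sumr; apply: eq_bigr => j _.
by rewrite !mxE rmorphM /=; ring.
Qed.

Lemma inner_grid_pt (B : 'M[R]_d) (N : R) m k : B \in unitmx ->
  inner (grid_pt B N m) (dlatt B k) = 2 * pi * (idot m k)%:~R / N.
Proof. by move=> uB; rewrite /grid_pt innerZl inner_latt//; ring. Qed.

Lemma cexpi_neq1 (th : R) : th != 0 -> `|th| <= pi -> cexpi th != 1 :> C.
Proof.
move=> t0 tp; apply/eqP => E.
have c1 : cos th = 1 by have := congr1 (@complex.Re R) E.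
have := cos_ub tp; rewrite c1 subrr => h.
have : 0 < th ^+ 2 by rewrite exprn_even_gt0.
by lra.
Qed.

Lemma abs_freq n (a : int) : (`|a| <= n)%N -> `|2 * pi * a%:~R / gridN n| <= pi :> R.
Proof.
move=> an; have N0 := gridN_gt0 n; have p0 := pi_gt0 R.
rewrite (_ : 2 * pi * a%:~R / gridN n = (2 * pi / gridN n) * a%:~R); last by ring.
have q0 : 0 <= 2 * pi / gridN n by rewrite divr_ge0 ?(ltW N0)// mulr_ge0// ltW.
rewrite normrM (ger0_norm q0) -intr_norm mulrAC ler_pdivrMr//.
have h : (`|a|%:~R : R) <= n%:~R by rewrite ler_int; lia.
have : gridN n = 2 * n%:~R + 1 by rewrite /gridN -addn1 natrD -muln2 natrM -pmulrn mulrC.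
by nra.
Qed.

Lemma geom1 n (a : int) : (`|a| <= n)%N ->
  \sum_(i < n.*2.+1) cexpi (- (2 * pi * (a * ((i : nat)%:Z - n%:Z))%:~R / gridN n)) =
  (if a == 0 then Rc (gridN n) else 0) :> C.
Proof.
move=> an; have N0 := gridN_gt0 n; case: eqP => [->|/eqP a0].
  under eq_bigr => i _ do rewrite mul0r mulr0 mul0r oppr0 cexpi0.
  rewrite -[1]/(Rc 1) -Rc_sum; congr Rc.
  by rewrite sumr_const card_ord.
pose th : R := - (2 * pi * a%:~R / gridN n).
have thE (i : nat) : - (2 * pi * (a * (i%:Z - n%:Z))%:~R / gridN n) = th *+ i + - (th *+ n).
  have -> : ((a * (i%:Z - n%:Z))%:~R : R) = a%:~R * (i%:R - n%:R) by rewrite intrM intrB -!pmulrn.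
  rewrite -(mulr_natr th i) -(mulr_natr th n) /th.
  move: (gridN n) N0 (i%:R : R) (n%:R : R) (a%:~R : R) => N N0 i' n' a'.
  by field; rewrite gt_eqF.
under eq_bigr => i _ do rewrite thE cexpiD cexpi_mulrn.
rewrite -mulr_suml.
have q1 : cexpi th != 1 :> C.
  apply: cexpi_neq1.
    rewrite /th oppr_eq0; apply: mulf_neq0; last by rewrite invr_eq0 gt_eqF.
    apply: mulf_neq0; last by rewrite intr_eq0.
    by rewrite gt_eqF// mulr_gt0// pi_gt0.
  by rewrite /th normrN; exact: abs_freq.
have : (cexpi th - 1) * \sum_(i < n.*2.+1) cexpi th ^+ i = 0 :> C.
  rewrite -subrX1 -cexpi_mulrn -mulr_natr /th -[X in _ * X]/(gridN n).
  have -> : - (2 * pi * a%:~R / gridN n) * gridN n = 2 * pi * (- a)%:~R.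
    by rewrite rmorphN /=; field; rewrite gt_eqF.
  by rewrite cexpi_int subrr.
by move/eqP; rewrite mulf_eq0 subr_eq0 (negbTE q1) /= => /eqP ->; rewrite mul0r.
Qed.

Lemma orthog n m : m \in zbox n ->
  \sum_(k <- zbox n) cexpi (- (2 * pi * (idot m k)%:~R / gridN n)) =
  (if m == 0 then Rc (gridN n) ^+ d else 0) :> C.
Proof.
rewrite mem_zbox => /forallP mn; rewrite -bsumE.
pose F (j : 'I_d) (i : 'I_(n.*2.+1)) : C :=
  cexpi (- (2 * pi * (m 0 j * ((i : nat)%:Z - n%:Z))%:~R / gridN n)).
transitivity (\sum_(f : {ffun 'I_d -> 'I_(n.*2.+1)}) \prod_j F j (f j)).
  apply: eq_bigr => f _; rewrite /F -cexpi_sum; congr cexpi.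
  rewrite sumrN; congr (- _); rewrite /idot rmorph_sum mulr_sumr mulr_suml.
  by apply: eq_bigr => j _; rewrite mxE.
rewrite -(bigA_distr_bigA F).
under eq_bigr => j _ do rewrite /F geom1//.
case: (eqVneq m 0) => [->|m0].
  under eq_bigr => j _ do rewrite mxE eqxx.
  by rewrite prodr_const card_ord.
have [j mj] : exists j, m 0 j != 0.
  apply/existsP; rewrite -negb_forall; apply: contra m0 => /forallP H.
  by apply/eqP/rowP => j; rewrite mxE; apply/eqP; exact: H.
by rewrite (bigD1 j)//= (negbTE mj) mul0r.
Qed.

(** The box is a complete residue system, so a translation permutes its residue classes. *)
Lemma bsum_shift (V : zmodType) n (h : ivec -> V) m0 :
  (forall m q, h (m + (n.*2.+1)%:Z *: q) = h m) ->
  \sum_(m <- zbox n) h (m + m0) = \sum_(m <- zbox n) h m.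
Proof.
move=> hp; rewrite -!bsumE.
pose a (j : 'I_d) : int := m0 0 j.
(* Residues of [m0]. Addition of ordinals is modulo [2 n + 1] and thus permutes the box; [q] below
   records the carries. *)
pose c : {ffun 'I_d -> 'I_(n.*2.+1)} := [ffun j => inord `|(a j %% (n.*2.+1)%:Z)%Z|%N].
rewrite [RHS](reindex_inj (addIr c)) /=; apply: eq_bigr => f _.
pose q : ivec := \row_j (((boxpt f + m0) ord0 j - boxpt (f + c) ord0 j) %/ (n.*2.+1)%:Z)%Z.
rewrite -(hp (boxpt (f + c)) q); congr h; apply/rowP => j.
have cj : (c j : nat) = `|(a j %% (n.*2.+1)%:Z)%Z|%N.
  rewrite ffunE inordK// -ltz_nat gez0_abs ?modz_ge0//; exact: ltz_pmod.
have cz : (c j : nat)%:Z = (a j %% (n.*2.+1)%:Z)%Z by rewrite cj gez0_abs ?modz_ge0.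
have key (X Y w : int) : X - Y = w * (n.*2.+1)%:Z -> X = Y + (n.*2.+1)%:Z * ((X - Y) %/ (n.*2.+1)%:Z)%Z.
  by move=> E; rewrite E mulzK// [_ * w]mulrC -E addrC subrK.
have E1 := divz_eq (a j) (n.*2.+1)%:Z; have E2 := divn_eq (f j + c j) n.*2.+1.
rewrite [RHS]mxE [X in _ = _ + X]mxE [q 0 j]mxE.
apply: (key _ _ ((a j %/ (n.*2.+1)%:Z)%Z + ((f j + c j) %/ n.*2.+1)%N%:Z)).
rewrite mxE [boxpt _ _ _]mxE [boxpt (f + c) _ _]mxE ffunE /=.
rewrite -[m0 _ _]/(a j) {1}E1 -cz.
have /(congr1 Posz) := E2; rewrite !PoszD PoszM /=.
move=> E3; rewrite mulrDl.
rewrite [X in _ = _ + X](_ : _ = (f j)%:Z + (c j)%:Z - ((f j + c j) %% n.*2.+1)%N%:Z); first by ring.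
by rewrite E3 addrK.
Qed.

End Dft.

Section Ultra.
Local Open Scope ring_scope.
Local Open Scope classical_set_scope.
Context {R : realType}.

(** A single ultrafilter gives limits to all coefficient sequences simultaneously, without
    extracting a diagonal subsequence. *)
Lemma ultra_limit : exists U : set (set nat),
  [/\ (forall n0, U [set n | (n0 <= n)%N]), (forall A D, U A -> U D -> U (A `&` D)),
   (forall A, U A -> exists n, A n) &
   forall (v : nat -> R) (M : R), (forall n, `|v n| <= M) ->
     exists2 L : R, `|L| <= M & forall e : R, 0 < e -> U [set n | `|v n - L| <= e]].
Proof.
have [U [UU sub]] := ultraFilterLemma eventually_filter.
exists U; split.
- by move=> n0; apply: sub; exists n0.
- by move=> A D; exact: filterI.
- by move=> A UA; exact: (filter_ex UA).
move=> v M vM.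
have segU : (v @ U) `[- M, M].
  rewrite /= /fmap /= (_ : _ @^-1` _ = setT); first exact: filterT.
  by apply/seteqP; split=> // n _ /=; rewrite in_itv /= -ler_norml.
have [L [LM cl]] := @segment_compact R (- M) M (v @ U) _ segU.
exists L; first by move: LM; rewrite /= in_itv /= -ler_norml.
(* An ultrafilter contains this set or its complement, and the complement is excluded because [L] is
   a cluster point. *)
move=> e e0; case: (in_ultra_setVsetC [set n | `|v n - L| <= e] UU) => // UC.
have UC' : (v @ U) [set x | ~ `|x - L| <= e] by [].
have nb : nbhs L (ball L e) by exact: nbhsx_ballx.
have [x [/= xa]] := cl _ _ UC' nb.
by rewrite /ball /= distrC => /ltW.
Qed.

End Ultra.

(** * Fourier expansion of a periodic distribution *)

Section Coeff.
Local Open Scope ring_scope.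
Local Open Scope classical_set_scope.
Context {R : realType} {d : nat}.
Local Notation ivec := 'rV[int]_d.
Local Notation vec := 'rV[R]_d.
Local Notation C := R[i].
Implicit Types (k m q : ivec) (x y z b : vec) (F G H psi g : vec -> C) (n K : nat) (e s t h M : R)
  (l : seq 'I_d).
Variables (B : 'M[R]_d) (sig : bool) (s t : R) (u : (vec -> C) -> C).
Hypotheses (uB : B \in unitmx) (s0 : 0 < s) (t0 : 0 < t)
  (lu : GSlinear sig s t u) (cu : GScont sig s t u)
  (pu : periodic_dist B (inGS sig s t) u).
Local Notation T := (inGS sig s t).
Local Notation gn n := (grid_pt B (gridN n)).
Local Notation al k := (dlatt B k).

(* The discrete Fourier coefficient of the periodic function [z |-> u (psi (. - z))] sampled
   on the refined lattice. *)
Definition aN n k psi : C := Rc (gridN n ^- d) *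
  \sum_(m <- zbox n) u (fun y => psi (y - gn n m)) * cexpi (- inner (gn n m) (al k)).

Lemma T_shiftB psi c : T psi -> T (fun y => psi (y - c)).
Proof. exact: T_shift. Qed.

Lemma norm_gn n m : m \in zbox n -> `|gn n m| <= mxn B.
Proof.
rewrite mem_zbox => /forallP mn; rewrite /grid_pt normrZ normfV ger0_norm ?(ltW (gridN_gt0 n))//.
rewrite mulrC ler_pdivrMr ?gridN_gt0//; apply: le_trans (norm_mulmx _ _) _.
rewrite ler_wpM2l ?mxn_ge0//; apply: vnorm_le => [|j]; first by rewrite ltW ?gridN_gt0.
rewrite mxE -intr_norm; apply: (@le_trans _ _ (n%:~R : R)); first by rewrite ler_int; have := mn j; lia.
by rewrite -pmulrn /gridN ler_nat; lia.
Qed.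

Lemma gn0 n : gn n 0 = 0.
Proof. by rewrite /grid_pt /latt (_ : intvec 0 = 0) ?mul0mx ?scaler0//; apply/rowP => j; rewrite !mxE. Qed.

(** Discrete Fourier inversion at the point 0: by [orthog] only the sample at [m = 0] survives. *)
Lemma aN_sum n psi : T psi -> \sum_(k <- zbox n) aN n k psi = u psi.
Proof.
move=> Tp; rewrite -mulr_sumr exchange_big /=.
under eq_big_seq => m mb.
  rewrite -mulr_sumr.
  under eq_bigr => k _ do rewrite inner_grid_pt//.
  rewrite orthog//.
over.
have b0 : (0 : ivec) \in zbox n by rewrite mem_zbox; apply/forallP => j; rewrite mxE.
rewrite (bigD1_seq 0)//= ?uniq_zbox// big1 ?addr0; last by move=> m /negbTE ->; rewrite mulr0.
rewrite eqxx gn0 mulrC -mulrA -RcX -RcM.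
rewrite mulfV ?Rc1 ?mulr1; last by rewrite expf_neq0// gt_eqF ?gridN_gt0.
by congr u; apply/funext => y; rewrite subr0.
Qed.

Lemma latt_gn n q : gn n ((n.*2.+1)%:Z *: q) = latt B q.
Proof.
rewrite /grid_pt /latt (_ : intvec _ = gridN n *: intvec q).
  by rewrite -scalemxAl scalerA mulVf ?scale1r// gt_eqF ?gridN_gt0.
by apply/rowP => j; rewrite !mxE intrM -pmulrn.
Qed.

Lemma idot_shift m q k a : idot (m + a *: q) k = idot m k + a * idot q k.
Proof.
by rewrite /idot mulr_sumr -big_split /=; apply: eq_bigr => j _; rewrite !mxE; ring.
Qed.

(** By periodicity of [u] the summand depends on [m] modulo [2 n + 1] only, so the sum may be
    recentred by [bsum_shift], which leaves a phase. *)
Lemma aN_shift n k m0 psi : T psi ->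
  aN n k (fun y => psi (y - gn n m0)) = cexpi (inner (gn n m0) (al k)) * aN n k psi.
Proof.
move=> Tp; pose h m := u (fun y => psi (y - gn n m)) * cexpi (- inner (gn n m) (al k)).
have hp m q : h (m + (n.*2.+1)%:Z *: q) = h m.
  rewrite /h; congr (_ * _).
    rewrite -(pu q (T_shiftB (gn n m) Tp)); congr u; apply/funext => y.
    by rewrite grid_ptD latt_gn opprD addrA [y - _ - _]addrAC.
  rewrite !inner_grid_pt// idot_shift intrD intrM -pmulrn -/(gridN n).
  rewrite (_ : - (2 * pi * _ / _) = - (2 * pi * (idot m k)%:~R / gridN n) + 2 * pi * (- idot q k)%:~R).
    by rewrite cexpiD cexpi_int mulr1.
  by rewrite rmorphN /=; field; rewrite gt_eqF ?gridN_gt0.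
rewrite /aN mulrCA; congr (_ * _); rewrite -[in RHS](bsum_shift m0 hp) mulr_sumr.
apply: eq_bigr => m _; rewrite /h [RHS]mulrCA; congr (_ * _).
  by congr u; apply/funext => y; rewrite grid_ptD opprD addrA addrAC.
by rewrite -cexpiD grid_ptD innerDl; congr cexpi; ring.
Qed.

Lemma aN_bound n k H (Q : R) : (forall m, m \in zbox n -> cabs (u (fun y => H (y - gn n m))) <= Q) ->
  cabs (aN n k H) <= Q.
Proof.
move=> hQ; rewrite /aN cabsM cabs_Rc; have N0 : 0 < gridN n :> R := gridN_gt0 n.
have Nd : 0 < gridN n ^+ d :> R by rewrite exprn_gt0.
rewrite ger0_norm ?invr_ge0 ?(ltW Nd)// mulrC ler_pdivrMr//.
apply: le_trans (cabs_sum _ _) _.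
apply: (@le_trans _ _ (\sum_(m <- zbox n) Q)).
  by apply: ler_sum_in => m mb; rewrite cabsM cabs_cexpi mulr1 hQ.
rewrite big_const_seq count_predT size_zbox iter_addr_0 -mulr_natr /gridN -natrX.
by [].
Qed.

Lemma aN_lin n k (a b : C) F G : T F -> T G ->
  aN n k (fun y => a * F y + b * G y) = a * aN n k F + b * aN n k G.
Proof.
move=> TF TG; rewrite /aN [a * _]mulrCA [b * _]mulrCA -mulrDr; congr (_ * _).
rewrite !mulr_sumr -big_split /=; apply: eq_bigr => m _.
by rewrite lu ?mulrDl ?mulrA//; exact: T_shiftB.
Qed.

Lemma aN_Z n k (a : C) F : T F -> aN n k (fun y => a * F y) = a * aN n k F.
Proof.
move=> TF; have := aN_lin n k a 0 TF TF; rewrite mul0r addr0 => <-.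
by congr aN; apply/funext => y; rewrite mul0r addr0.
Qed.

Lemma aN_D n k F G : T F -> T G -> aN n k (fun y => F y + G y) = aN n k F + aN n k G.
Proof.
move=> TF TG; have := aN_lin n k 1 1 TF TG; rewrite !mul1r => <-.
by congr aN; apply/funext => y; rewrite !mul1r.
Qed.

Lemma aN_bigsum n k (I : Type) (r : seq I) (F : I -> vec -> C) G : T G ->
  (forall i, T (F i)) -> aN n k (fun y => \sum_(i <- r) F i y) = \sum_(i <- r) aN n k (F i).
Proof.
move=> TG TF; elim: r => [|i r IH].
  have E := aN_Z n k 0 TG; rewrite mul0r in E; rewrite big_nil -[RHS]E.
  by congr aN; apply/funext => y; rewrite big_nil mul0r.
rewrite big_cons -IH -aN_D//; last exact: T_sum TG TF.
by congr aN; apply/funext => y; rewrite big_cons.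
Qed.

(** The sampling points have norm at most [mxn B] whatever [n] is, so translating [H] costs a factor
    2 on the scale and a constant independent of [n] and [k]. *)
Lemma aN_pick F G (A : R) : T F -> T G -> 0 < A ->
  exists h M (K : R), [/\ 0 < h, 0 <= K, GBW s t h M F, GBW s t h M G &
   forall n k H M', T H -> GBW s t (A * h) M' H -> cabs (aN n k H) <= K * M'].
Proof.
move=> TF TG A0; have [|h [M [K [h0 K0 bF bG HK]]]] := GS_pick (A := 2 * A) s0 t0 cu TF TG.
  by rewrite mulr_gt0.
have Ah : 0 < A * h by rewrite mulr_gt0.
have [E E0 HE] := GBW_shift (d := d) s t0 Ah (mxn_ge0 B).
exists h, M, (K * E); split=> //; first by rewrite mulr_ge0.
move=> n k H M' TH bH; apply: aN_bound => m mb.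
have M'0 := GBW_ge0 bH.
have zb : `|- gn n m| <= mxn B by rewrite normrN norm_gn.
have [_ r1 r2] := HE M' H _ bH zb.
have hh : 0 <= 2 * (A * h) by rewrite mulr_ge0// ltW.
have r3 := RBW_RB hh (RBW_ge0 r1) r1; have r4 := RBW_RB hh (RBW_ge0 r2) r2.
rewrite mulrA in r3 r4; rewrite -mulrA.
by apply: HK => //; exact: T_shiftB.
Qed.

Definition sdC (b : vec) e F : vec -> C := fun y =>
  Rc (e ^- 2) * (Rc 2 * F y + - (F (y + e *: b) + F (y - e *: b))).

Lemma re_sdC b e F : reF (sdC b e F) = sdiff b e (reF F).
Proof.
by apply/funext => y; rewrite /reF /sdiff /sdC /=; case: (F y) (F (y + _)) (F (y - _)) => [? ?] [? ?] [? ?] /=; ring.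
Qed.

Lemma im_sdC b e F : imF (sdC b e F) = sdiff b e (imF F).
Proof.
by apply/funext => y; rewrite /imF /sdiff /sdC /=; case: (F y) (F (y + _)) (F (y - _)) => [? ?] [? ?] [? ?] /=; ring.
Qed.

Lemma T_sdC b e F : T F -> T (sdC b e F).
Proof.
move=> TF; apply: T_scale => //.
rewrite (_ : (fun y => _) = fun y => Rc 2 * F y + (-1) * (F (y + e *: b) + F (y - e *: b))); last first.
  by apply/funext => y; rewrite mulN1r.
by apply: T_lin => //; apply: T_add => //; exact: T_shift.
Qed.

(* [Dj] multiplies [aN n k] by [1 + sd_symbol n k j >= 1 + k_j ^ 2], whence the decay of [aN]
   in [k]. *)
Definition Dj n (j : 'I_d) F : vec -> C := fun y => F y + sdC (latt B (delta_mx 0 j)) (gridN n)^-1 F y.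
Definition Ds n l F : vec -> C := foldr (Dj n) F l.

Lemma T_Ds n l F : T F -> T (Ds n l F).
Proof. by elim: l => //= j l IH TF; apply: T_add => //; [exact: IH|apply: T_sdC; exact: IH]. Qed.

Lemma norm_lattej j : `|latt B (delta_mx 0 j)| <= mxn B.
Proof.
apply: le_trans (norm_mulmx _ _) _; apply: ler_piMr; first exact: mxn_ge0.
apply: vnorm_le => // i; rewrite !mxE eqxx /=.
by case: eqP => _; rewrite ?normr1 ?normr0.
Qed.

Lemma GBW_Ds l h : 0 < h -> exists2 E : R, 0 <= E & forall n M F, GBW s t h M F ->
  GBW s t ((2 `^ s + 2) ^+ size l * h) (E * M) (Ds n l F).
Proof.
move=> h0; elim: l => [|j l [E E0 IH]].
  by exists 1 => // n M F; rewrite expr0 !mul1r.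
have a0 : 1 <= 2 `^ s + 2 :> R by have := powR_ge0 2 s; lra.
have a1 : 0 < 2 `^ s + 2 :> R by lra.
pose h' := (2 `^ s + 2) ^+ size l * h.
have h'0 : 0 < h' by rewrite mulr_gt0// exprn_gt0.
have [E' E'0 HE] := RBW_sdiff (d := d) (ltW s0) t0 h'0 (mxn_ge0 B).
exists (E + E' * E); first by rewrite addr_ge0// mulr_ge0.
move=> n M F bF; have M0 := GBW_ge0 bF.
have [[s1 s2] b1 b2] := IH n M F bF.
have i0 : 0 < (gridN n)^-1 :> R by rewrite invr_gt0 gridN_gt0.
have i1 : (gridN n)^-1 <= 1 :> R by rewrite invf_le1 ?gridN_gt0// gridN_ge1.
have hh : h' <= (2 `^ s + 2) ^+ size (j :: l) * h.
  by rewrite /= exprS -mulrA ler_peMl// ltW.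
have EM : 0 <= E * M by rewrite mulr_ge0.
have P f : smoothR f -> RBW s t h' (E * M) f ->
  RBW s t ((2 `^ s + 2) ^+ size (j :: l) * h) ((E + E' * E) * M)
    (fun y => f y + sdiff (latt B (delta_mx 0 j)) (gridN n)^-1 f y).
  move=> sf bf; rewrite mulrDl -mulrA; apply: RBWD => //; first exact: smooth_sdiff.
    by apply: RBW_mono bf => //; exact: ltW.
  by rewrite /= exprS -mulrA; apply: HE => //; exact: norm_lattej.
split.
- rewrite /= /Dj; split.
    rewrite (_ : reF _ = fun y => reF (Ds n l F) y + sdiff (latt B (delta_mx 0 j)) (gridN n)^-1 (reF (Ds n l F)) y).
      by apply: smoothD => //; exact: smooth_sdiff.
    by rewrite -re_sdC; apply/funext => y; rewrite /reF cReD.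
  rewrite (_ : imF _ = fun y => imF (Ds n l F) y + sdiff (latt B (delta_mx 0 j)) (gridN n)^-1 (imF (Ds n l F)) y).
    by apply: smoothD => //; exact: smooth_sdiff.
  by rewrite -im_sdC; apply/funext => y; rewrite /imF cImD.
- rewrite (_ : reF _ = fun y => reF (Ds n l F) y + sdiff (latt B (delta_mx 0 j)) (gridN n)^-1 (reF (Ds n l F)) y).
    exact: P.
  by rewrite -re_sdC; apply/funext => y; rewrite /reF cReD.
- rewrite (_ : imF _ = fun y => imF (Ds n l F) y + sdiff (latt B (delta_mx 0 j)) (gridN n)^-1 (imF (Ds n l F)) y).
    exact: P.
  by rewrite -im_sdC; apply/funext => y; rewrite /imF cImD.
Qed.

Lemma idot_delta j k : idot (delta_mx 0 j) k = k 0 j.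
Proof.
rewrite /idot (bigD1 j)//= big1 ?addr0; first by rewrite mxE !eqxx mul1r.
by move=> i /negbTE ij; rewrite mxE ij andbF mul0r.
Qed.

Lemma idotN m k : idot (- m) k = - idot m k.
Proof. by rewrite /idot -sumrN; apply: eq_bigr => j _; rewrite !mxE mulNr. Qed.

Definition sd_symbol n k j : R := gridN n ^+ 2 * (2 - 2 * cos (2 * pi * (k 0 j)%:~R / gridN n)).

Lemma aN_sdC n k j F : T F ->
  aN n k (sdC (latt B (delta_mx 0 j)) (gridN n)^-1 F) = Rc (sd_symbol n k j) * aN n k F.
Proof.
move=> TF; have N0 : 0 < gridN n :> R := gridN_gt0 n.
rewrite (_ : sdC _ _ F = fun y => Rc (gridN n ^+ 2) * (Rc 2 * F y +
   (-1) * (F (y - gn n (- delta_mx 0 j)) + F (y - gn n (delta_mx 0 j))))); last first.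
  by apply/funext => y; rewrite /sdC grid_ptN opprK /grid_pt exprVn invrK mulN1r.
have T1 : T (fun y => F (y - gn n (- delta_mx 0 j)) + F (y - gn n (delta_mx 0 j))).
  by apply: T_add => //; exact: T_shiftB.
rewrite aN_Z; last by apply: T_lin.
rewrite aN_lin// aN_D; try exact: T_shiftB.
rewrite !aN_shift// !inner_grid_pt// idotN idot_delta.
rewrite (_ : 2 * pi * (- k 0 j)%:~R / gridN n = - (2 * pi * (k 0 j)%:~R / gridN n)); last first.
  by rewrite rmorphN /=; ring.
rewrite /sd_symbol; set th := 2 * pi * _ / _; rewrite RcM -mulrA; congr (_ * _).
rewrite -mulrDl mulrA -mulrDl; congr (_ * _).
apply/eqP; rewrite eq_complex /= cosN sinN; apply/andP; split; apply/eqP; ring.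
Qed.

(** For [k] in the box the frequency stays in the range of [cos_ub], and the resulting constant
    [pi^2 / 4] is at least 1. *)
Lemma sd_symbol_ge n k j : k \in zbox n -> 1 + ((k 0 j)%:~R : R) ^+ 2 <= 1 + sd_symbol n k j.
Proof.
rewrite mem_zbox => /forallP /(_ j) kj; rewrite lerD2l /sd_symbol; have N0 : 0 < gridN n :> R := gridN_gt0 n.
have := @cos_ub R _ (abs_freq kj); set th := 2 * pi * _ / _ => h.
have E : gridN n ^+ 2 * (th ^+ 2 / 32 * 2) = (pi ^+ 2 / 4) * ((k 0 j)%:~R) ^+ 2 :> R.
  by rewrite /th; field; rewrite gt_eqF.
apply: (@le_trans _ _ (gridN n ^+ 2 * (th ^+ 2 / 32 * 2))).
  rewrite E ler_peMl ?sqr_ge0//.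
  have : 2 <= pi :> R by exact: pi_ge2.
  by rewrite expr2; nra.
rewrite ler_wpM2l ?sqr_ge0//; lra.
Qed.

Lemma aN_Ds n k l F : T F ->
  aN n k (Ds n l F) = Rc (\prod_(j <- l) (1 + sd_symbol n k j)) * aN n k F.
Proof.
move=> TF; elim: l => [|j l IH]; first by rewrite big_nil Rc1 mul1r.
rewrite /= big_cons RcM -mulrA -IH /Dj aN_D; [|exact: T_Ds|apply: T_sdC; exact: T_Ds].
by rewrite aN_sdC ?RcD ?Rc1 ?mulrDl ?mul1r//; exact: T_Ds.
Qed.

(** [Dj] is applied once in each direction. Its symbols multiply to at least [1 / omega 1 k], while
    the seminorms of [Ds n l F] stay bounded in [n]; hence [D] does not depend on [n]. *)
Lemma aN_omega F : T F -> exists2 D : R, 0 <= D & forall n k, k \in zbox n ->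
  cabs (aN n k F) <= D * omega 1 k.
Proof.
move=> TF; pose l := enum 'I_d.
have a1 : 0 < (2 `^ s + 2) ^+ size l :> R by rewrite exprn_gt0//; have := powR_ge0 2 s; lra.
have [h [M [Q [h0 Q0 bF _ HQ]]]] := aN_pick TF TF a1.
have [E E0 HE] := GBW_Ds l h0; have M0 := GBW_ge0 bF.
exists (Q * (E * M)); first by rewrite mulr_ge0// mulr_ge0.
move=> n k kb; have := HQ n k _ _ (T_Ds n l TF) (HE n M F bF).
rewrite aN_Ds// cabsM cabs_Rc /l big_enum /=.
set P := \prod_(j < d) _ => h1.
have PP : (omega 1 k)^-1 <= P.
  rewrite /omega -prodfV /P; apply: ler_prod => j _; rewrite /rho1 divr1 invrK sd_symbol_ge// andbT.
  by rewrite addr_ge0 ?sqr_ge0.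
have om0 : 0 < omega 1 k :> R by rewrite prodr_gt0// => j _; exact: rho1_gt0.
rewrite -ler_pdivrMr//; apply: le_trans h1; rewrite mulrC ler_wpM2r ?cabs_ge0//.
exact: le_trans PP (ler_norm _).
Qed.

Definition chi k : vec -> C := fun y => cexpi (inner y (al k)).
Definition conv_errC n K psi G : vec -> C := fun y =>
  psi y * (Rc (gridN n ^- d) * \sum_(m <- zbox K) G (y - gn n m) + - (Rc (kap B (gridN n)) * intC G)).

Lemma T_chi k psi : T psi -> T (fun y => psi y * chi k y).
Proof.
by move=> Tp; have := T_mod s0 t0 (al k) 0 Tp; congr T; apply/funext => y; rewrite addr0.
Qed.

Lemma T_conv_errC n K psi G : T psi -> T G -> T (conv_errC n K psi G).
Proof.
move=> Tp TG.
have T1 (a : C) : T (fun y => a * psi y) by exact: T_scale.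
have T2 : T (fun y => \sum_(m <- zbox K) G (y - gn n m)).
  by apply: (T_sum s0 t0 _ TG) => m; exact: T_shiftB.
rewrite (_ : conv_errC _ _ _ _ = fun y => psi y * (Rc (gridN n ^- d) * \sum_(m <- zbox K) G (y - gn n m)) +
    - (Rc (kap B (gridN n)) * intC G) * psi y).
  by apply: T_add => //; apply: T_mul => //; exact: T_scale.
by apply/funext => y; rewrite /conv_errC mulrDr [X in _ + X]mulrC.
Qed.

Lemma re_conv_errC n K psi G : reF (conv_errC n K psi G) = fun y =>
  conv_err B (gridN n) K (reF psi) (reF G) y + -1 * conv_err B (gridN n) K (imF psi) (imF G) y.
Proof.
apply/funext => y; have -> : reF (conv_errC n K psi G) y = complex.Re (psi y * (Rc (gridN n ^- d) * \sum_(m <- zbox K) G (y - gn n m) + - (Rc (kap B (gridN n)) * intC G))) by [].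
rewrite /conv_err /intC cReM cReD cImD cReN cImN !cReM !cImM cRe_sum cIm_sum /reF /imF /=; ring.
Qed.

Lemma im_conv_errC n K psi G : imF (conv_errC n K psi G) = fun y =>
  conv_err B (gridN n) K (reF psi) (imF G) y + conv_err B (gridN n) K (imF psi) (reF G) y.
Proof.
apply/funext => y; have -> : imF (conv_errC n K psi G) y = complex.Im (psi y * (Rc (gridN n ^- d) * \sum_(m <- zbox K) G (y - gn n m) + - (Rc (kap B (gridN n)) * intC G))) by [].
rewrite /conv_err /intC cImM cReD cImD cReN cImN !cReM !cImM cRe_sum cIm_sum /reF /imF /=; ring.
Qed.

Lemma GBW_conv_errC h : 0 < h -> exists E C : R, [/\ 0 <= E, 0 <= C & exists D : R -> R,
  forall n K M M' psi G, mxn B <= gridN n -> GBW s t h M psi -> GBW s t h M' G ->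
  GBW s t (2 `^ t * (2 * (2 `^ s * h))) (E * (M * M' * (C / gridN n + D (gridN n) * @tau R d K)))
    (conv_errC n K psi G)].
Proof.
move=> h0; have [E1 E10 [D HD]] := @conv_err_bound R d B s t h uB (ltW s0) (ltW h0).
have h'0 : 0 < 2 * (2 `^ s * h) by rewrite !mulr_gt0// powR_gt0.
have [E2 E20 H2] := RB_RBW (d := d) s h'0 t0.
exists (E2 * 2), E1; split=> //; first by rewrite mulr_ge0.
exists D => n K M M' psi G Bn [[sp1 sp2] p1 p2] [[sG1 sG2] g1 g2].
have N1 : 1 <= gridN n :> R := gridN_ge1 n.
set Q := M * M' * _.
have P (f g : vec -> R) : smoothR f -> smoothR g -> RBW s t h M f -> RBW s t h M' g ->
  RB s t (2 * (2 `^ s * h)) Q (conv_err B (gridN n) K f g) by move=> *; exact: HD.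
have S (f g : vec -> R) : smoothR f -> smoothR g -> smoothR (conv_err B (gridN n) K f g) by exact: smooth_conv_err.
have Q0 := RB_ge0 (P _ _ sp1 sG1 p1 g1).
have Q2 : 0 <= 2 * Q by rewrite mulr_ge0.
have QE : 2 * Q = Q + Q by ring.
have QE' : 2 * Q = Q + `|-1| * Q by rewrite normrN1; ring.
have b1 : RB s t (2 * (2 `^ s * h)) (2 * Q) (reF (conv_errC n K psi G)).
  rewrite re_conv_errC QE'; apply: RBD; [exact: S|apply: smoothZ; exact: S|exact: P|].
  by apply: RBZ; [exact: S|exact: P].
have b2 : RB s t (2 * (2 `^ s * h)) (2 * Q) (imF (conv_errC n K psi G)).
  by rewrite im_conv_errC QE; apply: RBD; [exact: S|exact: S|exact: P|exact: P].
rewrite -mulrA; split; [|exact: H2|exact: H2].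
split; first by rewrite re_conv_errC; apply: smoothD; [exact: S|apply: smoothZ; exact: S].
by rewrite im_conv_errC; apply: smoothD; exact: S.
Qed.

Lemma zbox_opp K (V : zmodType) (a : ivec -> V) : \sum_(m <- zbox K) a (- m) = \sum_(m <- zbox K) a m.
Proof.
rewrite -(big_map (fun m => - m) xpredT a); apply: perm_big; apply: uniq_perm.
- by rewrite map_inj_uniq ?uniq_zbox//; exact: oppr_inj.
- exact: uniq_zbox.
move=> m; apply/mapP/idP => [[m' m'b ->]|mb].
  by move: m'b; rewrite !mem_zbox => /forallP H; apply/forallP => j; rewrite mxE abszN.
exists (- m); last by rewrite opprK.
by move: mb; rewrite !mem_zbox => /forallP H; apply/forallP => j; rewrite mxE abszN.
Qed.

(* [psi y * g (y - z) * chi (y - z)] is, up to the phase of [z], the translate by the grid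
   point [z] of [g y * (psi * chi) (y + z)]. *)
Lemma aN_conv n k K psi g : T psi -> T g ->
  aN n k (conv_errC n K psi (fun y => g y * chi k y)) +
    Rc (kap B (gridN n)) * intC (fun y => g y * chi k y) * aN n k psi =
  Rc (gridN n ^- d) * \sum_(m <- zbox K) aN n k (fun y => g y * (psi (y + gn n m) * chi k (y + gn n m))).
Proof.
move=> Tp Tg; have TG := T_chi k Tg; set G := fun y => g y * chi k y in TG *.
have TS m : T (fun y => psi y * G (y - gn n m)) by apply: T_mul => //; exact: T_shiftB.
have TSm : T (fun y => \sum_(m <- zbox K) psi y * G (y - gn n m)).
  by apply: (T_sum s0 t0 _ Tp).
rewrite -aN_Z// -aN_D//; [|exact: T_conv_errC|exact: T_scale].
transitivity (aN n k (fun y => Rc (gridN n ^- d) * \sum_(m <- zbox K) psi y * G (y - gn n m))).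
  by congr aN; apply/funext => y; rewrite /conv_errC -mulr_sumr; ring.
rewrite aN_Z// (aN_bigsum _ _ _ Tp)//; congr (_ * _); apply: eq_bigr => m _.
pose H y := g y * (psi (y + gn n m) * chi k (y + gn n m)).
rewrite (_ : (fun y => _) = fun y => cexpi (- inner (gn n m) (al k)) * H (y - gn n m)); last first.
  apply/funext => y; rewrite /H subrK /G /chi innerDl innerNl cexpiD; ring.
have TT : T H.
  apply: T_mul => //; apply: (T_shift s0 t0 (F := fun y => psi y * chi k y)) => //.
  exact: T_chi.
rewrite aN_Z; last exact: T_shiftB.
by rewrite aN_shift// mulrA [cexpi _ * cexpi _]mulrC cexpiNK mul1r.
Qed.

(** The right side of [aN_conv], after [m] is replaced by [- m] in the symmetric box, is the sum
    obtained when [psi] and [g] exchange their roles. *)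
Lemma aN_conv_sym n k K psi g : T psi -> T g ->
  Rc (kap B (gridN n)) * (intC (fun y => g y * chi k y) * aN n k psi - intC (fun y => psi y * chi k y) * aN n k g) =
  aN n k (conv_errC n K g (fun y => psi y * chi k y)) - aN n k (conv_errC n K psi (fun y => g y * chi k y)).
Proof.
move=> Tp Tg; set a := Rc _; set b := intC _; set c := intC _.
suff E : aN n k (conv_errC n K psi (fun y => g y * chi k y)) + a * b * aN n k psi =
   aN n k (conv_errC n K g (fun y => psi y * chi k y)) + a * c * aN n k g.
  move: E; move: (aN n k psi) (aN n k g) (aN n k (conv_errC _ _ _ _)) (aN n k (conv_errC _ _ _ _)) => p q X Y E.
  have -> : a * (b * p - c * q) = Y + a * b * p - Y - a * c * q by ring.
  by rewrite E; ring.
rewrite aN_conv//.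
rewrite (_ : _ + _ = Rc (gridN n ^- d) * \sum_(m <- zbox K) aN n k (fun y => g y * (psi (y - gn n m) * chi k (y - gn n m)))).
  congr (_ * _); rewrite -[LHS]zbox_opp; apply: eq_bigr => m _.
  by congr aN; apply/funext => y; rewrite grid_ptN.
have TG := T_chi k Tp; set G := fun y => psi y * chi k y in TG *.
have TSm : T (fun y => \sum_(m <- zbox K) g y * G (y - gn n m)).
  by apply: (T_sum s0 t0 _ Tg) => m; apply: T_mul => //; exact: T_shiftB.
rewrite -aN_Z// -aN_D//; [|exact: T_conv_errC|exact: T_scale].
rewrite (_ : (fun y => _) = fun y => Rc (gridN n ^- d) * \sum_(m <- zbox K) g y * G (y - gn n m)).
  rewrite aN_Z// (aN_bigsum _ _ _ Tg)// => m.
  by apply: T_mul => //; exact: T_shiftB.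
by apply/funext => y; rewrite /conv_errC -mulr_sumr /a /c -/G; ring.
Qed.

Lemma aN_relation k psi g : T psi -> T g -> exists2 C : R, 0 <= C & forall n, mxn B <= gridN n ->
  cabs (Rc (kap B (gridN n)) * (intC (fun y => g y * chi k y) * aN n k psi - intC (fun y => psi y * chi k y) * aN n k g))
  <= C / gridN n.
Proof.
(* From the inside: 2 for the product with [chi], [2 * 2^s] from [conv_err_bound], and [2^t] for
   regaining the weight by [RB_RBW]. *)
move=> Tp Tg; pose A := 2 `^ t * (2 * (2 `^ s * 2)) : R.
have A0 : 0 < A by rewrite /A !mulr_gt0// powR_gt0.
have [h [M [Q [h0 Q0 bp bg HQ]]]] := aN_pick Tp Tg A0.
have hh : 0 < 2 * h by rewrite mulr_gt0.
have [E [C [E0 C0 [D HD]]]] := GBW_conv_errC hh.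
have M0 := GBW_ge0 bp.
pose M1 := expt s (`|al k| / h) ^+ d * 2.
have bchi F : GBW s t h M F -> GBW s t (2 * h) (2 * (M * M1)) (fun y => F y * chi k y).
  move=> bF; have := GBW_mul (ltW s0) (ltW h0) bF (DBC_cexpi 0 s0 h0 (normr_ge0 (al k)) (lexx _)).
  by congr GBW; apply/funext => y; rewrite addr0.
have b2 F : GBW s t h M F -> GBW s t (2 * h) M F.
  by move=> bF; apply: GBW_mono bF => //; [exact: ltW|rewrite ler_peMl ?ltW// ltr1n].
have M10 : 0 <= M1 by rewrite mulr_ge0// exprn_ge0// expR_ge0.
pose W := Q * E * (M * (2 * (M * M1))).
have W0 : 0 <= W.
  apply: mulr_ge0; first exact: mulr_ge0.
  by apply: mulr_ge0 => //; apply: mulr_ge0 => //; exact: mulr_ge0.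
exists (2 * (W * C)); first by rewrite mulr_ge0// mulr_ge0.
move=> n Bn; have N0 : 0 < gridN n :> R := gridN_gt0 n.
have bnd K F G : T F -> T G -> GBW s t h M F -> GBW s t h M G ->
  cabs (aN n k (conv_errC n K F (fun y => G y * chi k y))) <= W * (C / gridN n + D (gridN n) * @tau R d K).
  move=> TF TG bF bG; have := HD n K _ _ _ _ Bn (b2 _ bF) (bchi _ bG).
  rewrite (_ : 2 `^ t * _ = A * h); last by rewrite /A; ring.
  move=> /HQ H; apply: le_trans (H n k _) _; first by apply: T_conv_errC => //; exact: T_chi.
  by apply: le_eq; rewrite /W; ring.
(* The left side does not involve the truncation, so [K0] is chosen after [n], against the possibly
   large factor [D (gridN n)]. *)
rewrite -[leRHS]addr0; apply/ler_addgt0Pr => e e0.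
pose X := 2 * (W * `|D (gridN n)|) + 1.
have X0 : 0 < X by rewrite /X ltr_wpDl// mulr_ge0// mulr_ge0.
have [K0 HK] := @tau_small R d (e / X) (divr_gt0 e0 X0).
have tK := HK K0 (leqnn _); have t0' := @tau_ge0 R d K0.
rewrite (aN_conv_sym n k K0 Tp Tg); apply: le_trans (cabsB _ _) _.
apply: le_trans (lerD (bnd K0 _ _ Tg Tp bg bp) (bnd K0 _ _ Tp Tg bp bg)) _.
rewrite addr0.
apply: (@le_trans _ _ (2 * (W * C) / gridN n + 2 * (W * (`|D (gridN n)| * (e / X))))).
  rewrite [leLHS](_ : _ = 2 * (W * C) / gridN n + 2 * (W * (D (gridN n) * @tau R d K0))); last by ring.
  rewrite lerD2l ler_wpM2l// ler_wpM2l//; apply: le_trans (ler_wpM2r t0' (ler_norm _)) _.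
  by rewrite ler_wpM2l.
rewrite lerD2l [leLHS](_ : _ = e * ((X - 1) / X)); last by rewrite /X; ring.
by apply: ler_piMr; [exact: ltW|rewrite ler_pdivrMr// mul1r gerBl].
Qed.

Lemma cabs_gt0 (z : C) : z != 0 -> 0 < cabs z.
Proof.
by move=> z0; rewrite lt_neqAle cabs_ge0 eq_sym andbT; apply: contra z0 => /eqP /cabs_eq0 ->.
Qed.

(** [kap] stays away from 0 by [kap_lb], so [aN_relation] can be divided by it and by the integral
    of [g]. *)
Lemma aN_limit k psi g : T psi -> T g -> intC (fun y => g y * chi k y) != 0 ->
  forall e, 0 < e -> exists n0, forall n, (n0 <= n)%N ->
  cabs (aN n k psi - aN n k g / intC (fun y => g y * chi k y) * intC (fun y => psi y * chi k y)) <= e.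
Proof.
move=> Tp Tg; set A := intC _; set P := intC _ => A0 e e0.
have [Q Q0 HQ] := aN_relation k Tp Tg; rewrite -/A -/P in HQ.
have [c c0 [N1 Hc]] := kap_lb uB.
have A1 := cabs_gt0 A0.
have X0 : 0 < c * cabs A * e by rewrite !mulr_gt0.
have [n0 Hn] := gridN_large (Num.max (Num.max N1 (mxn B)) (Q / (c * cabs A * e))).
exists n0 => n hn; have N0 : 0 < gridN n :> R := gridN_gt0 n.
have := Hn n hn; rewrite !ge_max => /andP[/andP[h1 h2] h3].
have kc := Hc _ h1 (gridN_ge1 n); have := HQ n h2; rewrite cabsM cabs_Rc => h4.
have k0 : 0 < kap B (gridN n) by exact: lt_le_trans kc.
rewrite (_ : aN n k psi - _ = (A * aN n k psi - P * aN n k g) / A); last first.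
  by move: (aN n k psi) (aN n k g) => p q; field.
rewrite cabsM cabsV ler_pdivrMr//.
move: h4; rewrite (ger0_norm (ltW k0)) => h4.
have h5 : c * cabs (A * aN n k psi - P * aN n k g) <= Q / gridN n.
  by apply: le_trans h4; rewrite ler_wpM2r ?cabs_ge0.
have h6 : Q / gridN n <= c * cabs A * e by rewrite ler_pdivrMr// mulrC -ler_pdivrMr.
have := le_trans h5 h6; rewrite -mulrA ler_pM2l//.
by rewrite [e * _]mulrC.
Qed.

Lemma ultra_seq (U : set (set nat)) (s' : seq ivec) (S : ivec -> set nat) :
  (forall n0, U [set n | (n0 <= n)%N]) -> (forall A D, U A -> U D -> U (A `&` D)) ->
  (forall k, U (S k)) -> forall n0, exists V, U V /\ forall n, V n ->
    (n0 <= n)%N /\ forall k, k \in s' -> S k n.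
Proof.
move=> U0 UI US n0; elim: s' => [|k s' [V [UV HV]]].
  by exists [set n | (n0 <= n)%N].
exists (V `&` S k); split; first exact: UI.
move=> n [Vn Sn]; have [h1 h2] := HV n Vn; split=> // k'; rewrite inE => /orP[/eqP ->//|].
exact: h2.
Qed.

(** The limit in [n] and the sum over [k] are exchanged by domination. Outside the box [K] the terms
    are controlled by [aN_omega] independently of [n]. Inside it, finitely many quotients must be
    close to their limits at a common [n >= K], which finite intersections in the ultrafilter
    provide. *)
Lemma representation (g : ivec -> vec -> C) : (forall k, T (g k)) ->
  (forall k, intC (fun y => g k y * chi k y) != 0) ->
  exists c : ivec -> C,
   (forall k (Q : R), (forall x, cabs (u (fun y => g k (y - x))) <= Q) ->
      cabs (c k) <= Q / cabs (intC (fun y => g k y * chi k y))) /\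
   forall psi, T psi ->
     ccvg (fun K => boxsum K (fun k => c k * intC (fun y => psi y * chi k y))) (u psi).
Proof.
move=> Tg A0; have [U [U0 UI Une Ulim]] := @ultra_limit R.
pose A k := intC (fun y => g k y * chi k y); pose b n k := aN n k (g k) / A k.
have A1 k : 0 < cabs (A k) := cabs_gt0 (A0 k).
(* [aN_pick] bounds [b n k] uniformly in [n], so its real and imaginary parts have limits along the
   ultrafilter. *)
have exc k : exists c : C, forall e : R, 0 < e -> exists V, U V /\ forall n, V n -> cabs (b n k - c) <= e.
  have [h [M [Q [h0 Q0 bF _ HQ]]]] := aN_pick (Tg k) (Tg k) ltr01.
  have bM n : cabs (b n k) <= Q * M / cabs (A k).
    rewrite cabsM cabsV ler_pM2r ?invr_gt0//; apply: HQ => //; by rewrite mul1r.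
  have [L1 _ H1] := Ulim _ _ (fun n => le_trans (cabs_re _) (bM n)).
  have [L2 _ H2] := Ulim _ _ (fun n => le_trans (cabs_im _) (bM n)).
  exists (L1 +i* L2)%C => e e0; have e2 : 0 < e / 2 by rewrite divr_gt0.
  exists ([set n | `|complex.Re (b n k) - L1| <= e / 2] `&` [set n | `|complex.Im (b n k) - L2| <= e / 2]).
  split; first by apply: UI; [exact: H1|exact: H2].
  move=> n [/= n1 n2]; apply: le_trans (cabs_le _) _.
  rewrite cReD cImD cReN cImN /=; apply: le_trans (lerD n1 n2) _.
  by apply: le_eq; field.
have [c Hc] := choice exc.
exists c; split.
  move=> k Q HQ; rewrite -/(A k); apply/ler_addgt0Pr => e e0.
  have [V [UV HV]] := Hc k e e0; have [n Vn] := Une _ UV.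
  have h1 : cabs (b n k) <= Q / cabs (A k).
    rewrite cabsM cabsV ler_pM2r ?invr_gt0//; apply: aN_bound => m _; exact: HQ.
  rewrite -[c k](subrK (b n k)) addrC; apply: le_trans (cabsD _ _) _.
  by apply: lerD => //; rewrite cabs_sub; exact: HV.
move=> psi Tp e e0; have [D D0 HD] := aN_omega Tp.
pose P k := intC (fun y => psi y * chi k y).
have e4 : 0 < e / 4 by rewrite divr_gt0.
have D1 : 0 < D + 1 by rewrite ltr_wpDl.
have [K0 HK] := @tau_small R d (e / 4 / (D + 1)) (divr_gt0 e4 D1).
exists K0 => K hK; rewrite boxsumE.
pose S := (size (@zbox d K))%:R + 1 : R.
have S0 : 0 < S by rewrite ltr_wpDl.
pose de := e / 4 / S; have de0 : 0 < de by rewrite divr_gt0.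
have ex1 k : exists V, U V /\ forall n, V n -> cabs (aN n k psi - c k * P k) <= 2 * de.
  have P0 : 0 < cabs (P k) + 1 by rewrite ltr_wpDl ?cabs_ge0.
  have [V [UV HV]] := Hc k (de / (cabs (P k) + 1)) (divr_gt0 de0 P0).
  have [n0 Hn] := aN_limit Tp (Tg k) (A0 k) de0.
  exists (V `&` [set n | (n0 <= n)%N]); split; first exact: UI.
  move=> n [Vn nn].
  have E (x y z w : C) : x - y * w = (x - z * w) + (z - y) * w by ring.
  rewrite (E _ _ (b n k)).
  apply: le_trans (cabsD _ _) _; rewrite [2 * de](_ : _ = de + de); last by ring.
  apply: lerD; first exact: Hn.
  rewrite cabsM; apply: le_trans (ler_wpM2r (cabs_ge0 _) (HV n Vn)) _.
  rewrite -mulrA ler_piMr ?(ltW de0)// mulrC ler_pdivrMr// mul1r lerDl//.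
have [W HW] := choice ex1.
have [V [UV HV]] := ultra_seq (zbox K) U0 UI (fun k => (HW k).1) K.
have [n Vn] := Une _ UV; have [Kn hn] := HV n Vn.
rewrite -(aN_sum n Tp) (sum_uniq_cat _ (uniq_zbox K) (uniq_zbox n) (zbox_sub Kn)).
rewrite opprD addrA -sumrB.
apply: le_lt_trans (cabsB _ _) _.
have h1 : cabs (\sum_(k <- zbox K) (c k * P k - aN n k psi)) <= (size (@zbox d K))%:R * (2 * de).
  apply: le_trans (cabs_sum _ _) _.
  apply: (@le_trans _ _ (\sum_(k <- @zbox d K) (2 * de))).
    by apply: ler_sum_in => k kb; rewrite cabs_sub; apply: (HW k).2; exact: hn.
  by rewrite big_const_seq count_predT iter_addr_0 -[leLHS]mulr_natl.
have h2 : cabs (\sum_(k <- zbox n | k \notin zbox K) aN n k psi) <= D * @tau R d K.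
  have := @sum_tail R d D (fun k => D * omega 1 k) (zbox n) K D0.
  move=> /(_ _ (uniq_zbox n) (zbox_sub Kn)) tl.
  apply: le_trans _ (tl _); last first.
    by move=> k; rewrite ger0_norm// mulr_ge0// omega_ge0.
  apply: le_trans _ (ler_norm _).
  rewrite (sum_uniq_cat _ (uniq_zbox K) (uniq_zbox n) (zbox_sub Kn)) addrC addKr.
  rewrite -big_filter -[leRHS]big_filter; apply: le_trans (cabs_sum _ _) _.
  by apply: ler_sum_in => k; rewrite mem_filter => /andP[_ kb]; exact: HD.
apply: le_lt_trans (lerD h1 h2) _.
have h3 : (size (@zbox d K))%:R * (2 * de) <= e / 2.
  have -> : e / 2 = S * (2 * de) by rewrite /de; field; rewrite gt_eqF.
  by apply: ler_wpM2r; [exact: mulr_ge0 (ler0n _ 2) (ltW de0)|rewrite lerDl].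
have h4 : D * @tau R d K <= e / 4.
  apply: (@le_trans _ _ (D * (e / 4 / (D + 1)))); first by rewrite ler_wpM2l// HK.
  by rewrite mulrA ler_pdivrMr// mulrC ler_wpM2l ?(ltW e4)// lerDl.
by lra.
Qed.

End Coeff.

(** * Nonvanishing of the Fourier transform *)

Section Comb.
Local Open Scope ring_scope.
Local Open Scope classical_set_scope.
Context {R : realType} {d : nat}.
Local Notation ivec := 'rV[int]_d.
Local Notation vec := 'rV[R]_d.
Local Notation C := R[i].
Implicit Types (k m q : ivec) (x y z : vec) (F G psi : vec -> C) (f : vec -> R) (n K : nat) (e s t h M : R)
  (sig : bool).

Lemma w1_lattice m (M : R) : 1 <= M -> w1 (latt (M%:M : 'M[R]_d) m) <= CN (1%:M : 'M[R]_d) 1 * omega 1 m.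
Proof.
move=> M1; apply: (@le_trans _ _ (w1 (grid_pt (1%:M : 'M[R]_d) 1 m))).
  rewrite /w1; apply: lerXn2r; rewrite ?nnegrE ?rho1_ge0//.
  rewrite /grid_pt /latt invr1 scale1r mulmx1 mul_mx_scalar normrZ; apply: rho1_le.
  have M0 : 0 <= M by lra.
  by rewrite (ger0_norm (normr_ge0 (intvec m))) (ger0_norm M0) ger0_norm ?mulr_ge0// ler_peMl.
exact: w1_grid_pt1 (unitmx1 _ _) _ _ (lexx _).
Qed.

Lemma w1_far m (M : R) : 1 <= M -> m != 0 -> w1 (latt (M%:M : 'M[R]_d) m) <= M^-1.
Proof.
move=> M1 m0; have M0 : 0 < M by lra.
have [j mj] : exists j, m 0 j != 0.
  apply/existsP; rewrite -negb_forall; apply: contra m0 => /forallP H.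
  by apply/eqP/rowP => j; rewrite mxE; apply/eqP; exact: H.
have d0 : (0 < d)%N := leq_ltn_trans (leq0n j) (ltn_ord j).
apply: (@le_trans _ _ (rho1 `|latt (M%:M : 'M[R]_d) m|)).
  by rewrite /w1 -[leRHS]expr1 ler_wiXn2l ?rho1_ge0 ?rho1_le1.
have h : M <= `|latt (M%:M : 'M[R]_d) m|.
  apply: le_trans (vnorm_coord _ j); rewrite /latt mul_mx_scalar !mxE normrM (ger0_norm (ltW M0)).
  rewrite ler_peMr ?(ltW M0)// -intr_norm.
  by rewrite (_ : 1 = 1%:~R)// ler_int; move: mj; rewrite -normr_gt0; lia.
rewrite /rho1 lef_pV2 ?posrE//; first by rewrite expr2; nra.

Qed.

(* The Dirac comb on [M Z^d]. *)
Definition comb (M : R) psi : C :=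
  (zsum (fun k => reF psi (latt M%:M k)) +i* zsum (fun k => imF psi (latt M%:M k)))%C.

Lemma zsum0 (a : R) : zsum (fun k : ivec => if k == 0 then a else 0) = a.
Proof.
have o0 : 0 < omega 1 (0 : ivec) :> R by rewrite prodr_gt0// => j _; exact: rho1_gt0.
apply: (@zsum_eq _ _ (`|a| / omega 1 (0 : ivec))).
- by rewrite divr_ge0// ltW.
- move=> k; case: eqP => [->|_]; first by rewrite divfK ?gt_eqF.
  by rewrite normr0 mulr_ge0 ?omega_ge0// divr_ge0// ltW.
move=> e e0; exists 0%N => K _.
have b0 : (0 : ivec) \in zbox K by rewrite mem_zbox; apply/forallP => j; rewrite mxE.
rewrite (bigD1_seq 0)//= ?uniq_zbox// big1 ?addr0 ?eqxx; last by move=> m /negbTE ->.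
by rewrite subrr normr0 ltW.
Qed.

Lemma comb_dom (M A : R) f : 1 <= M -> 0 <= A -> (forall x, `|f x| <= A * w1 x) ->
  forall k, `|f (latt M%:M k)| <= A * CN (1%:M : 'M[R]_d) 1 * omega 1 k.
Proof.
move=> M1 A0 H k; apply: le_trans (H _) _; rewrite -mulrA ler_wpM2l//; exact: w1_lattice.
Qed.

Lemma comb_bound (M A : R) f : 1 <= M -> 0 <= A -> (forall x, `|f x| <= A * w1 x) ->
  `|zsum (fun k => f (latt M%:M k))| <= A * CN (1%:M : 'M[R]_d) 1 * 5 ^+ d.
Proof.
move=> M1 A0 H; have D := comb_dom M1 A0 H; have A1 := MCN_ge0 (1%:M : 'M[R]_d) 1 A0.
apply: (zsum_bound A1 D) => s us; apply: le_trans (ler_norm_sum _ _ _) _.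
apply: le_trans (ler_sum _ (fun k _ => D k)) _.
rewrite -mulr_sumr ler_wpM2l//; have := sum_omega_le (lexx (1 : R)) us.
by rewrite mulr1.
Qed.

(** Away from the origin one factor of [w2 = w1^2] gives [1 / M] by [w1_far], and the other one
    makes the sum converge uniformly in [M]. *)
Lemma comb_near (M A : R) f : 1 <= M -> 0 <= A -> (forall x, `|f x| <= A * w2 x) ->
  `|zsum (fun k => f (latt M%:M k)) - f 0| <= A * CN (1%:M : 'M[R]_d) 1 * 5 ^+ d / M.
Proof.
move=> M1 A0 H; have M0 : 0 < M by lra.
have A1 := MCN_ge0 (1%:M : 'M[R]_d) 1 A0.
have A2 : 0 <= A * CN (1%:M : 'M[R]_d) 1 / M by rewrite divr_ge0// ltW.
pose b k : R := if k == 0 then 0 else f (latt M%:M k).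
pose b0 k : R := if k == 0 then f 0 else 0.
have l0 : latt M%:M (0 : ivec) = 0 :> vec.
  by rewrite /latt (_ : intvec 0 = 0) ?mul0mx//; apply/rowP => j; rewrite !mxE.
have bb k : `|b k| <= A * CN (1%:M : 'M[R]_d) 1 / M * omega 1 k.
  rewrite /b; case: eqP => [_|/eqP k0]; first by rewrite normr0 mulr_ge0 ?omega_ge0.
  apply: le_trans (H _) _; rewrite /w2 expr2.
  have h := ler_pM (w1_ge0 _) (w1_ge0 _) (w1_far M1 k0) (w1_lattice k M1).
  by apply: le_trans (ler_wpM2l A0 h) _; apply: le_eq; ring.
have o0 : 0 < omega 1 (0 : ivec) :> R by rewrite prodr_gt0// => j _; exact: rho1_gt0.
have b0b k : `|b0 k| <= `|f 0| / omega 1 (0 : ivec) * omega 1 k.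
  rewrite /b0; case: eqP => [->|_]; first by rewrite divfK ?gt_eqF.
  by rewrite normr0 mulr_ge0 ?omega_ge0// divr_ge0// ltW.
have -> : (fun k => f (latt M%:M k)) = fun k => b k + b0 k.
  by apply/funext => k; rewrite /b /b0; case: eqP => [->|_]; rewrite ?l0 ?add0r ?addr0.
rewrite (zsumD A2 _ bb b0b); last by rewrite divr_ge0// ltW.
rewrite zsum0 addrK; apply: (zsum_bound A2 bb) => s us; apply: le_trans (ler_norm_sum _ _ _) _.
apply: le_trans (ler_sum _ (fun k _ => bb k)) _.
rewrite -mulr_sumr [leRHS]mulrAC ler_wpM2l//; have := sum_omega_le (lexx (1 : R)) us.
by rewrite mulr1.
Qed.

Lemma T_dom sig s t F : 0 < s -> 0 < t -> inGS sig s t F -> exists2 A : R, 0 <= A &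
  (forall x, `|reF F x| <= A * w2 x) /\ (forall x, `|imF F x| <= A * w2 x).
Proof.
move=> s0 t0 TF; have [A [[a _] [b _]]] := T_lip2 s0 t0 TF.
exists `|A| => //; split=> x; apply: le_trans (_ : A * w2 x <= _); rewrite ?a ?b//;
  by rewrite ler_wpM2r ?w2_ge0 ?ler_norm.
Qed.

Lemma T_dom1 sig s t F : 0 < s -> 0 < t -> inGS sig s t F -> exists2 A : R, 0 <= A &
  (forall x, `|reF F x| <= A * w1 x) /\ (forall x, `|imF F x| <= A * w1 x).
Proof.
move=> s0 t0 TF; have [A A0 [a b]] := T_dom s0 t0 TF.
by exists A => //; split=> x; [apply: le_trans (a x) _|apply: le_trans (b x) _];
  rewrite ler_wpM2l ?w2_le_w1.
Qed.

Lemma comb_lin sig s t M : 0 < s -> 0 < t -> 1 <= M -> GSlinear sig s t (comb M).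
Proof.
move=> s0 t0 M1 a b F G TF TG.
have [A A0 [r1 r2]] := T_dom1 s0 t0 TF; have [A' A'0 [r1' r2']] := T_dom1 s0 t0 TG.
have Q (e e' c c' : R) (f g f' g' : vec -> R) : (forall x, `|f x| <= A * w1 x) -> (forall x, `|g x| <= A * w1 x) ->
  (forall x, `|f' x| <= A' * w1 x) -> (forall x, `|g' x| <= A' * w1 x) ->
  zsum (fun k => (e * f (latt M%:M k) + e' * g (latt M%:M k)) + (c * f' (latt M%:M k) + c' * g' (latt M%:M k))) =
  (e * zsum (fun k => f (latt M%:M k)) + e' * zsum (fun k => g (latt M%:M k))) +
  (c * zsum (fun k => f' (latt M%:M k)) + c' * zsum (fun k => g' (latt M%:M k))).
  move=> h1 h2 h3 h4.
  have Z (E a0 : R) (p : vec -> R) : 0 <= a0 -> (forall x, `|p x| <= a0 * w1 x) ->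
    (forall k, `|E * p (latt M%:M k)| <= `|E| * (a0 * CN (1%:M : 'M[R]_d) 1) * omega 1 k).
    by move=> a00 Hp k; rewrite normrM -mulrA ler_wpM2l// comb_dom.
  have D (a1 a2 : R) (p1 p2 : ivec -> R) : (forall k, `|p1 k| <= a1 * omega 1 k) -> (forall k, `|p2 k| <= a2 * omega 1 k) ->
    forall k, `|p1 k + p2 k| <= (a1 + a2) * omega 1 k.
    by move=> H1 H2 k; rewrite mulrDl (le_trans (ler_normD _ _))// lerD.
  have P (E a0 : R) : 0 <= a0 -> 0 <= `|E| * (a0 * CN (1%:M : 'M[R]_d) 1).
    by move=> a00; apply: mulr_ge0 => //; exact: MCN_ge0.
  have z1 := Z e _ _ A0 h1; have z2 := Z e' _ _ A0 h2; have z3 := Z c _ _ A'0 h3; have z4 := Z c' _ _ A'0 h4.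
  rewrite (zsumD _ _ (D _ _ _ _ z1 z2) (D _ _ _ _ z3 z4)); try (by apply: addr_ge0; exact: P).
  rewrite (zsumD _ _ z1 z2); try exact: P.
  rewrite (zsumD _ _ z3 z4); try exact: P.
  rewrite (zsumZ _ _ (comb_dom M1 A0 h1)) ?(zsumZ _ _ (comb_dom M1 A0 h2)); try exact: MCN_ge0.
  by rewrite (zsumZ _ _ (comb_dom M1 A'0 h3)) ?(zsumZ _ _ (comb_dom M1 A'0 h4)); try exact: MCN_ge0.
apply/eqP; rewrite eq_complex; apply/andP; split; apply/eqP; rewrite /comb.
  rewrite (_ : (fun k => reF _ _) = fun k => (complex.Re a * reF F (latt M%:M k) + - complex.Im a * imF F (latt M%:M k)) +
      (complex.Re b * reF G (latt M%:M k) + - complex.Im b * imF G (latt M%:M k))); last first.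
    by apply/funext => y; rewrite /reF /imF cReD !cReM; ring.
  by rewrite [LHS]/= Q// cReD !cReM /=; ring.
rewrite [LHS]/= (_ : (fun k => imF _ _) = fun k => (complex.Re a * imF F (latt M%:M k) + complex.Im a * reF F (latt M%:M k)) +
      (complex.Re b * imF G (latt M%:M k) + complex.Im b * reF G (latt M%:M k))); last first.
  by apply/funext => y; rewrite /reF /imF cImD !cImM; ring.
by rewrite Q// cImD !cImM /=; ring.
Qed.

Lemma comb_cont sig s t M : 0 < s -> 0 < t -> 1 <= M -> GScont sig s t (comb M).
Proof.
move=> s0 t0 M1.
have key h : 0 < h -> exists K : R, forall psi (A : R), smoothC psi -> GSbound s t h A psi ->
    cabs (comb M psi) <= K * A.
  move=> h0; have [Q Q0 HQ] := RB_RBW (d := d) s h0 t0.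
  exists (2 * (Q * CN (1%:M : 'M[R]_d) 1 * 5 ^+ d)) => psi A sp H.
  have [r1 r2] := GSbound_RB sp H; have A0 := RB_ge0 r1; have QA : 0 <= Q * A by rewrite mulr_ge0.
  have w (f : vec -> R) : RB s t h A f -> forall x, `|f x| <= Q * A * w1 x.
    move=> rf x; have := HQ A f A0 rf [::] [::] x; rewrite /xp big_nil normr1 mul1r !bd_nil !mulr1 => h1.
    by apply: le_trans h1 _; rewrite ler_wpM2l ?w2_le_w1.
  apply: le_trans (cabs_le _) _; rewrite /comb /=.
  apply: le_trans (lerD (comb_bound M1 QA (w _ r1)) (comb_bound M1 QA (w _ r2))) _.
  by apply: le_eq; ring.
case: sig => [|h h0]; last first.
  exact: key.
exists 1; split=> //; have [K HK] := key 1 ltr01; exists K => psi A Tp; apply: HK.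
by case: Tp.
Qed.

Lemma comb_periodic sig s t M : 0 < s -> 0 < t -> 1 <= M -> periodic_dist M%:M (inGS sig s t) (comb M).
Proof.
move=> s0 t0 M1 m F TF; have [A A0 [r1 r2]] := T_dom1 s0 t0 TF.
have E (f : vec -> R) : (forall x, `|f x| <= A * w1 x) ->
   zsum (fun k => f (latt M%:M k - latt M%:M m)) = zsum (fun k => f (latt M%:M k)).
  move=> H; have := zsum_shift (- m) (MCN_ge0 _ _ A0) (comb_dom M1 A0 H) => <-.
  congr zsum; apply/funext => k; congr f.
  rewrite /latt -mulmxBl; congr (_ *m _); apply/rowP => j.
  by rewrite !mxE rmorphB.
by rewrite /comb; congr (_ +i* _)%C; exact: E.
Qed.

Lemma latt_unit M : 1 <= M -> (M%:M : 'M[R]_d) \in unitmx.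
Proof. by move=> M1; rewrite unitmxE det_scalar unitfE expf_neq0// gt_eqF//; lra. Qed.

Lemma T_scaleIC sig s t (a : C) F : 0 < s -> 0 < t -> inGS sig s t F ->
  intC (fun y => a * F y) = a * intC F.
Proof.
move=> s0 t0 TF; have [A HA] := T_lipC s0 t0 TF.
have := IC_lin a 0 HA HA; rewrite mul0r addr0 => <-.
by congr intC; apply/funext => y; rewrite mul0r addr0.
Qed.

Lemma IC_normsq sig s t F : 0 < s -> 0 < t -> inGS sig s t F -> F <> (fun _ => 0) ->
  intC (fun y => F y * conjc (F y)) != 0.
Proof.
move=> s0 t0 TF F0.
have TG : inGS sig s t (fun y => F y * conjc (F y)) by apply: T_mul => //; exact: T_conj.
have [A [L1 L2]] := T_lip2 s0 t0 TG.
have rE : reF (fun y => F y * conjc (F y)) = fun y => reF F y ^+ 2 + imF F y ^+ 2.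
  by apply/funext => y; rewrite /reF /imF; case: (F y) => a b /=; ring.
have [x0 Fx0] : exists x0, F x0 <> 0.
  by apply: contrapT => H; apply: F0; apply/funext => x; apply: contrapT => Hx; apply: H; exists x.
have p : 0 < intRd (reF (fun y => F y * conjc (F y))).
  apply: (I_pos (x0 := x0) L1) => [x|]; rewrite rE; first by rewrite addr_ge0 ?sqr_ge0.
  rewrite lt_neqAle addr_ge0 ?sqr_ge0// andbT eq_sym; apply/eqP => /eqP.
  rewrite paddr_eq0 ?sqr_ge0// !sqrf_eq0 => /andP[/eqP a /eqP b]; apply: Fx0.
  by move: a b; rewrite /reF /imF; case: (F x0) => a b /= -> ->.
apply/eqP => /(congr1 (@complex.Re R)) /= E.
by rewrite E ltxx in p.
Qed.

(* If the Fourier transform of [F] vanished, the expansion of a Dirac comb would vanish on all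
   translates of [F]; but a comb of large period is close to evaluation at [0]. *)
Lemma fourier_nonzero sig s t F : 0 < s -> 0 < t -> inGS sig s t F -> F <> (fun _ => 0) ->
  exists eta : vec, intC (fun y => F y * cexpi (inner y eta)) != 0.
Proof.
move=> s0 t0 TF F0; apply: contrapT => H; have F0' := F0.
have Z eta : intC (fun y => F y * cexpi (inner y eta)) = 0.
  by apply/eqP; apply: contrapT => /negP E; apply: H; exists eta.
apply: F0; apply/funext => x0.
pose psi y := F (y + x0); have Tp : inGS sig s t psi by exact: T_shift.
have [A A0 [r1 r2]] := T_dom s0 t0 Tp.
pose X := A * CN (1%:M : 'M[R]_d) 1 * 5 ^+ d.
have X0 : 0 <= X by rewrite mulr_ge0 ?exprn_ge0//; exact: MCN_ge0.
have key M : 1 <= M -> cabs (psi 0) <= 2 * X / M.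
  move=> M1; have uM := latt_unit M1.
  (* With [|F|^2] in place of [F], the denominators of [representation] are the squared L2 norm of
     [F], nonzero even when the Fourier transform of [F] vanishes. *)
  pose g k y := F y * conjc (F y) * cexpi (- inner y (dlatt M%:M k)).
  have Tg k : inGS sig s t (g k).
    have TN : inGS sig s t (fun y => F y * conjc (F y)) by apply: T_mul => //; exact: T_conj.
    have := T_mod s0 t0 (- dlatt M%:M k) 0 TN; congr inGS; apply/funext => y.
    by rewrite /g innerNr addr0.
  have gE k : intC (fun y => g k y * chi M%:M k y) != 0.
    rewrite (_ : (fun y => _) = fun y => F y * conjc (F y)); first exact: (IC_normsq s0 t0 TF F0').
    by apply/funext => y; rewrite /g /chi -mulrA [cexpi _ * _]mulrC cexpiNK mulr1.
  have [c [_ Hc]] := representation uM s0 t0 (comb_lin s0 t0 M1) (comb_cont sig s0 t0 M1)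
    (comb_periodic s0 t0 M1) Tg gE.
  (* [psi] is a translate of [F], so each of its Fourier integrals is a phase times one of [F] and
     vanishes by [Z]. *)
  have u0 : comb M psi = 0.
    apply: cabs_eq0; apply/eqP; rewrite eq_le cabs_ge0 andbT; apply/ler_addgt0Pr => e e0.
    have [N0 HN] := Hc psi Tp e e0; have := HN N0 (leqnn _).
    rewrite boxsumE big1 ?sub0r ?cabsN ?add0r; first exact: ltW.
    move=> k _; rewrite (_ : intC _ = 0) ?mulr0//.
    pose G y := F y * cexpi (inner y (dlatt M%:M k)).
    have TG : inGS sig s t G by exact: (T_chi M%:M s0 t0 k TF).
    have [A' HA'] := T_lipC s0 t0 TG.
    rewrite (_ : (fun y => _) = fun y => cexpi (- inner x0 (dlatt M%:M k)) * G (y + x0)).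
      by rewrite (T_scaleIC _ s0 t0 (T_shift s0 t0 _ TG)) (IC_shift _ HA') Z mulr0.
    apply/funext => y; rewrite /psi /G /chi innerDl cexpiD.
    by rewrite [RHS]mulrCA; congr (_ * _); rewrite [RHS]mulrC -mulrA cexpiNK mulr1.
  have c0 : psi 0 = - (comb M psi - psi 0) by rewrite u0 sub0r opprK.
  rewrite c0 cabsN; apply: le_trans (cabs_le _) _; rewrite cReD cImD cReN cImN /comb /=.
  apply: le_trans (lerD (comb_near M1 A0 r1) (comb_near M1 A0 r2)) _.
  by apply: le_eq; rewrite /X; ring.
have -> : F x0 = psi 0 by rewrite /psi add0r.
apply: cabs_eq0; apply/eqP; rewrite eq_le cabs_ge0 andbT; apply/ler_addgt0Pr => e e0; rewrite add0r.
pose M := Num.max 1 (2 * X / e).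
have M1 : 1 <= M by rewrite le_max lexx.
have M2 : 2 * X / e <= M by rewrite le_max lexx orbT.
apply: le_trans (key M M1) _; have M0 : 0 < M by lra.
by move: M2; rewrite !ler_pdivrMr// [M * e]mulrC.
Qed.

End Comb.

(** * Decay of Fourier transforms *)

Section Decay.
Local Open Scope ring_scope.
Local Open Scope classical_set_scope.
Context {R : realType}.
Implicit Types (s h a b A M X Y r p rho : R).

Lemma expR_half_le a b Y : 0 <= Y -> 0 <= a -> (forall n, Y ^+ n * a <= b * n`!%:R) ->
  a * expR (Y / 2) <= 2 * b.
Proof.
move=> Y0 a0 H; have ab := H 0%N; rewrite expr0 mul1r fact0 mulr1 in ab.
have b0 : 0 <= b by exact: le_trans ab.
have [->|an] := eqVneq a 0; first by rewrite mul0r mulr_ge0.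
have a1 : 0 < a by rewrite lt_neqAle eq_sym an.
rewrite mulrC -ler_pdivlMr// /expR; apply: limr_le; first exact: is_cvg_series_exp_coeff.
have q0 : 0 <= b / a by rewrite divr_ge0.
near=> n; rewrite /series /= big_mkord.
(* The hypothesis bounds each term of the series at [Y / 2] by a term of a geometric series of ratio
   1/2, whose partial sums are [2 - 2 / 2^n]. *)
apply: (@le_trans _ _ (b / a * (2 - 2 / 2 ^+ n))).
  elim: (n : nat) => [|m IH]; first by rewrite big_ord0 expr0 divr1 subrr mulr0.
  rewrite big_ord_recr /=; have f0 : 0 < (m`!)%:R :> R by rewrite ltr0n fact_gt0.
  have e0 : 0 < 2 ^+ m :> R by rewrite exprn_gt0.
  have h1 : (Y / 2) ^+ m / m`!%:R <= b / a / 2 ^+ m.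
    rewrite expr_div_n mulrAC ler_pM2r ?invr_gt0// ler_pdivrMr// mulrAC ler_pdivlMr//.
  apply: le_trans (lerD IH h1) _; apply: le_eq; rewrite exprS.
  by move: (2 ^+ m : R) e0 => E e0; field; rewrite !gt_eqF.
have -> : 2 * b / a = b / a * 2 by ring.
by rewrite ler_wpM2l// gerBl divr_ge0// exprn_ge0.
Unshelve. all: by end_near.
Qed.

(* After taking [s]-th roots the bounds read [Y ^ n a <= b n!]; summing them with weights
   [2 ^ - n / n!] gives an exponential. *)
Lemma factorial_decay s h X A B : 0 < s -> 0 < h -> 0 <= X -> 0 <= A ->
  (forall n, X ^+ n * A <= B * (h ^+ n * (n`!%:R `^ s))) ->
  A <= 2 `^ s * B * expR (- (s / 2 * (X / h) `^ (1 / s))).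
Proof.
move=> s0 h0 X0 A0 H.
have B0 : 0 <= B by have := H 0%N; rewrite !expr0 !mul1r fact0 powR1 mulr1; exact: le_trans.
have p0 : 0 <= 1 / s by rewrite divr_ge0// ltW.
have sp : s * (1 / s) = 1 by field; rewrite gt_eqF.
have ps : 1 / s * s = 1 by rewrite mulrC.
set Y := (X / h) `^ (1 / s).
have Xh : 0 <= X / h by rewrite divr_ge0// ltW.
have key : A `^ (1 / s) * expR (Y / 2) <= 2 * B `^ (1 / s).
  apply: expR_half_le; rewrite ?powR_ge0// => n.
  rewrite powR_exp// -powRM ?exprn_ge0//.
  have -> : n`!%:R = (n`!%:R `^ s) `^ (1 / s) :> R by rewrite -powRrM sp powRr1.
  rewrite -powRM ?powR_ge0//; apply: ge0_ler_powR => //; rewrite ?nnegrE.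
  - by rewrite mulr_ge0// exprn_ge0.
  - by rewrite mulr_ge0// powR_ge0.
  rewrite expr_div_n mulrAC ler_pdivrMr ?exprn_gt0//.
  by apply: le_trans (H n) _; apply: le_eq; ring.
have : (A `^ (1 / s) * expR (Y / 2)) `^ s <= (2 * B `^ (1 / s)) `^ s.
  by apply: ge0_ler_powR key; rewrite ?nnegrE ?mulr_ge0 ?powR_ge0 ?expR_ge0// ltW.
rewrite !powRM ?powR_ge0 ?expR_ge0// -!powRrM ps !powRr1// -expRM => h1.
rewrite expRN ler_pdivlMr ?expR_gt0//; apply: le_trans h1.
by apply: le_eq; congr (_ * expR _); ring.
Qed.

Lemma powRD_le p X Y : 0 <= p -> 0 <= X -> 0 <= Y -> (X + Y) `^ p <= 2 `^ p * (X `^ p + Y `^ p).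
Proof.
move=> p0; wlog XY : X Y / X <= Y => [W|] X0 Y0.
  case/orP: (le_total X Y) => h; first exact: W.
  by rewrite addrC [X `^ p + _]addrC; exact: W.
apply: (@le_trans _ _ ((2 * Y) `^ p)).
  by apply: ge0_ler_powR; rewrite ?nnegrE ?addr_ge0 ?mulr_ge0//; lra.
by rewrite powRM// ler_wpM2l ?powR_ge0// lerDr powR_ge0.
Qed.

Context {d : nat}.
Local Notation vec := 'rV[R]_d.
Implicit Types (x y z xi eta : vec) (f g : vec -> R) (l : seq 'I_d) (j : 'I_d) (F : vec -> R[i]).

Lemma norm_coord_max x : (0 < d)%N -> exists j, `|x| = `|x 0 j|.
Proof.
move=> d0; pose j0 := Ordinal d0.
have [j _ H] := @arg_maxP _ _ 'I_d j0 xpredT (fun j => `|x 0 j|) isT.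
exists j; apply/eqP; rewrite eq_le vnorm_coord andbT.
by apply: vnorm_le => // i; exact: H.
Qed.

Lemma norm_enorm x : `|x| <= enorm x.
Proof.
apply: vnorm_le => [|j]; first exact: sqrtr_ge0.
rewrite -sqrtr_sqr /enorm ler_sqrt; last by rewrite sumr_ge0// => i _; exact: sqr_ge0.
by rewrite (bigD1 j)//= lerDl sumr_ge0// => i _; exact: sqr_ge0.
Qed.

Lemma enorm_norm x : enorm x <= d%:R * `|x|.
Proof.
have h0 : 0 <= d%:R * `|x| by rewrite mulr_ge0.
rewrite -(ger0_norm h0) -sqrtr_sqr /enorm ler_sqrt ?sqr_ge0//.
apply: (@le_trans _ _ (\sum_(j < d) `|x| ^+ 2)).
  by apply: ler_sum => j _; rewrite -(real_normK (num_real (x 0 j))) lerXn2r ?nnegrE// vnorm_coord.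
rewrite sum_const_ord exprMn ler_wpM2r ?sqr_ge0//.
by rewrite -natrX ler_nat; case: (d) => // m; rewrite expnS leq_pmulr.
Qed.

(** The sup norm is used because one coordinate attains it, which is what iterated integration by
    parts can see. Passing to [enorm] costs a factor [d^(1/s)] in the exponent. *)
Definition pow_norm s x : R := `|x| `^ (1 / s).

Lemma pow_norm_ge0 s x : 0 <= pow_norm s x. Proof. exact: powR_ge0. Qed.

Lemma pow_normD s x y : 0 < s -> pow_norm s (x + y) <= 2 `^ (1 / s) * (pow_norm s x + pow_norm s y).
Proof.
move=> s0; have p0 : 0 <= 1 / s by rewrite divr_ge0// ltW.
apply: le_trans (powRD_le p0 (normr_ge0 x) (normr_ge0 y)).
by apply: ge0_ler_powR; rewrite ?nnegrE ?addr_ge0 ?ler_normD.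
Qed.

Lemma pow_normN s x : pow_norm s (- x) = pow_norm s x. Proof. by rewrite /pow_norm normrN. Qed.

Lemma pow_norm_enorm s x : 0 < s -> pow_norm s x <= enorm x `^ (1 / s).
Proof.
move=> s0; apply: ge0_ler_powR; rewrite ?nnegrE ?divr_ge0 ?(ltW s0) ?sqrtr_ge0//.
exact: norm_enorm.
Qed.

Lemma enorm_pow_norm s x : 0 < s -> enorm x `^ (1 / s) <= d%:R `^ (1 / s) * pow_norm s x.
Proof.
move=> s0; rewrite -powRM//; apply: ge0_ler_powR; rewrite ?nnegrE ?divr_ge0 ?(ltW s0) ?sqrtr_ge0 ?mulr_ge0//.
exact: enorm_norm.
Qed.

(** [(s / rho)^s] is the scale at which [expt] becomes an exponential of rate [rho]. *)
Lemma expt_powR s rho r : 0 < s -> 0 < rho -> 0 <= r -> expt s (r / (s / rho) `^ s) = expR (rho * r `^ (1 / s)).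
Proof.
move=> s0 r0 rr; rewrite /expt; congr expR.
have q0 : 0 <= s / rho by rewrite divr_ge0// ltW.
rewrite -powRN powRM ?powR_ge0// -powRrM.
rewrite (_ : - s * (1 / s) = -1); last by field; rewrite gt_eqF.
by rewrite powR_inv1//; field; rewrite !gt_eqF.
Qed.

Lemma pow_norm_w1 s rho : 0 < s -> 0 < rho -> exists2 C : R, 0 <= C & forall x, 1 <= C * w1 x * expR (rho * pow_norm s x).
Proof.
move=> s0 r0; pose h := (s / rho) `^ s.
have h0 : 0 < h by rewrite powR_gt0// divr_gt0.
pose E := h ^+ (2 * d) * (((2 * d)`!)%:R `^ s).
have E0 : 0 <= E by rewrite mulr_ge0 ?powR_ge0// exprn_ge0// ltW.
exists (2 ^+ d * (1 + E)) => [|x]; first by rewrite mulr_ge0 ?exprn_ge0// addr_ge0.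
have e1 : 1 <= expR (rho * pow_norm s x) by rewrite -expR0 ler_expR mulr_ge0 ?pow_norm_ge0// ltW.
have h1 : `|x| ^+ (2 * d) <= expR (rho * pow_norm s x) * E.
  by have := pow_expt (2 * d) s0 h0 (normr_ge0 x); rewrite expt_powR.
have h2 := one_plus_pow d (sqr_ge0 `|x|); rewrite -exprM in h2.
have h3 : (1 + `|x| ^+ 2) ^+ d <= 2 ^+ d * (1 + E) * expR (rho * pow_norm s x).
  apply: le_trans h2 _; rewrite -mulrA ler_wpM2l ?exprn_ge0//.
  rewrite mulrDl mul1r lerD//; by rewrite mulrC.
rewrite /w1 /rho1 exprVn mulrAC ler_pdivlMr ?mul1r//.
Qed.

Lemma lf_nseq n j : lf (nseq n j) = n`!.
Proof.
rewrite /lf /mfact (bigD1 j)//= big1 ?muln1.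
  by rewrite /cnt count_nseq /= eqxx mul1n.
by move=> i ij; rewrite /cnt count_nseq /= eq_sym (negbTE ij) mul0n.
Qed.

Section TrigDecay.
Variables (s h M : R) (f : vec -> R) (xi : vec).
Hypotheses (s0 : 0 < s) (h0 : 0 < h) (sf : smoothR f) (Hf : WB w2 s h M f).

Definition Jt l a b : R := intRd (fun y => partials l f y * trig a b xi y).

Lemma M_ge0 : 0 <= M. Proof. exact: WB_ge0 (w2_gt0 _) Hf. Qed.

Lemma lip_trig l a b (p : seq 'I_d) : exists A, lip w1 A (partials p (fun y => partials l f y * trig a b xi y)).
Proof.
pose h' := 2 `^ s * h; have h'0 : 0 < h' by rewrite mulr_gt0// powR_gt0.
have b1 : WB w2 s h' (M * bd s h' l) (partials l f).
  move=> q x; rewrite -partials_cat; apply: le_trans (Hf _ _) _.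
  rewrite ler_wpM2r ?w2_ge0// -mulrA ler_wpM2l ?M_ge0// [bd s h' l * _]mulrC.
  exact: bd_cat2 (ltW s0) (ltW h0).
have b2 := WB_trig a b s0 h'0 (normr_ge0 xi) (lexx _).
have sp := smooth_partials l sf; have st := smooth_trig a b xi.
have b3 := WBM (ltW s0) (ltW h'0) (@w2_gt0 R d) sp st b1 b2.
have h2 : 0 <= 2 * h' by rewrite mulr_ge0// ltW.
have L := WB_lip p (ltW s0) h2 (smoothM sp st) b3.
eexists; exact: lip_w21 (lip_ge0 (w2_gt0 _) L) L.
Qed.

Lemma Jt_step l j a b : Jt (j :: l) a b = - Jt l (b * xi 0 j) (- (a * xi 0 j)).
Proof.
have sp := smooth_partials l sf; have st := smooth_trig a b xi.
have [A1 L1] := lip_trig l a b [::]; have [A2 L2] := lip_trig l a b [:: j].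
have := I_partial (j := j) (fun x => smooth_diff x (smoothM sp st)) L1 L2.
rewrite partialM; [|by move=> x; exact: smooth_diff|by move=> x; exact: smooth_diff].
rewrite partial_trig.
have [A3 L3] := lip_trig (j :: l) a b [::]; have [A4 L4] := lip_trig l (b * xi 0 j) (- (a * xi 0 j)) [::].
rewrite (I_add _ _ L3 L4); [|exact: lip_ge0 (w1_gt0 _) L3|exact: lip_ge0 (w1_gt0 _) L4].
by move/eqP; rewrite addr_eq0 => /eqP.
Qed.

Lemma Jt_scale l a b (c : R) : Jt l (c * a) (c * b) = c * Jt l a b.
Proof.
have [A L] := lip_trig l a b [::].
rewrite /Jt -(I_scale c _ L); last exact: lip_ge0 (w1_gt0 _) L.
by congr intRd; apply/funext => y; rewrite /= /trig; ring.
Qed.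

(** Integration by parts exchanges the cosine and sine integrals, so their sum is reproduced
    exactly, with the factor [|xi_j|]. *)
Definition Nt l : R := `|Jt l 1 0| + `|Jt l 0 1|.

Lemma Nt_step l j : Nt (j :: l) = `|xi 0 j| * Nt l.
Proof.
rewrite /Nt !Jt_step !normrN mulrDr addrC; congr (_ + _).
  by rewrite -normrM -Jt_scale; congr (`|Jt _ _ _|); ring.
by rewrite -(normrN (xi 0 j)) -normrM -Jt_scale; congr (`|Jt _ _ _|); ring.
Qed.

Lemma Nt_pow n j : Nt (nseq n j) = `|xi 0 j| ^+ n * Nt [::].
Proof. by elim: n => [|n IH]; rewrite ?expr0 ?mul1r//= Nt_step IH exprS mulrA. Qed.

Lemma Nt_bound l : Nt l <= 2 * (M * bd s h l * @CI R d).
Proof.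
have P a b : `|a| + `|b| = 1 -> `|Jt l a b| <= M * bd s h l * @CI R d.
  move=> ab; have [A L] := lip_trig l a b [::].
  apply: (I_bound (lip_ge0 (w1_gt0 _) L) L).
  move=> x; rewrite normrM -[leRHS]mulr1.
  apply: ler_pM => //; last by rewrite -ab trig_le.
  apply: le_trans (Hf _ _) _; apply: ler_wpM2l (w2_le_w1 _).
  by rewrite mulr_ge0 ?M_ge0// bd_ge0// ltW.
rewrite mulr_natl mulr2n; apply: lerD; apply: P; by rewrite ?normr1 ?normr0 ?addr0 ?add0r.
Qed.

(** Only derivatives in the direction of the largest coordinate of [xi] are used; for them [bd] is
    [h^n n!^s], the form required by [factorial_decay]. *)
Lemma Nt_decay : (0 < d)%N -> Nt [::] <= 2 `^ s * (2 * (M * @CI R d)) * expR (- (s / 2 * (`|xi| / h) `^ (1 / s))).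
Proof.
move=> d0; have [j ->] := norm_coord_max xi d0.
apply: factorial_decay => // [|n]; first by rewrite addr_ge0.
rewrite -Nt_pow; apply: le_trans (Nt_bound _) _; apply: le_eq.
by rewrite /bd lf_nseq size_nseq; ring.
Qed.

End TrigDecay.

Lemma fourier_decay s h M F xi : (0 < d)%N -> 0 < s -> 0 < h -> smoothC F ->
  WB w2 s h M (reF F) -> WB w2 s h M (imF F) ->
  cabs (intC (fun y => F y * cexpi (inner y xi))) <=
    2 `^ s * 4 * @CI R d * M * expR (- (s / 2 * (`|xi| / h) `^ (1 / s))).
Proof.
move=> d0 s0 h0 [s1 s2] H1 H2.
have N1 := Nt_decay xi s0 h0 s1 H1 d0; have N2 := Nt_decay xi s0 h0 s2 H2 d0.
have P (f g : vec -> R) (c e a b : R) : smoothR f -> smoothR g -> WB w2 s h M f -> WB w2 s h M g ->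
   `|intRd (fun y => f y * trig c e xi y + g y * trig a b xi y)| <= `|Jt f xi [::] c e| + `|Jt g xi [::] a b|.
  move=> sf sg Hf Hg; have [A L] := lip_trig xi s0 h0 sf Hf [::] c e [::].
  have [A' L'] := lip_trig xi s0 h0 sg Hg [::] a b [::].
  rewrite (I_add _ _ L L'); [|exact: lip_ge0 (w1_gt0 _) L|exact: lip_ge0 (w1_gt0 _) L'].
  exact: ler_normD.
apply: le_trans (cabs_le _) _; rewrite /intC /=.
have -> : reF (fun y => F y * cexpi (inner y xi)) = fun y => reF F y * trig 1 0 xi y + imF F y * trig 0 (-1) xi y.
  by apply/funext => y; rewrite /reF cReM /trig /imF /=; ring.
have -> : imF (fun y => F y * cexpi (inner y xi)) = fun y => reF F y * trig 0 1 xi y + imF F y * trig 1 0 xi y.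
  by apply/funext => y; rewrite /imF cImM /trig /reF /=; ring.
apply: le_trans (lerD (P _ _ _ _ _ _ s1 s2 H1 H2) (P _ _ _ _ _ _ s1 s2 H1 H2)) _.
have -> : `|Jt (imF F) xi [::] 0 (-1)| = `|Jt (imF F) xi [::] 0 1|.
  have := Jt_scale xi s0 h0 s2 H2 [::] 0 1 (-1); rewrite mulr0 mulr1 => ->.
  by rewrite mulN1r normrN.
move: N1 N2; rewrite /Nt; set X := expR _ => N1 N2.
apply: (@le_trans _ _ (2 `^ s * (2 * (M * @CI R d)) * X + 2 `^ s * (2 * (M * @CI R d)) * X)); first by lra.
by apply: le_eq; ring.
Qed.

End Decay.

(** * Trigonometric series *)

Section Series.
Local Open Scope ring_scope.
Local Open Scope classical_set_scope.
Context {R : realType} {d : nat}.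
Local Notation ivec := 'rV[int]_d.
Local Notation vec := 'rV[R]_d.
Local Notation C := R[i].
Implicit Types (k m : ivec) (x y z v : vec) (f g : vec -> R) (A M e s h rho : R) (l : seq 'I_d)
  (a b : ivec -> R) (K n : nat) (j : 'I_d).

Lemma derive_inner x v w : 'D_w (fun x : vec => inner x v) x = inner w v.
Proof.
apply/lim_near_cst => //=; near=> h.
rewrite innerDl addrK innerZl -[_ *: _]/(_ * _) mulKf//.
by near: h; exact: nbhs_dnbhs_neq.
Unshelve. all: by end_near. Qed.

(** Subtracting the linear part reduces the claim to a function with quadratically small increments,
    whose differential is 0. *)
Lemma diff_quadratic f x v A : 0 <= A ->
  (forall y, `|y| <= 1 -> `|f (x + y) - f x - inner y v| <= A * `|y| ^+ 2) ->
  differentiable f x /\ forall j, partial j f x = v 0 j.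
Proof.
move=> A0 H; pose g z := f z - inner z v.
have gq y : `|y| <= 1 -> `|g (x + y) - g x| <= A * `|y| ^+ 2.
  by move=> /H; rewrite /g innerDl; congr (`|_| <= _); ring.
pose df : {linear vec -> R} := \0.
have cdf : continuous df by rewrite (_ : (df : vec -> R) = cst 0)//; exact: cst_continuous.
have nb (e : R) : 0 < e -> \forall y \near (0 : vec), `|g (y + x) - g x| <= e * `|y|.
  move=> e0; have A1 : 0 < A + 1 by rewrite ltr_wpDl.
  near=> y; have y1 : `|y| <= 1.
    near: y; apply/nbhs_ballP; exists 1 => //= y.
    by rewrite -ball_normE /ball_ /= sub0r normrN => /ltW.
  have y2 : A * `|y| <= e.
    have : `|y| <= e / (A + 1).
      near: y; apply/nbhs_ballP; exists (e / (A + 1)) => /=; first by rewrite divr_gt0.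
      by move=> y; rewrite -ball_normE /ball_ /= sub0r normrN => /ltW.
    rewrite ler_pdivlMr// mulrC => h; apply: le_trans h.
    by rewrite ler_wpM2r// lerDl.
  rewrite [y + x]addrC; apply: le_trans (gq y y1) _.
  by rewrite expr2 mulrA ler_wpM2r.
have D : 'd g x = df :> (vec -> R).
  apply: diff_unique => //; apply/eqaddoP => _/posnumP[e].
  apply: filterS (nb e%:num [gt0 of e%:num]) => y.
  by rewrite -![(_ + _ : _ -> _) _]/(_ + _) -![(- _ : _ -> _) _]/(- _) /= addr0.
have dg : differentiable g x.
  apply/diff_locallyP; rewrite D; split => //; apply/eqaddoP => _/posnumP[e].
  apply: filterS (nb e%:num [gt0 of e%:num]) => y.
  by rewrite -![(_ + _ : _ -> _) _]/(_ + _) -![(- _ : _ -> _) _]/(- _) /= addr0.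
have fE : f = fun z => g z + inner z v by apply/funext => z; rewrite /g subrK.
split; first by rewrite fE; apply: differentiableD => //; exact: diff_inner.
move=> j; rewrite fE /partial deriveD; [|exact: diff_derivable|apply: diff_derivable; exact: diff_inner].
by rewrite derive_inner inner_ej deriveE// D add0r.
Unshelve. all: by end_near. Qed.

Lemma trig_quadratic (a b : R) z x y :
  `|trig a b z (x + y) - trig a b z x - inner y (\row_j partial j (trig a b z) x)| <=
    d%:R ^+ 2 * ((`|a| + `|b|) * `|z| ^+ 2) * `|y| ^+ 2.
Proof.
have df g : smoothR g -> forall y, differentiable g y by move=> sg y'; exact: smooth_diff.
have st := smooth_trig a b z.
have [t /andP[t0 t1] ->] := mvt_line x y (df _ st).
rewrite /inner; under [X in _ - X]eq_bigr => j _ do rewrite mxE.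
rewrite -sumrB; apply: le_trans (ler_norm_sum _ _ _) _.
have tn : `|t| <= 1 by rewrite ger0_norm.
have key (j : 'I_d) : `|y 0 j * partial j (trig a b z) (x + t *: y) - y 0 j * partial j (trig a b z) x| <=
    d%:R * ((`|a| + `|b|) * `|z| ^+ 2 * `|y| ^+ 2).
  rewrite -mulrBr normrM.
  have [t' _ ->] := mvt_line x (t *: y) (df _ (smooth_partial j st)).
  apply: le_trans (ler_wpM2l (normr_ge0 _) (ler_norm_sum _ _ _)) _.
  rewrite mulr_sumr -[leRHS]sum_const_ord; apply: ler_sum => i _.
  have h1 : `|partial i (partial j (trig a b z)) (x + t' *: (t *: y))| <= `|z| ^+ 2 * (`|a| + `|b|).
    apply: le_trans (trig_xp [:: i; j] a b z _) _.
    rewrite ler_wpM2r ?addr_ge0// /xp !big_cons big_nil mulr1 normrM expr2.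
    by apply: ler_pM => //; exact: vnorm_coord.
  rewrite normrM mxE normrM.
  have h2 : `|t| * `|y 0 i| <= `|y|.
    by rewrite -[leRHS]mul1r; apply: ler_pM => //; exact: vnorm_coord.
  have h3 := ler_pM (mulr_ge0 (normr_ge0 t) (normr_ge0 (y 0 i))) (normr_ge0 _) h2 h1.
  have h4 := ler_pM (normr_ge0 (y 0 j)) (mulr_ge0 (mulr_ge0 (normr_ge0 t) (normr_ge0 (y 0 i))) (normr_ge0 _)) (vnorm_coord y j) h3.
  by apply: le_trans h4 _; apply: le_eq; ring.
apply: le_trans (ler_sum _ (fun j _ => key j)) _.
by rewrite sum_const_ord; apply: le_eq; ring.
Qed.

Lemma zsum_lsum (I : Type) (r : seq I) (c : I -> R) (f : I -> ivec -> R) M : 0 <= M ->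
  (forall i k, `|f i k| <= M * omega 1 k) ->
  (exists2 M' : R, 0 <= M' & forall k, `|\sum_(i <- r) c i * f i k| <= M' * omega 1 k) /\
  zsum (fun k => \sum_(i <- r) c i * f i k) = \sum_(i <- r) c i * zsum (f i).
Proof.
move=> M0 H; elim: r => [|i r [[M' M'0 H'] IH]].
  split; first by exists 0 => // k; rewrite big_nil normr0 mul0r.
  rewrite big_nil -[RHS](@zsum0 R d 0); congr zsum; apply/funext => k; rewrite big_nil.
  by case: eqP.
have Hi k : `|c i * f i k| <= `|c i| * M * omega 1 k.
  by rewrite normrM -mulrA ler_wpM2l.
have ci0 : 0 <= `|c i| * M by rewrite mulr_ge0.
split.
  exists (`|c i| * M + M'); first by rewrite addr_ge0.
  move=> k; rewrite big_cons mulrDl; apply: le_trans (ler_normD _ _) _.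
  by apply: lerD.
rewrite big_cons -IH -(zsumZ (c i) M0 (H i)) -(zsumD ci0 M'0 Hi H').
by congr zsum; apply/funext => k; rewrite big_cons.
Qed.

Variables (B : 'M[R]_d) (s : R).
Hypotheses (uB : B \in unitmx) (s0 : 0 < s) (d0 : (0 < d)%N).
Local Notation al k := (dlatt B k).

Definition dual_mx : 'M[R]_d := (2 * pi) *: (invmx B)^T.

Lemma dual_mx_unit : dual_mx \in unitmx.
Proof.
rewrite /dual_mx unitmxZ ?unitmx_tr ?unitmx_inv// unitfE gt_eqF// mulr_gt0//.
exact: pi_gt0.
Qed.

Lemma w1_al k : w1 (al k) <= CN dual_mx 1 * omega 1 k.
Proof.
have := w1_grid_pt1 dual_mx_unit k (lexx (1 : R)).
by rewrite /grid_pt invr1 scale1r.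
Qed.

Definition coef_decay rho M a b := forall k, `|a k| + `|b k| <= M * expR (- (rho * pow_norm s (al k))).

Lemma exp_omega rho : 0 < rho -> exists2 A : R, 0 <= A & forall k, expR (- (rho * pow_norm s (al k))) <= A * omega 1 k.
Proof.
move=> r0; have [A A0 HA] := @pow_norm_w1 R d s rho s0 r0.
exists (A * CN dual_mx 1); first by rewrite mulr_ge0 ?CN_ge0.
move=> k; rewrite expRN -[leLHS]mul1r ler_pdivrMr ?expR_gt0//; apply: le_trans (HA (al k)) _.
by rewrite ler_wpM2r ?expR_ge0// -mulrA ler_wpM2l// w1_al.
Qed.

Lemma poly_exp rho n : 0 < rho -> exists2 A : R, 0 <= A & forall x, `|x| ^+ n <= A * expR (rho * pow_norm s x).
Proof.
move=> r0; pose h := (s / rho) `^ s.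
have h0 : 0 < h by rewrite powR_gt0// divr_gt0.
exists (h ^+ n * (n`!%:R `^ s)) => [|x]; first by rewrite mulr_ge0 ?powR_ge0// exprn_ge0// ltW.
have := pow_expt n s0 h0 (normr_ge0 x); rewrite expt_powR// => h1.
by apply: le_trans h1 _; rewrite mulrC.
Qed.

Lemma coef_decay_ge0 rho M a b : coef_decay rho M a b -> 0 <= M.
Proof.
move=> /(_ 0) H; have : 0 <= M * expR (- (rho * pow_norm s (al 0))) by apply: le_trans H; rewrite addr_ge0.
by rewrite pmulr_lge0// expR_gt0.
Qed.

Lemma coef_decay_poly rho M a b n : 0 < rho -> coef_decay rho M a b -> exists2 A : R, 0 <= A &
  forall k, (`|a k| + `|b k|) * `|al k| ^+ n <= A * expR (- (rho / 2 * pow_norm s (al k))).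
Proof.
move=> r0 H; have M0 := coef_decay_ge0 H; have r2 : 0 < rho / 2 by rewrite divr_gt0.
have [A A0 HA] := poly_exp n r2.
exists (M * A); first by rewrite mulr_ge0.
move=> k; apply: le_trans (ler_pM _ _ (H k) (HA (al k))) _; rewrite ?addr_ge0 ?exprn_ge0//.
by rewrite mulrACA -expRD; apply: le_eq; congr (_ * expR _); field.
Qed.

Lemma coef_decay_omega rho M a b n : 0 < rho -> coef_decay rho M a b -> exists2 A : R, 0 <= A &
  forall k, (`|a k| + `|b k|) * `|al k| ^+ n <= A * omega 1 k.
Proof.
move=> r0 H; have r2 : 0 < rho / 2 by rewrite divr_gt0.
have [A A0 HA] := coef_decay_poly n r0 H; have [A' A'0 HA'] := exp_omega r2.
exists (A * A'); first by rewrite mulr_ge0.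
by move=> k; apply: le_trans (HA k) _; rewrite -[leRHS]mulrA ler_wpM2l.
Qed.

Definition trig_series a b x : R := zsum (fun k => trig (a k) (b k) (al k) x).

Lemma trig_series_dom rho M a b : 0 < rho -> coef_decay rho M a b -> exists2 A : R, 0 <= A &
  forall k x, `|trig (a k) (b k) (al k) x| <= A * omega 1 k.
Proof.
move=> r0 H; have [A A0 HA] := coef_decay_omega 0 r0 H; exists A => // k x.
by apply: le_trans (trig_le _ _ _ _) _; have := HA k; rewrite expr0 mulr1.
Qed.

Lemma coef_decay_partial rho M a b j : 0 < rho -> coef_decay rho M a b -> exists2 M' : R, 0 <= M' &
  coef_decay (rho / 2) M' (fun k => b k * al k 0 j) (fun k => - (a k * al k 0 j)).
Proof.
move=> r0 H; have [A A0 HA] := coef_decay_poly 1 r0 H; exists A => // k.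
apply: le_trans (HA k); rewrite normrN !normrM -mulrDl addrC expr1.
by rewrite ler_wpM2l ?addr_ge0// vnorm_coord.
Qed.

(** The Taylor remainder of each term is quadratic in [y] with a factor [|al k|^2]. These factors
    are summable against the coefficients, so the whole series has a quadratic remainder and
    [diff_quadratic] applies. *)
Lemma trig_series_diff rho M a b x : 0 < rho -> coef_decay rho M a b ->
  differentiable (trig_series a b) x /\
  forall j, partial j (trig_series a b) x = trig_series (fun k => b k * al k 0 j) (fun k => - (a k * al k 0 j)) x.
Proof.
move=> r0 H.
pose S j := trig_series (fun k => b k * al k 0 j) (fun k => - (a k * al k 0 j)).
have [A A0 HA] := coef_decay_omega 2 r0 H; have [A1 A10 HA1] := trig_series_dom r0 H.
have [A2 A20 HA2] : exists2 A2 : R, 0 <= A2 & forall j k, `|partial j (trig (a k) (b k) (al k)) x| <= A2 * omega 1 k.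
  have [A3 A30 HA3] := coef_decay_omega 1 r0 H; exists A3 => // j k.
  apply: le_trans (trig_xp [:: j] _ _ _ _) _; apply: le_trans (HA3 k).
  by rewrite mulrC ler_wpM2l ?addr_ge0// expr1 /xp big_cons big_nil mulr1 vnorm_coord.
suff [D1 D2] : differentiable (trig_series a b) x /\ forall j, partial j (trig_series a b) x = (\row_j S j x : vec) 0 j.
  by split=> // j; rewrite D2 mxE.
apply: (@diff_quadratic _ _ _ (d%:R ^+ 2 * A * 5 ^+ d)); first by rewrite !mulr_ge0 ?exprn_ge0.
move=> y _.
have SE j : S j x = zsum (fun k => partial j (trig (a k) (b k) (al k)) x).
  by rewrite /S /trig_series; congr zsum; apply/funext => k; rewrite partial_trig.
have [[M' M'0 HM'] Ls] := zsum_lsum (index_enum 'I_d) (fun j => y 0 j) A20 HA2.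
have -> : inner y (\row_j S j x) = zsum (fun k => \sum_(j < d) y 0 j * partial j (trig (a k) (b k) (al k)) x).
  by rewrite Ls /inner; apply: eq_bigr => j _; rewrite mxE SE.
rewrite /trig_series.
have N (f : ivec -> R) Mf : (forall k, `|f k| <= Mf * omega 1 k) -> forall k, `|-1 * f k| <= Mf * omega 1 k.
  by move=> Hf k; rewrite mulN1r normrN.
have Z (f : ivec -> R) Mf : 0 <= Mf -> (forall k, `|f k| <= Mf * omega 1 k) -> - zsum f = zsum (fun k => -1 * f k).
  by move=> Mf0 Hf; rewrite (zsumZ _ Mf0 Hf) mulN1r.
rewrite (Z _ _ A10 (HA1 ^~ x)) (Z _ _ M'0 HM').
have D1 k : `|trig (a k) (b k) (al k) (x + y) + -1 * trig (a k) (b k) (al k) x| <= (A1 + A1) * omega 1 k.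
  rewrite mulrDl; apply: le_trans (ler_normD _ _) _; apply: lerD; first exact: HA1.
  exact: (N _ _ (HA1 ^~ x)).
rewrite -(zsumD A10 A10 (HA1 ^~ (x + y)) (N _ _ (HA1 ^~ x))).
rewrite -(zsumD (addr_ge0 A10 A10) M'0 D1 (N _ _ HM')).
have Q k : `|trig (a k) (b k) (al k) (x + y) + -1 * trig (a k) (b k) (al k) x +
    -1 * (\sum_(j < d) y 0 j * partial j (trig (a k) (b k) (al k)) x)| <= d%:R ^+ 2 * A * `|y| ^+ 2 * omega 1 k.
  rewrite !mulN1r; have := trig_quadratic (a k) (b k) (al k) x y.
  rewrite /inner; under [X in _ - X]eq_bigr => j _ do rewrite mxE.
  move=> h; apply: le_trans h _; rewrite [leRHS](_ : _ = d%:R ^+ 2 * (A * omega 1 k) * `|y| ^+ 2); last by ring.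
  by rewrite ler_wpM2r ?exprn_ge0// ler_wpM2l ?exprn_ge0.
have q0 : 0 <= d%:R ^+ 2 * A * `|y| ^+ 2 by rewrite !mulr_ge0 ?exprn_ge0.
apply: (zsum_bound q0 Q) => r ur; apply: le_trans (ler_norm_sum _ _ _) _.
apply: le_trans (ler_sum _ (fun k _ => Q k)) _.
rewrite -mulr_sumr [leRHS]mulrAC ler_wpM2l//; have := sum_omega_le (lexx (1 : R)) ur.
by rewrite mulr1.
Qed.

Lemma trig_series_partial rho M a b j : 0 < rho -> coef_decay rho M a b ->
  partial j (trig_series a b) = trig_series (fun k => b k * al k 0 j) (fun k => - (a k * al k 0 j)).
Proof. by move=> r0 H; apply/funext => x; have [_ ->] := trig_series_diff x r0 H. Qed.

Lemma smooth_trig_series rho M a b : 0 < rho -> coef_decay rho M a b -> smoothR (trig_series a b).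
Proof.
move=> r0 H.
(* The rate is part of the class because [coef_decay_partial] halves it at every derivative. *)
pose cl (f : vec -> R) := exists a b rho M, [/\ 0 < rho, coef_decay rho M a b & f = trig_series a b].
apply: (@smooth_ind _ _ cl); last by exists a, b, rho, M.
  by move=> f [a' [b' [r' [M' [r'0 H' ->]]]]] x; have [] := trig_series_diff x r'0 H'.
move=> f j [a' [b' [r' [M' [r'0 H' ->]]]]].
have [M2 _ H2] := coef_decay_partial j r'0 H'.
eexists _, _, (r' / 2), M2; split; [by rewrite divr_gt0|exact: H2|exact: trig_series_partial H'].
Qed.

Lemma trig_series_partials rho M a b l : 0 < rho -> coef_decay rho M a b -> exists a' b' rho' M',
  [/\ 0 < rho', coef_decay rho' M' a' b', partials l (trig_series a b) = trig_series a' b' &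
   forall k, trig (a' k) (b' k) (al k) = partials l (trig (a k) (b k) (al k))].
Proof.
move=> r0 H; elim: l => [|j l [a' [b' [r' [M' [r'0 H' E E']]]]]].
  by exists a, b, rho, M.
have [M2 _ H2] := coef_decay_partial j r'0 H'.
eexists _, _, (r' / 2), M2; split; [by rewrite divr_gt0|exact: H2| |].
  by rewrite /= E (trig_series_partial _ r'0 H').
by move=> k; rewrite /= -E' partial_trig.
Qed.

(** To avoid the rates lost in [trig_series_partials], its terms are estimated from the original
    coefficients. Of the rate [2 d rho], one half absorbs the growth [d rho] of the monomials by
    [xp_expt], and the other half makes the series converge. *)
Lemma trig_series_bound rho M a b : 0 < rho -> coef_decay (2 * d%:R * rho) M a b -> exists2 A : R, 0 <= A &
  forall l x, `|partials l (trig_series a b) x| <= A * bd s ((s / rho) `^ s) l.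
Proof.
move=> r0 H; have M0 := coef_decay_ge0 H.
have dR : 0 < d%:R :> R by rewrite ltr0n.
have dr0 : 0 < d%:R * rho by rewrite mulr_gt0.
have ddr0 : 0 < 2 * d%:R * rho by rewrite -mulrA mulr_gt0.
have [A A0 HA] := exp_omega dr0.
set h := (s / rho) `^ s; have h0 : 0 < h by rewrite powR_gt0// divr_gt0.
exists (M * A * 5 ^+ d); first by rewrite mulr_ge0 ?exprn_ge0// mulr_ge0.
move=> l x; have [a' [b' [r' [M' [r'0 H' -> E']]]]] := trig_series_partials l ddr0 H.
have b0 : 0 <= bd s h l by rewrite bd_ge0// ltW.
have Q k : `|trig (a' k) (b' k) (al k) x| <= M * A * bd s h l * omega 1 k.
  rewrite E'; apply: le_trans (trig_xp _ _ _ _ _) _.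
  have h1 := xp_expt l s0 h0 (normr_ge0 (al k)) (lexx _).
  rewrite expt_powR// -expRM_natl in h1.
  apply: le_trans (ler_pM _ _ h1 (H k)) _; rewrite ?addr_ge0//.
  rewrite [leLHS](_ : _ = M * bd s h l * (expR (d%:R * (rho * pow_norm s (al k))) * expR (- (2 * d%:R * rho * pow_norm s (al k))))); last by ring.
  rewrite -expRD [leRHS](_ : _ = M * bd s h l * (A * omega 1 k)); last by ring.
  apply: ler_wpM2l; first exact: mulr_ge0.
  apply: le_trans (HA k); apply: le_eq; congr expR; ring.
have q0 : 0 <= M * A * bd s h l by rewrite mulr_ge0// mulr_ge0.
apply: (zsum_bound q0 Q) => r ur; apply: le_trans (ler_norm_sum _ _ _) _.
apply: le_trans (ler_sum _ (fun k _ => Q k)) _.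
rewrite -mulr_sumr [leRHS]mulrAC ler_wpM2l//; have := sum_omega_le (lexx (1 : R)) ur.
by rewrite mulr1.
Qed.

Lemma trig_cexpi (a b : R) z x : trig a b z x = complex.Re ((a +i* - b)%C * cexpi (inner x z)).
Proof. by rewrite /trig cReM /=; ring. Qed.

Lemma trig_series_periodic a b x m : trig_series a b (x + latt B m) = trig_series a b x.
Proof.
congr zsum; apply/funext => k; rewrite !trig_cexpi innerDl cexpiD inner_latt//.
by rewrite cexpi_int mulr1.
Qed.

Lemma trig_series_approx rho M a b : 0 < rho -> coef_decay rho M a b -> exists2 A : R, 0 <= A & forall K x,
  `|trig_series a b x - \sum_(k <- zbox K) trig (a k) (b k) (al k) x| <= A * @tau R d K.
Proof.
move=> r0 H; have [A A0 HA] := trig_series_dom r0 H; exists (2 * A); first by rewrite mulr_ge0.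
by move=> K x; rewrite -mulrA; apply: (zsum_approx A0 (HA ^~ x) (uniq_zbox K)).
Qed.

End Series.

(** * The short-time Fourier transform *)

Section Stft.
Local Open Scope ring_scope.
Local Open Scope classical_set_scope.
Context {R : realType} {d : nat}.
Local Notation ivec := 'rV[int]_d.
Local Notation vec := 'rV[R]_d.
Local Notation C := R[i].
Implicit Types (k m : ivec) (x y z xi eta : vec) (psi F : vec -> C) (A M Q e s t h r rho eps : R)
  (l : seq 'I_d) (c : ivec -> C) (K n : nat) (j : 'I_d) (f g : vec -> R).

Lemma ccvg_le (v : nat -> C) (L : C) Q : (forall n, cabs (v n) <= Q) -> ccvg v L -> cabs L <= Q.
Proof.
move=> H cv; apply/ler_addgt0Pr => e e0; have [N0 HN] := cv e e0.
have := HN N0 (leqnn _) => h; rewrite -[L](subrK (v N0)) addrC.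
apply: le_trans (cabsD _ _) _; apply: lerD => //; rewrite cabs_sub; exact: ltW.
Qed.

Lemma ccvg_unique (v : nat -> C) (L L' : C) : ccvg v L -> ccvg v L' -> L = L'.
Proof.
move=> h h'; apply/eqP; rewrite -subr_eq0; apply/eqP/cabs_eq0/eqP; rewrite eq_le cabs_ge0 andbT.
apply/ler_addgt0Pr => e e0; rewrite add0r; have e2 : 0 < e / 2 by rewrite divr_gt0.
have [N1 H1] := h _ e2; have [N2 H2] := h' _ e2.
have h1 := H1 (maxn N1 N2) (leq_maxl _ _); have h2 := H2 (maxn N1 N2) (leq_maxr _ _).
apply: le_trans (cabs_dist (v (maxn N1 N2)) _ _) _; rewrite cabs_sub; apply: ltW.
by lra.
Qed.

Definition decay_rate s h : R := s / 2 * (h^-1) `^ (1 / s).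

Lemma decay_rate_gt0 s h : 0 < s -> 0 < h -> 0 < decay_rate s h.
Proof. by move=> s0 h0; rewrite mulr_gt0 ?divr_gt0// powR_gt0// invr_gt0. Qed.

Lemma decay_rateE s h (xi : vec) : 0 < s -> 0 < h -> s / 2 * (`|xi| / h) `^ (1 / s) = decay_rate s h * pow_norm s xi.
Proof. by move=> s0 h0; rewrite powRM ?invr_ge0 ?(ltW h0)// /decay_rate /pow_norm; ring. Qed.

(** For a window in [Sigma] every scale [h] is allowed, hence every rate of decay of its Fourier
    transform. *)
Lemma decay_rate_onto s rho : 0 < s -> 0 < rho -> exists2 h : R, 0 < h & decay_rate s h = rho.
Proof.
move=> s0 r0; have q0 : 0 < 2 * rho / s by rewrite divr_gt0// mulr_gt0.
exists (((2 * rho / s) `^ s)^-1); first by rewrite invr_gt0 powR_gt0.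
rewrite /decay_rate invrK -powRrM (_ : s * (1 / s) = 1); last by field; rewrite gt_eqF.
by rewrite powRr1 ?(ltW q0)//; field; rewrite gt_eqF.
Qed.

Section Fixed.
Variables (B : 'M[R]_d) (sg : bool) (s s1 t1 : R) (u : (vec -> C) -> C) (phi : vec -> C).
Hypotheses (d0 : (0 < d)%N) (uB : B \in unitmx) (s0 : 0 < s) (s10 : 0 < s1) (t10 : 0 < t1)
  (lu : GSlinear sg s1 t1 u) (cu : GScont sg s1 t1 u)
  (pu : periodic_dist B (inGS sg s1 t1) u) (Tphi : inGS sg s1 t1 phi).
Local Notation T := (inGS sg s1 t1).
Local Notation al k := (dlatt B k).
Local Notation c2p := ((2 * pi) `^ (d%:R / 2) : R).

Definition atom x xi : vec -> C := fun y => conjc (phi (y - x)) * cexpi (- inner y xi).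
Definition phat xi : C := intC (fun y => conjc (phi y) * cexpi (inner y xi)).

Lemma c2p_gt0 : 0 < c2p.
Proof. by rewrite powR_gt0// mulr_gt0// pi_gt0. Qed.

Lemma T_conj_exp xi : T (fun y => conjc (phi y) * cexpi (inner y xi)).
Proof.
have := T_mod s10 t10 xi 0 (T_conj s10 t10 Tphi); congr inGS.
by apply/funext => y; rewrite addr0.
Qed.

Lemma T_atom x xi : T (atom x xi).
Proof.
have := T_mod s10 t10 (- xi) 0 (T_shift s10 t10 (- x) (T_conj s10 t10 Tphi)); congr inGS.
by apply/funext => y; rewrite addr0 innerNr.
Qed.

Lemma cabs_STFT x xi : cabs (STFT u phi x xi) = c2p^-1 * cabs (u (atom x xi)).
Proof.
rewrite /STFT cabsM cabs_Rc powRN ger0_norm// invr_ge0 ltW//; exact: c2p_gt0.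
Qed.

Lemma IC_atom x xi k : intC (fun y => atom x xi y * chi B k y) =
  cexpi (inner x (al k - xi)) * phat (al k - xi).
Proof.
pose G y := conjc (phi y) * cexpi (inner y (al k - xi)).
have TG : T G by exact: T_conj_exp.
have [A HA] := T_lipC s10 t10 TG.
rewrite -[phat _]/(intC G) -(IC_shift (- x) HA) -(T_scaleIC _ s10 t10 (T_shift s10 t10 _ TG)).
congr intC; apply/funext => y; rewrite /G /atom /chi -mulrA -cexpiD [RHS]mulrCA -cexpiD.
by congr (_ * cexpi _); rewrite innerDl innerNl !innerDr !innerNr; ring.
Qed.

Lemma fourierE psi k : fourier psi (- al k) = Rc (c2p^-1) * intC (fun y => psi y * chi B k y).
Proof.
rewrite /fourier powRN; congr (_ * intC _); apply/funext => y.
by rewrite /chi innerNr opprK.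
Qed.

Lemma dual_sumE c psi N : Rc c2p * boxsum N (fun k => c k * fourier psi (- al k)) =
  boxsum N (fun k => c k * intC (fun y => psi y * chi B k y)).
Proof.
rewrite !boxsumE mulr_sumr; apply: eq_bigr => k _; rewrite fourierE.
rewrite mulrCA [Rc c2p * _]mulrA -RcM mulfV ?Rc1 ?mul1r// gt_eqF//; exact: c2p_gt0.
Qed.

Definition phat_decay rho := exists2 A : R, 0 <= A & forall xi, cabs (phat xi) <= A * expR (- (rho * pow_norm s xi)).

Lemma GBW_phat t h M : 0 < h -> GBW s t h M phi -> phat_decay (decay_rate s h).
Proof.
move=> h0 H; have [sp a b] := GBW_conj H; have M0 := GBW_ge0 H.
exists (2 `^ s * 4 * @CI R d * M).
  by apply: mulr_ge0 => //; apply: mulr_ge0; [rewrite mulr_ge0 ?powR_ge0|exact: CI_ge0].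
move=> xi; have := fourier_decay xi d0 s0 h0 sp (RBW_WB a) (RBW_WB b).
by rewrite decay_rateE.
Qed.

Local Notation D := ((d%:R : R) `^ (1 / s) * 2 `^ (1 / s)).

Lemma D_gt0 : 0 < D. Proof. by rewrite mulr_gt0 ?powR_gt0// ltr0n. Qed.

(** In [D], [2^(1/s)] is the constant of the quasi-triangle inequality for the power [1/s], and
    [d^(1/s)] compares the Euclidean norm with the sup norm. *)
Lemma enorm_split x y : enorm (x + y) `^ (1 / s) <= D * (pow_norm s x + pow_norm s y).
Proof.
apply: le_trans (enorm_pow_norm _ s0) _; rewrite -mulrA ler_wpM2l ?powR_ge0//; exact: pow_normD.
Qed.

(** The [k]-th term is [c k] times a phase and the Fourier transform at [al k - xi]. The growth of
    [c k] is distributed over [al k - xi] and [xi]. The first share is beaten by the decay, as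
    [eps * D < rho]; the second gives the exponent [eps * D]. *)
Lemma dual_stft c eps rho e : 0 <= eps -> 0 < e -> eps * D < rho -> phat_decay rho ->
  coef_growth B s eps c ->
  (forall psi, T psi -> ccvg (fun N => Rc c2p * boxsum N (fun k => c k * fourier psi (- al k))) (u psi)) ->
  stft_bound u phi s (eps * D + e).
Proof.
move=> eps0 e0 er [A A0 HA] [K0 HK] Hu.
have K00 : 0 <= K0.
  have := le_trans (cabs_ge0 _) (HK 0); by rewrite pmulr_lge0// expR_gt0.
have er0 : 0 < rho - eps * D by rewrite subr_gt0.
have [C1 C10 H1] := @pow_norm_w1 R d s (rho - eps * D) s0 er0.
have [C2 C20 H2] := @pow_norm_w1 R d s e s0 e0.
pose Q := K0 * A * (C1 * (C2 * (2 ^+ d * CN (dual_mx B) 1))).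
have Bu := dual_mx_unit uB; have CN0 := CN_ge0 (dual_mx B) 1.
have Q0 : 0 <= Q.
  apply: mulr_ge0; first exact: mulr_ge0.
  by apply: mulr_ge0 => //; apply: mulr_ge0 => //; apply: mulr_ge0 => //; exact: exprn_ge0.
exists (c2p^-1 * (Q * 5 ^+ d)) => x xi.
rewrite cabs_STFT -mulrA ler_wpM2l ?invr_ge0 ?(ltW c2p_gt0)//.
apply: ccvg_le (Hu _ (T_atom x xi)) => N; rewrite dual_sumE boxsumE.
apply: le_trans (cabs_sum _ _) _.
set X := expR _.
have key k : cabs (c k * intC (fun y => atom x xi y * chi B k y)) <= Q * X * omega 1 k.
  rewrite IC_atom !cabsM cabs_cexpi mul1r.
  apply: le_trans (ler_pM (cabs_ge0 _) (cabs_ge0 _) (HK k) (HA _)) _.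
  set z := al k - xi.
  have e1 : eps * enorm (al k) `^ (1 / s) <= eps * D * (pow_norm s z + pow_norm s xi).
    by rewrite -mulrA ler_wpM2l// -(subrK xi (al k)); exact: enorm_split.
  have e2 : expR (eps * enorm (al k) `^ (1 / s)) * expR (- (rho * pow_norm s z)) <=
      expR (eps * D * pow_norm s xi) * expR (- ((rho - eps * D) * pow_norm s z)).
    rewrite -!expRD ler_expR; lra.
  have e3 : expR (- ((rho - eps * D) * pow_norm s z)) <= C1 * w1 z.
    by rewrite expRN -[leLHS]mul1r ler_pdivrMr ?expR_gt0.
  (* The remaining decay is centred at [xi]. Moving it to a summable weight in [k] costs an inverse
     [w1 xi], which the extra exponent [e] covers. *)
  have e4 : w1 z <= C2 * (2 ^+ d * CN (dual_mx B) 1 * omega 1 k) * expR (e * pow_norm s xi).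
    apply: (@le_trans _ _ (w1 z * (C2 * w1 xi * expR (e * pow_norm s xi)))).
      by rewrite ler_peMr ?w1_ge0.
    rewrite [leLHS](_ : _ = C2 * (w1 z * w1 xi) * expR (e * pow_norm s xi)); last by ring.
    rewrite ler_wpM2r ?expR_ge0// ler_wpM2l//; apply: le_trans (w1_mul_le _ _) _.
    by rewrite -mulrA ler_wpM2l ?exprn_ge0// /z subrK w1_al.
  have e5 : expR (eps * D * pow_norm s xi) * expR (e * pow_norm s xi) <= X.
    rewrite /X -expRD ler_expR -mulrDl ler_wpM2l ?pow_norm_enorm//.
    by rewrite addr_ge0 ?(ltW e0)// mulr_ge0// ltW// D_gt0.
  rewrite [leLHS](_ : _ = K0 * A * (expR (eps * enorm (al k) `^ (1 / s)) * expR (- (rho * pow_norm s z)))); last by ring.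
  apply: le_trans (ler_wpM2l (mulr_ge0 K00 A0) e2) _.
  have e6 := ler_wpM2l (mulr_ge0 K00 A0) (ler_wpM2l (expR_ge0 (eps * D * pow_norm s xi)) (le_trans e3 (ler_wpM2l C10 e4))).
  apply: le_trans e6 _.
  rewrite [leLHS](_ : _ = Q * omega 1 k * (expR (eps * D * pow_norm s xi) * expR (e * pow_norm s xi))); last by rewrite /Q; ring.
  rewrite [leRHS](_ : _ = Q * omega 1 k * X); last by ring.
  by rewrite ler_wpM2l// mulr_ge0 ?omega_ge0.
apply: (@le_trans _ _ (\sum_(k <- zbox N) Q * X * omega 1 k)); first by apply: ler_sum_in => k _.
rewrite -mulr_sumr [leRHS]mulrAC ler_wpM2l//; first by rewrite mulr_ge0// expR_ge0.
by have := sum_omega_le (lexx (1 : R)) (uniq_zbox (d := d) N); rewrite mulr1.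
Qed.

Lemma rep_phi : phi <> (fun _ => 0) -> exists c eta (A : R), [/\ 0 <= A,
  (forall k Q, (forall x, cabs (STFT u phi x (al k - eta)) <= Q) -> cabs (c k) <= A * Q) &
  forall psi, T psi -> ccvg (fun K => boxsum K (fun k => c k * intC (fun y => psi y * chi B k y))) (u psi)].
Proof.
move=> p0; have cp0 : (fun y => conjc (phi y)) <> (fun _ => 0).
  move=> E; apply: p0; apply/funext => y; have := congr1 (fun G : vec -> C => conjc (G y)) E.
  by rewrite /= conjcK => ->; rewrite /conjc /= oppr0.
have [eta He] := fourier_nonzero s10 t10 (T_conj s10 t10 Tphi) cp0.
pose g k y := conjc (phi y) * cexpi (inner y (eta - al k)).
have Tg k : T (g k) by exact: T_conj_exp.
have gE k : (fun y => g k y * chi B k y) = fun y => conjc (phi y) * cexpi (inner y eta).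
  by apply/funext => y; rewrite /g /chi -mulrA -cexpiD -innerDr subrK.
have g0 k : intC (fun y => g k y * chi B k y) != 0 by rewrite gE.
have [c [Hc Hr]] := representation uB s10 t10 lu cu pu Tg g0.
exists c, eta, (c2p / cabs (phat eta)); split=> //.
  by rewrite divr_ge0 ?cabs_ge0// ltW// c2p_gt0.
move=> k Q HQ; have := Hc k (c2p * Q); rewrite gE mulrAC; apply=> x.
rewrite (_ : (fun y => _) = fun y => cexpi (inner x (al k - eta)) * atom x (al k - eta) y); last first.
  apply/funext => y; rewrite /g /atom [RHS]mulrCA -cexpiD; congr (_ * cexpi _).
  by rewrite innerDl innerNl !innerDr !innerNr; ring.
rewrite (u_scale _ lu (T_atom _ _)) cabsM cabs_cexpi mul1r.
have := HQ x; rewrite cabs_STFT mulrC ler_pdivrMr ?c2p_gt0//.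
by rewrite mulrC.
Qed.

(** The fixed shift [eta] only contributes the constant [exp (r D |eta|^(1/s))]. *)
Lemma stft_coef c eta A r : 0 <= r -> 0 <= A ->
  (forall k Q, (forall x, cabs (STFT u phi x (al k - eta)) <= Q) -> cabs (c k) <= A * Q) ->
  stft_bound u phi s r -> coef_growth B s (r * D) c.
Proof.
move=> r0 A0 H [K HK]; exists (A * (`|K| * expR (r * D * pow_norm s eta))) => k.
apply: le_trans (H k (`|K| * expR (r * enorm (al k - eta) `^ (1 / s))) _) _.
  move=> x; apply: le_trans (HK _ _) _; by rewrite ler_wpM2r ?expR_ge0 ?ler_norm.
rewrite -!mulrA ler_wpM2l// ler_wpM2l// -expRD ler_expR.
have h1 := enorm_split (al k) (- eta); rewrite pow_normN in h1.
have h2 : r * enorm (al k - eta) `^ (1 / s) <= r * (D * (pow_norm s (al k) + pow_norm s eta)) by rewrite ler_wpM2l.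
have h3 : r * D * pow_norm s (al k) <= r * D * enorm (al k) `^ (1 / s).
  by rewrite ler_wpM2l ?pow_norm_enorm// mulr_ge0// ltW// D_gt0.
by move: h2 h3; rewrite -!mulrA; lra.
Qed.

(** Here the quasi-triangle inequality bounds [al k - eta] from below, so its constant [2^(1/s)]
    reduces the rate. *)
Lemma stft_coef_decay c eta A r : 0 < r -> 0 <= A ->
  (forall k Q, (forall x, cabs (STFT u phi x (al k - eta)) <= Q) -> cabs (c k) <= A * Q) ->
  stft_bound u phi s (- r) ->
  exists M, forall k, cabs (c k) <= M * expR (- (r / 2 `^ (1 / s) * pow_norm s (al k))).
Proof.
move=> r0 A0 H [K HK]; exists (A * (`|K| * expR (r * pow_norm s eta))) => k.
apply: le_trans (H k (`|K| * expR (- r * enorm (al k - eta) `^ (1 / s))) _) _.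
  move=> x; apply: le_trans (HK _ _) _; by rewrite ler_wpM2r ?expR_ge0 ?ler_norm.
rewrite -!mulrA ler_wpM2l// ler_wpM2l// -expRD ler_expR.
have p2 : 0 < 2 `^ (1 / s) :> R by rewrite powR_gt0.
have h1 := pow_normD (al k - eta) eta s0; rewrite subrK in h1.
have h2 := pow_norm_enorm (al k - eta) s0.
have h3 : pow_norm s (al k) / 2 `^ (1 / s) <= pow_norm s (al k - eta) + pow_norm s eta by rewrite ler_pdivrMr// mulrC.
have h4 : r / 2 `^ (1 / s) * pow_norm s (al k) <= r * (pow_norm s (al k - eta) + pow_norm s eta).
  by rewrite -mulrA [_^-1 * _]mulrC ler_wpM2l// ltW.
have h5 := ler_wpM2l (ltW r0) h2.
rewrite -mulrA mulrDr in h4.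
move: h4 h5; rewrite mulNr.
move: (r * enorm _ `^ _) (r * pow_norm s (al k - eta)) (r * pow_norm s eta) (r * (_ * _)) => a1 a2 a3 a4.
by lra.
Qed.

Lemma lip1_bounded f A : smoothR f -> (forall l x, (size l <= 1)%N -> `|partials l f x| <= A) ->
  lip (fun=> 1) (A + d%:R * A) f.
Proof.
move=> sf H; have A0 : 0 <= A := le_trans (normr_ge0 _) (H [::] 0 isT).
have dA : 0 <= d%:R * A by rewrite mulr_ge0.
split=> [x|x y _]; rewrite mulr1; first by apply: le_trans (H [::] x isT) _; rewrite lerDl.
have [t _ ->] := mvt_line x y (fun z => smooth_diff z sf).
apply: le_trans (ler_norm_sum _ _ _) _.
apply: (@le_trans _ _ (\sum_(j < d) (A * `|y|))).
  apply: ler_sum => j _; rewrite normrM mulrC; apply: ler_pM => //; last exact: vnorm_coord.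
  exact: (H [:: j]).
by rewrite sum_const_ord mulrA ler_wpM2r// lerDr.
Qed.

Lemma lipC_mul M A F psi : lip (fun=> 1) A (reF F) -> lip (fun=> 1) A (imF F) -> lipC M psi ->
  exists M', lipC M' (fun y => F y * psi y).
Proof.
move=> a b [p q]; have A0 : 0 <= A := lip_ge0 ltr01 a.
have P g f : lip w1 M g -> lip (fun=> 1) A f -> lip w1 (3 * (M * A)) (fun x => g x * f x).
  by move=> hg hf; apply: lipM => // x; exact: w1_ge0.
have E1 : reF (fun y => F y * psi y) = fun y => reF psi y * reF F y + (-1) * (imF psi y * imF F y).
  by apply/funext => y; rewrite /reF cReM /imF; ring.
have E2 : imF (fun y => F y * psi y) = fun y => imF psi y * reF F y + 1 * (reF psi y * imF F y).
  by apply/funext => y; rewrite /imF cImM /reF; ring.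
exists (3 * (M * A) + `|1| * (3 * (M * A))); split; rewrite ?E1 ?E2.
  by rewrite -(normrN 1); apply: lipD; [exact: P|apply: lipZ; exact: P].
by apply: lipD; [exact: P|apply: lipZ; exact: P].
Qed.

(** Up to a phase, the short-time Fourier transform at [x] is the Fourier transform of [F (. + x)]
    times the conjugate window. Bounds on [F] over the whole space are translation invariant, hence
    the uniformity in [x]; the scale [2 * h] is that of a product. *)
Lemma gevrey_stft t h M M' F : 0 < h -> DBC s h M F -> GBW s t h M' phi ->
  (forall psi, T psi -> u psi = intC (fun y => F y * psi y)) ->
  stft_bound u phi s (- (decay_rate s (2 * h) / d%:R `^ (1 / s))).
Proof.
move=> h0 DF Hphi Hu; have h20 : 0 < 2 * h by rewrite mulr_gt0.
have dd : 0 < (d%:R : R) `^ (1 / s) by rewrite powR_gt0// ltr0n.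
have bp := GBW_conj Hphi.
exists (c2p^-1 * (2 `^ s * 4 * @CI R d * (2 * (M' * M)))) => x xi.
have DFx : DBC s h M (fun y => F (y + x)).
  case: DF => sF a b; split; first exact: smoothC_shift.
    by move=> l y; have := a l (y + x); rewrite -[partials l _ _]/((fun y => partials l (reF F) (y + x)) y) -partials_shift.
  by move=> l y; have := b l (y + x); rewrite -[partials l _ _]/((fun y => partials l (imF F) (y + x)) y) -partials_shift.
have bH := GBW_mul (ltW s0) (ltW h0) bp DFx.
set H := fun y => _ in bH.
pose G (b : R) y := H y * cexpi (inner y (- xi) + b).
have lG b : exists A, lipC A (G b).
  have bG := GBW_mul (ltW s0) (ltW h20) bH (DBC_cexpi b s0 h20 (normr_ge0 (- xi)) (lexx _)).
  have h40 : 0 <= 2 * (2 * h) by rewrite mulr_ge0// ltW.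
  have [A [L1 L2]] := GBW_lip2 (ltW s0) h40 bG.
  by exists A; have A0 := lip_ge0 (w2_gt0 _) L1; split; exact: lip_w21.
have [A1 L1] := lG (- inner x xi); have [A0 L0] := lG 0.
have E : u (atom x xi) = cexpi (- inner x xi) * intC (fun y => H y * cexpi (inner y (- xi))).
  rewrite Hu; last exact: T_atom.
  transitivity (intC (G (- inner x xi))).
    rewrite -(IC_shift (- x) L1); congr intC; apply/funext => y; rewrite /G /H subrK /atom.
    rewrite [RHS](_ : _ = F y * (conjc (phi (y - x)) * cexpi (inner (y - x) (- xi) - inner x xi))); last by ring.
    by congr (_ * (_ * cexpi _)); rewrite innerDl innerNl !innerNr; ring.
  have := IC_lin (cexpi (- inner x xi)) 0 L0 L0; rewrite mul0r addr0.
  rewrite [X in _ = _ * intC X -> _](_ : _ = fun y => H y * cexpi (inner y (- xi))); last first.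
    by apply/funext => y; rewrite /G addr0.
  move=> <-; congr intC; apply/funext => y; rewrite mul0r addr0 /G addr0 cexpiD; ring.
rewrite cabs_STFT -[leRHS]mulrA ler_wpM2l ?invr_ge0 ?(ltW c2p_gt0)//.
rewrite E cabsM cabs_cexpi mul1r; have [sH a b] := bH.
apply: le_trans (fourier_decay (- xi) d0 s0 h20 sH (RBW_WB a) (RBW_WB b)) _.
rewrite ler_wpM2l//.
  apply: mulr_ge0; last exact: RBW_ge0 a.
  by apply: mulr_ge0; [rewrite mulr_ge0 ?powR_ge0|exact: CI_ge0].
rewrite decay_rateE// ler_expR pow_normN mulNr lerN2 mulrAC -mulrA ler_wpM2l ?(ltW (decay_rate_gt0 s0 h20))//.
by rewrite ler_pdivrMr// [leRHS]mulrC; exact: enorm_pow_norm.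
Qed.

(** A compact set whose lattice translates cover the space, by [LN_near] at [N = 1]; periodicity
    spreads Gevrey bounds from it to all points. *)
Definition cell : set vec := [set x | forall i, `[- mxn B, mxn B]%classic (x ord0 i)].

Lemma compact_cell : compact cell.
Proof. by apply: (@rV_compact _ _ (fun=> `[- mxn B, mxn B]%classic)) => i; exact: segment_compact. Qed.

Lemma periodic_DBC h F : periodic_fun B F -> smoothC F -> gevrey_on s h cell F -> exists M, DBC s h M F.
Proof.
move=> pF [s1' s2'] [M HM]; exists M.
have per (f : vec -> R) l m x : (forall y, f (y + latt B m) = f y) -> partials l f (x + latt B m) = partials l f x.
  move=> Hf; rewrite -[LHS]/((fun x => partials l f (x + latt B m)) x) -partials_shift.
  by congr (partials l _ x); apply/funext.
have cl x : exists x0 m, [/\ cell x0 & x = x0 + latt B m].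
  have [m Hm] := LN_near uB x (lexx (1 : R)).
  exists (x - latt B m), m; split; last by rewrite subrK.
  rewrite /grid_pt !invr1 scale1r mulr1 in Hm.
  by move=> i; rewrite /= in_itv /= -ler_norml; apply: le_trans Hm; exact: vnorm_coord.
have bdE l : bd s h l = h ^+ mabs (cnt l) * ((mfact (cnt l))%:R `^ s) by rewrite mabs_cnt.
have main l x : `|partials l (reF F) x| <= M * bd s h l /\ `|partials l (imF F) x| <= M * bd s h l.
  have [x0 [m [cx ->]]] := cl x.
  rewrite !per; [|by move=> y; rewrite /imF pF|by move=> y; rewrite /reF pF].
  have := HM (cnt l) x0 cx; rewrite -mulrA -bdE => h1.
  rewrite !partials_mpartial//; split; apply: le_trans h1.
    exact: (cabs_re (mpartialC (cnt l) F x0)).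
  exact: (cabs_im (mpartialC (cnt l) F x0)).
by split=> // l x; rewrite mulr1; have [] := main l x.
Qed.

(** The sum of [c k * chi B k], split into real and imaginary parts so that the real series of the
    previous part apply. *)
Definition fourier_series c : vec -> C := fun x =>
  (trig_series B (fun k => complex.Re (c k)) (fun k => - complex.Im (c k)) x +i*
   trig_series B (fun k => complex.Im (c k)) (fun k => complex.Re (c k)) x)%C.

Lemma coef_decay_fourier_series c rho M : (forall k, cabs (c k) <= M * expR (- (rho * pow_norm s (al k)))) ->
  coef_decay B s rho (2 * M) (fun k => complex.Re (c k)) (fun k => - complex.Im (c k)) /\
  coef_decay B s rho (2 * M) (fun k => complex.Im (c k)) (fun k => complex.Re (c k)).
Proof.
move=> H; have P k : `|complex.Re (c k)| + `|complex.Im (c k)| <= 2 * M * expR (- (rho * pow_norm s (al k))).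
  have h1 := cabs_re (c k); have h2 := cabs_im (c k); have h3 := H k.
  rewrite -mulrA mulr_natl mulr2n; apply: lerD; exact: le_trans h3.
by split=> k; [rewrite normrN|rewrite addrC]; exact: P.
Qed.

Lemma fourier_series_gevrey c rho M : 0 < rho ->
  (forall k, cabs (c k) <= M * expR (- (2 * d%:R * rho * pow_norm s (al k)))) ->
  exists2 A : R, 0 <= A & forall l x, `|partials l (reF (fourier_series c)) x| <= A * bd s ((s / rho) `^ s) l /\
    `|partials l (imF (fourier_series c)) x| <= A * bd s ((s / rho) `^ s) l.
Proof.
move=> r0 /coef_decay_fourier_series [D1 D2].
have [A1 A10 H1] := trig_series_bound uB s0 d0 r0 D1; have [A2 A20 H2] := trig_series_bound uB s0 d0 r0 D2.
exists (A1 + A2); first exact: addr_ge0.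
move=> l x; have b0 : 0 <= bd s ((s / rho) `^ s) l by rewrite bd_ge0// powR_ge0.
by split; rewrite mulrDl; [apply: le_trans (H1 l x) _; rewrite lerDl mulr_ge0|
  apply: le_trans (H2 l x) _; rewrite lerDr mulr_ge0].
Qed.

Lemma fourier_series_gevrey_on c rho M X : 0 < rho ->
  (forall k, cabs (c k) <= M * expR (- (2 * d%:R * rho * pow_norm s (al k)))) ->
  gevrey_on s ((s / rho) `^ s) X (fourier_series c).
Proof.
move=> r0 /(fourier_series_gevrey r0) [A A0 HA]; exists (2 * A) => a x _.
have [h1 h2] := HA (lst a) x.
have bdE : bd s ((s / rho) `^ s) (lst a) = ((s / rho) `^ s) ^+ mabs a * (mfact a)%:R `^ s.
  by rewrite /bd -mabs_cnt /lf cnt_lst.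
rewrite bdE in h1 h2.
apply: le_trans (cabs_le _) _; rewrite /mpartialC /= !mpartial_lst.
by apply: le_trans (lerD h1 h2) _; apply: le_eq; ring.
Qed.

Lemma smooth_fourier_series c rho M : 0 < rho ->
  (forall k, cabs (c k) <= M * expR (- (rho * pow_norm s (al k)))) -> smoothC (fourier_series c).
Proof.
by move=> r0 /coef_decay_fourier_series [D1 D2]; split; [exact: smooth_trig_series D1|exact: smooth_trig_series D2].
Qed.

Lemma periodic_fourier_series c : periodic_fun B (fourier_series c).
Proof. by move=> k y; rewrite /fourier_series !trig_series_periodic. Qed.

Lemma fourier_series_approx c rho M : 0 < rho ->
  (forall k, cabs (c k) <= M * expR (- (rho * pow_norm s (al k)))) ->
  exists2 A : R, 0 <= A & forall K x, cabs (fourier_series c x - \sum_(k <- zbox K) c k * chi B k x) <= A * @tau R d K.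
Proof.
move=> r0 /coef_decay_fourier_series [D1 D2].
have [A1 A10 H1] := trig_series_approx uB s0 r0 D1; have [A2 A20 H2] := trig_series_approx uB s0 r0 D2.
exists (A1 + A2); first exact: addr_ge0.
move=> K x; apply: le_trans (cabs_le _) _; rewrite mulrDl.
rewrite cReD cImD cReN cImN cRe_sum cIm_sum /=.
apply: lerD; [apply: le_trans (H1 K x)|apply: le_trans (H2 K x)]; apply: le_eq; congr (`|_ - _|).
  by apply: eq_bigr => k _; rewrite cReM /trig /=; ring.
by apply: eq_bigr => k _; rewrite cImM /trig /=; ring.
Qed.

Lemma IC_bigsum (I : Type) (r : seq I) (G : I -> vec -> C) (a : I -> C) psi : T psi -> (forall i, T (G i)) ->
  intC (fun y => \sum_(i <- r) a i * G i y) = \sum_(i <- r) a i * intC (G i).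
Proof.
move=> Tp TG; elim: r => [|i r IH].
  have := T_scaleIC 0 s10 t10 Tp; rewrite mul0r big_nil => E; rewrite -[RHS]E.
  by congr intC; apply/funext => y; rewrite big_nil mul0r.
have TS : T (fun y => \sum_(i <- r) a i * G i y).
  by apply: (T_sum s10 t10 _ Tp) => j; exact: T_scale.
have [A1 L1] := T_lipC s10 t10 (TG i); have [A2 L2] := T_lipC s10 t10 TS.
rewrite big_cons -IH -[X in _ = _ + X]mul1r -(IC_lin (a i) 1 L1 L2).
by congr intC; apply/funext => y; rewrite big_cons mul1r.
Qed.

Lemma lipC_sub M M' F psi : lipC M F -> lipC M' psi -> lipC (M + M') (fun y => 1 * F y + -1 * psi y).
Proof.
move=> [a b] [a' b']; have E1 : `|-1| * M' = M' by rewrite normrN1 mul1r.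
split.
  rewrite (_ : reF _ = fun y => reF F y + -1 * reF psi y); last first.
    by apply/funext => y; rewrite /reF cReD !cReM /=; ring.
  by rewrite -E1; apply: lipD => //; exact: lipZ.
rewrite (_ : imF _ = fun y => imF F y + -1 * imF psi y); last first.
  by apply/funext => y; rewrite /imF cImD !cImM /=; ring.
by rewrite -E1; apply: lipD => //; exact: lipZ.
Qed.

(** The box sums converge to [u psi] by hypothesis and to the integral because the series converges
    uniformly at speed [tau] while [psi] is integrable. *)
Lemma fourier_series_rep c rho M : 0 < rho ->
  (forall k, cabs (c k) <= M * expR (- (rho * pow_norm s (al k)))) ->
  (forall psi, T psi -> ccvg (fun K => boxsum K (fun k => c k * intC (fun y => psi y * chi B k y))) (u psi)) ->
  forall psi, T psi -> u psi = intC (fun y => fourier_series c y * psi y).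
Proof.
move=> r0 Hc Hu psi Tp; apply: ccvg_unique (Hu psi Tp) _.
have [A A0 HA] := fourier_series_approx r0 Hc.
have dR : 0 < 2 * d%:R :> R by rewrite mulr_gt0// ltr0n.
have r'0 : 0 < rho / (2 * d%:R) by rewrite divr_gt0.
have Hc' k : cabs (c k) <= M * expR (- (2 * d%:R * (rho / (2 * d%:R)) * pow_norm s (al k))).
  by rewrite [2 * _ * _]mulrC divfK ?gt_eqF.
have [E E0 HE] := fourier_series_gevrey r'0 Hc'; set h := (s / _) `^ s in HE.
have h0 : 0 <= h by exact: powR_ge0.
have sS := smooth_fourier_series r0 Hc.
have bd1' l : (size l <= 1)%N -> bd s h l <= 1 + h.
  case: l => [|j [|//]] _; first by rewrite bd_nil lerDl.
  by rewrite bd1 lerDr.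
have lS1 : lip (fun=> 1) (E * (1 + h) + d%:R * (E * (1 + h))) (reF (fourier_series c)).
  apply: lip1_bounded => [|l x sl]; first by case: sS.
  by apply: le_trans (HE l x).1 _; rewrite ler_wpM2l// bd1'.
have lS2 : lip (fun=> 1) (E * (1 + h) + d%:R * (E * (1 + h))) (imF (fourier_series c)).
  apply: lip1_bounded => [|l x sl]; first by case: sS.
  by apply: le_trans (HE l x).2 _; rewrite ler_wpM2l// bd1'.
have [Mp Lp] := T_lipC s10 t10 Tp.
have [M1 L1] := lipC_mul lS1 lS2 Lp.
have Mp0 := lipC_ge0 Lp.
have key K : cabs (boxsum K (fun k => c k * intC (fun y => psi y * chi B k y)) - intC (fun y => fourier_series c y * psi y))
    <= 2 * (A * @tau R d K * (2 * Mp)) * @CI R d.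
  rewrite boxsumE.
  have Tpc k : T (fun y => psi y * chi B k y) by exact: T_chi.
  have TS : T (fun y => \sum_(k <- zbox K) c k * (psi y * chi B k y)).
    by apply: (T_sum s10 t10 _ Tp) => k; exact: T_scale.
  have [M2 L2] := T_lipC s10 t10 TS.
  rewrite -(IC_bigsum _ _ Tp Tpc) cabs_sub -[X in cabs (X - _)]mul1r -mulN1r -(IC_lin 1 (-1) L1 L2).
  have LL := lipC_sub L1 L2.
  apply: (IC_bound LL) => x.
  rewrite mul1r mulN1r (_ : _ - _ = (fourier_series c x - \sum_(k <- zbox K) c k * chi B k x) * psi x); last first.
    by rewrite mulrBl mulr_suml; congr (_ - _); apply: eq_bigr => k _; ring.
  rewrite cabsM -mulrA; apply: ler_pM; rewrite ?cabs_ge0//.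
  apply: le_trans (cabs_le _) _; rewrite -mulrA mulr_natl mulr2n.
  by case: Lp => -[p _] [q _]; apply: lerD; [exact: p|exact: q].
move=> e e0; pose X := 2 * (A * (2 * Mp)) * @CI R d + 1.
have X0 : 0 < X.
  rewrite /X ltr_wpDl//; apply: mulr_ge0; last exact: CI_ge0.
  by rewrite mulr_ge0// mulr_ge0// mulr_ge0.
have [K0 HK] := @tau_small R d (e / X) (divr_gt0 e0 X0).
exists K0 => K hK; apply: le_lt_trans (key K) _.
have := HK K hK; rewrite ler_pdivlMr// => h1.
have t0 := @tau_ge0 R d K.
have := @CI_ge0 R d => ci.
rewrite [ltLHS](_ : _ = @tau R d K * (X - 1)); last by rewrite /X; ring.
have [->|tn] := eqVneq (@tau R d K) 0; first by rewrite mul0r.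
apply: lt_le_trans h1; rewrite ltr_pM2l; last by rewrite lt_neqAle eq_sym tn.
by rewrite ltrBlDr ltrDl.
Qed.

End Fixed.
End Stft.

(** * The implications between bounds, coefficients and regularity *)

Section Directions.
Local Open Scope ring_scope.
Local Open Scope classical_set_scope.
Context {R : realType} {d : nat}.
Local Notation vec := 'rV[R]_d.
Local Notation C := R[i].
Variables (B : 'M[R]_d) (s t : R).
Hypotheses (d0 : (0 < d)%N) (uB : B \in unitmx) (s0 : 0 < s).
Variables (phi : vec -> C) (sg : bool) (s1 t1 : R) (u : (vec -> C) -> C).
Hypotheses (Hu : GSdist sg s1 t1 u) (Tphi : inGS sg s1 t1 phi).
Local Notation T := (inGS sg s1 t1).
Local Notation D := ((d%:R : R) `^ (1 / s) * 2 `^ (1 / s)).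

Let s10 : 0 < s1. Proof. by case: Hu. Qed.
Let t10 : 0 < t1. Proof. by case: Hu => _ []. Qed.

Lemma dual_to_stft (c : 'rV[int]_d -> C) (eps rho r : R) : 0 < eps -> eps * D < rho -> eps * D < r ->
  phat_decay s phi rho -> coef_growth B s eps c ->
  (forall psi, T psi -> ccvg (fun N => Rc ((2 * pi) `^ (d%:R / 2)) *
     boxsum N (fun k => c k * fourier psi (- dlatt B k))) (u psi)) ->
  stft_bound u phi s r.
Proof.
move=> eps0 er rr ph cg rep.
have e0 : 0 < r - eps * D by rewrite subr_gt0.
have := dual_stft uB s0 s10 t10 Tphi (ltW eps0) e0 er ph cg rep.
by rewrite addrC subrK.
Qed.

Lemma dual_of_rep (every : bool) (c : 'rV[int]_d -> C) :
  (if every then forall eps : R, 0 < eps -> coef_growth B s eps c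
     else exists eps : R, 0 < eps /\ coef_growth B s eps c) ->
  (forall psi, T psi -> ccvg (fun K => boxsum K (fun k => c k * intC (fun y => psi y * chi B k y))) (u psi)) ->
  in_dual_Gevrey every B s T u.
Proof.
move=> gr rep; exists c; split=> // psi Tp e e0; have [N0 HN] := rep psi Tp e e0.
by exists N0 => N hN; rewrite dual_sumE; exact: HN.
Qed.

Lemma gevrey_on_mono h h' (X : set vec) (F : vec -> C) M : 0 <= h -> h <= h' ->
  (forall (a : 'I_d -> nat) (x : vec), X x ->
    cabs (mpartialC a F x) <= M * h ^+ mabs a * ((mfact a)%:R `^ s)) -> gevrey_on s h' X F.
Proof.
move=> h0 hh H; exists `|M| => a x Xx; apply: le_trans (H a x Xx) _.
rewrite ler_wpM2r ?powR_ge0//.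
apply: (@le_trans _ _ (`|M| * h ^+ mabs a)); first by rewrite ler_wpM2r ?exprn_ge0 ?ler_norm.
by rewrite ler_wpM2l// lerXn2r ?nnegrE// (le_trans h0).
Qed.

Lemma gevrey_to_stft (h : R) (F : vec -> C) : 0 < h -> (exists M, GBW s t h M phi) ->
  smoothC F -> gevrey_on s h (cell B) F -> periodic_fun B F ->
  (forall psi, T psi -> u psi = intC (fun y => F y * psi y)) ->
  stft_bound u phi s (- (decay_rate s (2 * h) / d%:R `^ (1 / s))).
Proof.
move=> h0 [M' Hp] sF gF pF rep; have [M HM] := periodic_DBC uB pF sF gF.
exact: (gevrey_stft d0 s0 s10 t10 Tphi h0 HM Hp rep).
Qed.

End Directions.

Local Open Scope ring_scope.

(* E = parallelepiped spanned by the rows of B (B invertible: non-degenerate).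
   The Gelfand-Shilov distribution f is modelled as a continuous linear
   functional u on a Gelfand-Shilov test space T = S_{t0}^{s0} (sig0 = false)
   or Sigma_{t0}^{s0} (sig0 = true), with phi in T so that V_phi f is defined. *)
Theorem theorem3p4 (R : realType) (d : nat) (B : 'M[R]_d) (s t : R) :
  (0 < d)%N -> B \in unitmx -> 0 < s -> 0 < t ->
  (* case phi in S_t^s \ {0} *)
  (forall phi : 'rV[R]_d -> R[i],
     inGS false s t phi -> phi <> (fun _ => 0) ->
     forall (sig0 : bool) (s0 t0 : R) (u : ('rV[R]_d -> R[i]) -> R[i]),
       GSdist sig0 s0 t0 u -> inGS sig0 s0 t0 phi ->
       periodic_dist B (inGS sig0 s0 t0) u ->
       (in_dual_Gevrey true B s (inGS sig0 s0 t0) u <->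
          (forall r : R, 0 < r -> stft_bound u phi s r)) /\
       (in_Gevrey true B s (inGS sig0 s0 t0) u <->
          (exists r : R, 0 < r /\ stft_bound u phi s (- r)))) /\
  (* case phi in Sigma_t^s \ {0} *)
  (forall phi : 'rV[R]_d -> R[i],
     inGS true s t phi -> phi <> (fun _ => 0) ->
     forall (sig0 : bool) (s0 t0 : R) (u : ('rV[R]_d -> R[i]) -> R[i]),
       GSdist sig0 s0 t0 u -> inGS sig0 s0 t0 phi ->
       periodic_dist B (inGS sig0 s0 t0) u ->
       (in_dual_Gevrey false B s (inGS sig0 s0 t0) u <->
          (exists r : R, 0 < r /\ stft_bound u phi s r)) /\
       (in_Gevrey false B s (inGS sig0 s0 t0) u <->
          (forall r : R, 0 < r -> stft_bound u phi s (- r)))).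
Proof.
move=> d0 uB s0 t0; split=> phi /(inGSP _ _ s0 t0)[sphi Hphi] p0 sg s1 t1 u Hu Tphi pu.
- have [h [h0 [M HM]]] := Hphi.
  have ph := GBW_phat d0 s0 h0 HM; set rho := decay_rate s h in ph.
  have r0 : 0 < rho := decay_rate_gt0 s0 h0.
  have [s10 [t10 [lu cu]]] := Hu.
  pose D := (d%:R : R) `^ (1 / s) * 2 `^ (1 / s); have D0 : 0 < D := D_gt0 s d0.
  have [c [eta [A [A0 Hc rep]]]] := rep_phi uB s10 t10 lu cu pu Tphi p0.
  split; split.
  (* Here the window has one fixed rate [rho], so [eps * D] has to lie below both [rho] and [r];
     growth for every [eps] permits this choice. *)
  + move=> [c' [gr rep']] r r1; pose eps := Num.min (r / 2) (rho / 2) / D.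
    have m0 : 0 < Num.min (r / 2) (rho / 2) by rewrite lt_min !divr_gt0.
    have e0 : 0 < eps by rewrite divr_gt0.
    have eD : eps * D = Num.min (r / 2) (rho / 2) by rewrite /eps divfK// gt_eqF.
    have m1 : Num.min (r / 2) (rho / 2) <= r / 2 by rewrite ge_min lexx.
    have m2 : Num.min (r / 2) (rho / 2) <= rho / 2 by rewrite ge_min lexx orbT.
    by apply: (dual_to_stft uB s0 Hu Tphi e0 _ _ ph (gr eps e0) rep'); rewrite -/D eD; lra.
  + move=> Hb; apply: (dual_of_rep (every := true) _ rep) => eps e0.
    have q0 : 0 < eps / D by rewrite divr_gt0.
    have := stft_coef s0 (ltW q0) A0 Hc (Hb _ q0).
    by rewrite -/D divfK// gt_eqF.
  + move=> [F [[sF gF] [pF Fu]]].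
    have [h1 [h10 [MF gc]]] := gF _ (@compact_cell _ _ B).
    (* [phi] and [F] come with their own scales, and the product estimate needs a common one. *)
    have hm : 0 < Num.max h h1 by rewrite lt_max h0.
    eexists; split; last apply: (gevrey_to_stft d0 uB s0 Hu Tphi hm _ sF _ pF Fu).
    * by rewrite divr_gt0 ?powR_gt0 ?ltr0n// decay_rate_gt0// mulr_gt0.
    * exists M; apply: GBW_mono HM => //; first exact: ltW.
      by rewrite le_max lexx.
    * by apply: (gevrey_on_mono (ltW h10) _ gc); rewrite le_max lexx orbT.
  + move=> [r [r1 Hb]].
    have [M' Hd] := stft_coef_decay s0 r1 A0 Hc Hb.
    have q0 : 0 < r / 2 `^ (1 / s) by rewrite divr_gt0// powR_gt0.
    have dR : 0 < 2 * d%:R :> R by rewrite mulr_gt0// ltr0n.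
    exists (fourier_series B c); split; [split|split].
    * exact: (smooth_fourier_series uB s0 q0 Hd).
    (* The coefficients decay at rate [r / 2^(1/s)], of which [trig_series_bound] spends a factor
       [2 d]; [(s / rho)^s] is the Gevrey constant of the rate [rho] that remains. *)
    * move=> X _; exists ((s / (r / 2 `^ (1 / s) / (2 * d%:R))) `^ s); split.
        by rewrite powR_gt0// divr_gt0// divr_gt0.
      apply: (fourier_series_gevrey_on d0 uB s0 (M := M')) => [|k]; first by rewrite divr_gt0.
      by rewrite [2 * d%:R * _]mulrC divfK ?gt_eqF.
    * exact: periodic_fourier_series.
    * by move=> psi; exact: (fourier_series_rep d0 uB s0 s10 t10 q0 Hd rep).
- have [s10 [t10 [lu cu]]] := Hu.
  pose D := (d%:R : R) `^ (1 / s) * 2 `^ (1 / s); have D0 : 0 < D := D_gt0 s d0.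
  have [c [eta [A [A0 Hc rep]]]] := rep_phi uB s10 t10 lu cu pu Tphi p0.
  split; split.
  + move=> [c' [[eps [e0 gr]] rep']]; exists (eps * D + 1).
    have eD : 0 < eps * D by rewrite mulr_gt0.
    split; first by lra.
    have q0 : 0 < eps * D + 1 by lra.
    (* The growth [eps] is given, and the window adapts to it: a rate above [eps * D] is
       available. *)
    have [h h0 rh] := decay_rate_onto s0 q0; have [M HM] := Hphi h h0.
    have ph := GBW_phat d0 s0 h0 HM; rewrite rh in ph.
    by apply: (dual_to_stft uB s0 Hu Tphi e0 _ _ ph gr rep'); rewrite -/D; lra.
  + move=> [r [r0 Hb]]; apply: (dual_of_rep (every := false) _ rep); exists (r * D).
    by split; [rewrite mulr_gt0|exact: (stft_coef s0 (ltW r0) A0 Hc Hb)].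
  + move=> [F [[sF gF] [pF Fu]]] r r0.
    have dd : 0 < (d%:R : R) `^ (1 / s) by rewrite powR_gt0// ltr0n.
    have q0 : 0 < r * (d%:R : R) `^ (1 / s) by rewrite mulr_gt0.
    (* Half the scale, because [gevrey_to_stft] yields the rate of [2 * h]; the factor [d^(1/s)] in
       [q0] compensates its denominator. *)
    have [h h0 rh] := decay_rate_onto s0 q0; have h2 : 0 < h / 2 by rewrite divr_gt0.
    have := gevrey_to_stft d0 uB s0 Hu Tphi h2 (Hphi _ h2) sF (gF _ (@compact_cell _ _ B) _ h2) pF Fu.
    by rewrite [2 * _]mulrC divfK// rh mulfK// gt_eqF.
  + move=> Hb; have p2 : 0 < 2 `^ (1 / s) :> R by rewrite powR_gt0.
    have coef_decay r : 0 < r -> exists M : R, forall k, cabs (c k) <= M * expR (- (r * pow_norm s (dlatt B k))).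
      move=> r0; have q0 : 0 < r * 2 `^ (1 / s) by rewrite mulr_gt0.
      have [M HM] := stft_coef_decay s0 q0 A0 Hc (Hb _ q0).
      by exists M => k; have := HM k; rewrite mulfK// gt_eqF.
    have [M1 HM1] := coef_decay 1 ltr01.
    have dR : 0 < 2 * d%:R :> R by rewrite mulr_gt0// ltr0n.
    exists (fourier_series B c); split; [split|split].
    * exact: (smooth_fourier_series uB s0 ltr01 HM1).
    (* Inverts [h = (s / rho)^s], since any prescribed Gevrey constant [h] must be reached. *)
    * move=> X _ h h0; pose rho := s / h `^ (1 / s).
      have r0 : 0 < rho by rewrite divr_gt0// powR_gt0.
      have [M HM] := coef_decay _ (mulr_gt0 dR r0).
      have -> : h = (s / rho) `^ s.
        rewrite /rho invf_div mulrC divfK ?gt_eqF// -powRrM (_ : 1 / s * s = 1).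
          by rewrite powRr1// ltW.
        by field; rewrite gt_eqF.
      exact: (fourier_series_gevrey_on d0 uB s0 X r0 HM).
    * exact: periodic_fourier_series.
    * by move=> psi; exact: (fourier_series_rep d0 uB s0 s10 t10 ltr01 HM1 rep).
Qed.
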